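(* Every $3$-connected $\{K_{1,3},Z_{2}\}$-free graph has a spanning Halin subgraph.
   Context: All graphs are finite and simple. A graph is $\mathcal{F}$-free if it contains no member of $\mathcal{F}$ as an induced subgraph. $K_{1,3}$ is the star with three leaves. $Z_2$ is the graph obtained from a triangle $abc$ by adding a path $ade$ with new vertices $d,e$ (edges $ab,bc,ca,ad,de$). A Halin graph is a plane graph $T\cup C$ consisting of a tree $T$ having no vertex of degree $2$ and a cycle $C$ whose vertex set is exactly the set of leaves of $T$ (the union being embeddable in the plane without crossings). A spanning Halin subgraph of $G$ is a spanning subgraph of $G$ that is a Halin graph. *)

(* Defs.v *)
From mathcomp Require Import all_boot all_order all_algebra.
From mathcomp Require Import boolp classical_sets functions set_interval reals.
From mathcomp Require Import topology normedtype.

Set Implicit Arguments.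
Unset Strict Implicit.
Unset Printing Implicit Defensive.

Import Order.TTheory GRing.Theory Num.Theory.
Import numFieldNormedType.Exports.

Record sgraph (V : finType) := SGraph {
  adj :> rel V;
  adj_sym : symmetric adj;
  adj_irrefl : irreflexive adj
}.

Definition degree (V : finType) (G : sgraph V) (x : V) : nat := #|adj G x|.

Definition connected_graph (V : finType) (G : sgraph V) : Prop :=
  0 < #|V| /\ forall x y : V, connect G x y.

Definition k_connected (k : nat) (V : finType) (G : sgraph V) : Prop :=
  k < #|V| /\
  forall S : {set V}, #|S| < k ->
  forall x y : V, x \notin S -> y \notin S ->
  connect [rel u v | [&& G u v, u \notin S & v \notin S]] x y.

Definition induced_subgraph (W V : finType) (H : sgraph W) (G : sgraph V) :
    Prop :=
  exists f : W -> V, injective f /\ forall u v : W, G (f u) (f v) = H u v.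

Definition induced_free (W V : finType) (H : sgraph W) (G : sgraph V) : Prop :=
  ~ induced_subgraph H G.

(* The centre of the star is 0. *)
Definition K13_adj : rel 'I_4 := [rel i j | (val i == 0) (+) (val j == 0)].

Lemma K13_sym : symmetric K13_adj.
Proof. by move=> i j; rewrite /K13_adj /= addbC. Qed.

Lemma K13_irrefl : irreflexive K13_adj.
Proof. by move=> i; rewrite /K13_adj /= addbb. Qed.

Definition K13 : sgraph 'I_4 := SGraph K13_sym K13_irrefl.

(* The triangle a b c is 0 1 2 and the pendant path a d e is 0 3 4. *)
Definition Z2_edges : seq (nat * nat) :=
  [:: (0, 1); (1, 2); (2, 0); (0, 3); (3, 4)].

Definition Z2_adj : rel 'I_5 :=
  [rel i j | ((val i, val j) \in Z2_edges) || ((val j, val i) \in Z2_edges)].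

Lemma Z2_sym : symmetric Z2_adj.
Proof. by move=> i j; rewrite /Z2_adj /= orbC. Qed.

Lemma Z2_irrefl : irreflexive Z2_adj.
Proof. by case=> [[|[|[|[|[|n]]]]] lt_n5]. Qed.

Definition Z2 : sgraph 'I_5 := SGraph Z2_sym Z2_irrefl.

(* A ucycle of size 2 only traverses an edge back and forth. *)
Definition acyclic (V : finType) (G : sgraph V) : Prop :=
  forall p : seq V, ucycle G p -> size p < 3.

Definition is_tree (V : finType) (G : sgraph V) : Prop :=
  connected_graph G /\ acyclic G.

Definition cycle_adj (V : finType) (p : seq V) : rel V :=
  [rel x y | [&& x \in p, y \in p & (next p x == y) || (next p y == x)]].

Section PlaneGraphs.
Local Open Scope classical_set_scope.
Local Open Scope ring_scope.

Definition is_arc (R : realType) (a b : R * R) (A : set (R * R)) : Prop :=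
  exists g : R -> R * R,
    [/\ {within `[0, 1], continuous g},
        {in `[0, 1] &, injective g},
        g 0 = a, g 1 = b & A = g @` `[0, 1]].

(* [pos] places the vertices and [arc x y] is the closed arc drawn for the edge
   xy: the interior of an edge contains no vertex and no point of any other
   edge. *)
Definition plane_embedding (R : realType) (V : finType) (G : sgraph V)
    (pos : V -> R * R) (arc : V -> V -> set (R * R)) : Prop :=
  let inner x y := arc x y `\` [set pos x; pos y] in
  [/\ injective pos,
      forall x y, G x y ->
        is_arc (pos x) (pos y) (arc x y) /\ arc x y = arc y x,
      forall x y z, G x y -> ~ inner x y (pos z) &
      forall x y u v, G x y -> G u v -> (x, y) != (u, v) -> (x, y) != (v, u) ->
        inner x y `&` arc u v = set0].

Definition planar (R : realType) (V : finType) (G : sgraph V) : Prop :=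
  exists (pos : V -> R * R) (arc : V -> V -> set (R * R)),
    plane_embedding G pos arc.

End PlaneGraphs.

(* The cycle C is given by the cyclic sequence [p] of its vertices. *)
Definition halin (R : realType) (V : finType) (H : sgraph V) : Prop :=
  exists (T : sgraph V) (p : seq V),
    [/\ is_tree T /\ (forall x : V, degree T x <> 2),
        uniq p /\ 2 < size p,
        forall x : V, x \in p <-> degree T x = 1,
        forall x y : V, H x y = T x y || cycle_adj p x y &
        planar R H].

Definition has_spanning_halin_subgraph (R : realType) (V : finType)
    (G : sgraph V) : Prop :=
  exists H : sgraph V, (forall x y : V, H x y -> G x y) /\ halin R H.

(* Main.v *)
Require Import Defs.
From mathcomp Require Import all_boot all_order all_algebra.
From mathcomp Require Import reals.
From mathcomp Require boolp classical_sets functions set_interval topology normedtype.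
From mathcomp Require Import zify ring lra.

(** Let G be a 3-connected graph without induced claw or Z2.  In every case the
    spanning Halin subgraph found has a caterpillar as its tree: a path of hubs
    with the leaves hanging from it, all of them but at most one on the same side,
    which admits an explicit straight-line drawing.

    If G has no independent triple, let e be a vertex with the largest possible
    set M of non-neighbours.  M is a clique, and a neighbour of e with a neighbour
    in M misses at most one vertex of M, since otherwise there is an induced Z2.
    As a graph without independent triple has a Hamilton path or is the disjoint
    union of two cliques, the neighbours of e can be arranged in one or two runs,
    and these are closed to a cycle through M; the maximality of M provides the
    required distinct attachments.

    If G has an independent triple and two vertices at distance 3, then G is a
    clique together with an independent set whose members have pairwise disjoint
    neighbourhoods.  Otherwise the triple x, y, z has pairwise common neighbours;
    these six vertices induce a hexagon, a hexagon with two chords or the 3-sun.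
    The 3-sun forces a clique with three further vertices, and the other two
    force the line graph of K33 or of K33 minus an edge. *)

(** Planarity is a statement about arcs in the real plane, so it is settled once, for one shape of
    drawing. After that a case is closed by exhibiting lists of hubs and leaves that meet the
    covering, adjacency and degree conditions of [halin_frame]. All frames are one-sided except
    those for the line graphs of K33 and of K33 minus an edge; for K33 the middle one of three hubs
    carries a leaf on each side. 3-connectivity enters through four consequences: there are at least
    four vertices, the graph is connected, every vertex has three neighbours, and at least three
    neighbours of e see M, because these neighbours separate e from M. Maximality of M is used in
    one way: a vertex with j exhibited non-neighbours forces |M| >= j. When two attachments of the
    rim in M would coincide, some vertex has too many non-neighbours; this is either a contradiction
    or yields a further vertex of M to attach to. The values 0, 1 and 2 of |M| leave little room and
    get frames of their own. *)

Set Implicit Arguments.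
Unset Strict Implicit.
Unset Printing Implicit Defensive.
Import Order.TTheory GRing.Theory Num.Theory.

(** * Straight-line drawings *)

Section Segments.
Import boolp classical_sets functions set_interval topology normedtype.
Import numFieldNormedType.Exports.
Local Open Scope classical_set_scope.
Local Open Scope ring_scope.
Variable R : realType.
Implicit Types a b : R * R.

Definition seg_point a b (t : R) : R * R :=
  (a.1 + t * (b.1 - a.1), a.2 + t * (b.2 - a.2)).

Definition segment a b : set (R * R) := seg_point a b @` `[0, 1].

Lemma seg_point_continuous a b : continuous (seg_point a b).
Proof.
move=> t; apply: (@cvg_pair _ _ _ _ (nbhs _) (nbhs _)) => /=;
by apply: cvgD; [exact: cvg_cst | apply: cvgM; [exact: cvg_id | exact: cvg_cst]].
Qed.

Lemma seg_point_inj a b : a <> b -> injective (seg_point a b).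
Proof.
case: a b => a1 a2 [b1 b2] neq s t [] /= /addrI e1 /addrI e2.
case: (eqVneq s t) => // nst; case: neq.
have cancel0 u : s * u = t * u -> u = 0.
  move=> /eqP; rewrite -subr_eq0 -mulrBl mulf_eq0 subr_eq0 (negPf nst).
  by move/eqP.
by congr pair; apply/esym/subr0_eq/cancel0.
Qed.

Lemma segment_arc a b : a <> b -> is_arc a b (segment a b).
Proof.
move=> neq; exists (seg_point a b); split => //.
- exact/continuous_subspaceT/seg_point_continuous.
- by move=> s t _ _; exact: seg_point_inj.
- by case: a {neq} => a1 a2; rewrite /seg_point !mul0r !addr0.
- by case: a b {neq} => a1 a2 [b1 b2]; rewrite /seg_point /= !mul1r !subrKC.
Qed.

Lemma segmentC a b : segment a b = segment b a.
Proof.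
suff sub c d : segment c d `<=` segment d c by apply/seteqP; split; apply: sub.
move=> q [t]; rewrite /= in_itv /= => /andP[t0 t1] <-.
exists (1 - t) => /=.
  by rewrite in_itv /=; apply/andP; split; lra.
by case: c d => c1 c2 [d1 d2]; rewrite /seg_point /=; congr pair; ring.
Qed.

Lemma segment_start a b : segment a b a.
Proof.
exists 0 => /=; first by rewrite in_itv /= lexx ler01.
by case: a => a1 a2; rewrite /seg_point !mul0r !addr0.
Qed.

(** One-sided like the last clause of [plane_embedding]: a shared point must be an end of the first
    segment. Quantifying over all pairs of edges covers both orders. *)
Definition noncrossing a b c d : Prop :=
  forall q, segment a b q -> segment c d q -> q = a \/ q = b.

(** [E] need only contain one direction of each edge. That no vertex lies inside an edge also comes
    from [noncrossing]: a vertex has an incident edge, so it would be a point shared by two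
    segments, hence an end of the first. *)
Lemma straight_line_planar (V : finType) (H : sgraph V) (E : rel V)
    (pos : V -> R * R) :
  injective pos -> (forall x y, H x y = E x y || E y x) ->
  (forall x, exists y, H x y) ->
  (forall x y u v, E x y -> E u v -> (x, y) != (u, v) -> (x, y) != (v, u) ->
     noncrossing (pos x) (pos y) (pos u) (pos v)) ->
  planar R H.
Proof.
move=> pos_inj HE H_nbr nc.
have nbr_neq x y : H x y -> pos x <> pos y.
  by move=> + /pos_inj eq_xy; rewrite eq_xy adj_irrefl.
have {}nc x y u v : H x y -> H u v -> (x, y) != (u, v) -> (x, y) != (v, u) ->
    noncrossing (pos x) (pos y) (pos u) (pos v).
  have swap a b c d : noncrossing a b c d -> noncrossing b a c d.
    by move=> h q; rewrite segmentC => hq /(h _ hq)[]; [right|left].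
  have swapr a b c d : noncrossing a b c d -> noncrossing a b d c.
    by move=> h q hq; rewrite segmentC => /(h _ hq).
  rewrite !HE => /orP[Exy|Eyx] /orP[Euv|Evu] n1 n2.
  - exact: nc.
  - exact/swapr/nc.
  - by apply/swap/nc; rewrite // xpair_eqE andbC -xpair_eqE.
  - by apply/swap/swapr/nc; rewrite // xpair_eqE andbC -xpair_eqE.
exists pos, (fun x y => segment (pos x) (pos y)); split => //.
- by move=> x y Hxy; split; [exact/segment_arc/nbr_neq | exact: segmentC].
- move=> x y z Hxy [seg_z /not_orP[zx zy]].
  have [w Hzw] := H_nbr z.
  have nzx : z != x by apply/eqP => e; apply: zx; rewrite e.
  have nzy : z != y by apply/eqP => e; apply: zy; rewrite e.
  have n1 : (x, y) != (z, w) by rewrite xpair_eqE eq_sym (negPf nzx).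
  have n2 : (x, y) != (w, z).
    by rewrite xpair_eqE [y == _]eq_sym (negPf nzy) andbF.
  by have [|] := nc _ _ _ _ Hxy Hzw n1 n2 _ seg_z (segment_start _ _).
- move=> x y u v Hxy Huv n1 n2; apply/seteqP; split => // q.
  by move=> [[hq nq] /(nc _ _ _ _ Hxy Huv n1 n2 _ hq)].
Qed.

End Segments.

(** * Coordinates for a caterpillar with its rim *)

Section CaterpillarDrawing.
Import boolp classical_sets functions set_interval topology normedtype.
Import numFieldNormedType.Exports.
Local Open Scope ring_scope.
Variables (R : realType) (k m : nat) (o : nat -> nat) (L : nat -> R).
Hypothesis o_lt : forall j, (o j < k)%N.
Hypothesis o_mono : forall i j, (0 < i)%N -> (i <= j <= m)%N -> (o i <= o j)%N.
Hypothesis L_mono : forall i j, (i < j)%N -> L i < L j.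
Hypothesis m_gt1 : (1 < m)%N.
(** The rim edges at the top leaf cross the height 1 of the spine at half of [o 0 + L 1] and at half
    of [o 0 + L m]. The two bounds place these points left of 0 and right of k - 1, off the
    spine. *)
Hypothesis L_first : (o 0)%:R + L 1 < 0.
Hypothesis L_last : 2 * k%:R <= (o 0)%:R + L m.

(* The k spine vertices sit at (i, 1), the leaves j = 1, ..., m at (L j, 0), and
   the leaf j hangs from the spine vertex o j.  The leaf 0 sits above its spine
   vertex, at height 2; the rim edges from there to the leaves 1 and m pass left
   and right of the spine. *)
Variant drawn_edge : R * R -> R * R -> Prop :=
| SpineEdge i of (i.+1 < k)%N : drawn_edge (i%:R, 1) (i.+1%:R, 1)
| Leg j of (0 < j <= m)%N : drawn_edge ((o j)%:R, 1) (L j, 0)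
| TopLeg : drawn_edge ((o 0)%:R, 1) ((o 0)%:R, 2)
| RimEdge j of (0 < j < m)%N : drawn_edge (L j, 0) (L j.+1, 0)
| LeftRimEdge : drawn_edge ((o 0)%:R, 2) (L 1, 0)
| RightRimEdge : drawn_edge (L m, 0) ((o 0)%:R, 2).

Lemma horizontal_segment (a b y X Y : R) : a <= b ->
  segment (a, y) (b, y) (X, Y) -> [/\ Y = y, a <= X & X <= b].
Proof.
move=> ab [t]; rewrite /= in_itv /= => /andP[t0 t1] [<- <-].
by split; nra.
Qed.

Lemma leg_segment (a b X Y : R) :
  segment (a, 1) (b, 0) (X, Y) ->
  [/\ 0 <= Y, Y <= 1 & X = Y * a + (1 - Y) * b].
Proof.
move=> [t]; rewrite /= in_itv /= => /andP[t0 t1] [<- <-].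
by split; [lra | lra | ring].
Qed.

Lemma vertical_segment (a X Y : R) :
  segment (a, 1) (a, 2) (X, Y) -> [/\ X = a, 1 <= Y & Y <= 2].
Proof.
move=> [t]; rewrite /= in_itv /= => /andP[t0 t1] [<- <-].
by split; lra.
Qed.

Lemma top_segment (a b X Y : R) :
  segment (a, 2) (b, 0) (X, Y) ->
  [/\ 0 <= Y, Y <= 2 & 2 * X = Y * a + (2 - Y) * b].
Proof.
move=> [t]; rewrite /= in_itv /= => /andP[t0 t1] [<- <-].
by split; [lra | lra | ring].
Qed.

(** The nonlinear step that linear arithmetic cannot make: [t] is the vertical distance of a common
    point from an end, and the difference of two line equations has this form. *)
Lemma null_weight (t u v : R) :
  0 <= t -> 0 <= u -> 0 < v -> u + t * v = 0 -> t = 0.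
Proof.
move=> t0 u0 v0 e; case: (ltgtP 0 t) t0 => // t0 _.
by have := mulr_gt0 t0 v0; lra.
Qed.

Lemma drawn_noncrossing A B C D :
  drawn_edge A B -> drawn_edge C D -> (A, B) <> (C, D) -> noncrossing A B C D.
Proof.
have nat1 (i : nat) : i.+1%:R = i%:R + 1 :> R by rewrite natr1.
have lt_nat (i j : nat) : (i < j)%N -> i%:R + 1 <= j%:R :> R.
  by rewrite natr1 ler_nat.
have lt_or (i j : nat) : i <> j -> i%:R + 1 <= j%:R :> R \/ j%:R + 1 <= i%:R :> R.
  by move=> /eqP; rewrite neq_ltn => /orP[] /lt_nat; [left|right].
have le_or (i j : nat) : i%:R <= j%:R :> R \/ j%:R + 1 <= i%:R :> R.
  by case: (leqP i j) => [|/lt_nat]; [rewrite -(ler_nat R); left | right].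
have L_le i j : (i <= j)%N -> L i <= L j.
  by rewrite leq_eqVlt => /orP[/eqP -> // | /L_mono /ltW].
have ge0 j : 0 <= j%:R :> R by rewrite ler0n.
have o_bd j : 0 <= (o j)%:R :> R /\ (o j)%:R + 1 <= k%:R :> R.
  by split; [exact: ge0 | exact: lt_nat].
have [o0 ok] := o_bd 0%N.
have L1m : L 1 < L m by exact: L_mono.
have Lneg := L_first; have Lpos := L_last.
move=> [i ik|j jm||j jm||] [i' ik'|j' jm'||j' jm'||] neq [X Y] //.
- move=> /horizontal_segment[]; first by rewrite nat1; lra.
  rewrite nat1 => Y1 A1 B1; have := lt_nat _ _ ik; rewrite nat1 => ub1.
  have lb1 := ge0 i.
  move=> /horizontal_segment[]; first by rewrite nat1; lra.
  rewrite nat1 => Y2 A2 B2; have := lt_nat _ _ ik'; rewrite nat1 => ub2.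
  have lb2 := ge0 i'.
  have /lt_or[h|h] : i <> i' by move=> e; apply: neq; rewrite e.
    by right; congr pair; lra.
  by left; congr pair; lra.
- move=> /horizontal_segment[]; first by rewrite nat1; lra.
  rewrite nat1 => Y1 A1 B1; have := lt_nat _ _ ik; rewrite nat1 => ub1.
  have lb1 := ge0 i.
  move=> /leg_segment[A2 B2 X2]; have /andP[j_gt2 j_le2] := jm'.
  have [oj2 ojk2] := o_bd j'; have L12 := L_le _ _ j_gt2; have Lm2 := L_le _ _ j_le2.
  rewrite Y1 in X2 *.
  by case: (le_or (o j') i) => h; [left | right]; congr pair; lra.
- move=> /horizontal_segment[]; first by rewrite nat1; lra.
  rewrite nat1 => Y1 A1 B1; have := lt_nat _ _ ik; rewrite nat1 => ub1.
  have lb1 := ge0 i.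
  move=> /vertical_segment[X2 A2 B2].
  by case: (le_or (o 0) i) => h; [left | right]; congr pair; lra.
- move=> /horizontal_segment[]; first by rewrite nat1; lra.
  rewrite nat1 => Y1 A1 B1; have := lt_nat _ _ ik; rewrite nat1 => ub1.
  have lb1 := ge0 i.
  move=> /horizontal_segment[]; first exact/ltW/L_mono.
  move=> Y2 A2 B2; have /andP[j_gt2 j_lt2] := jm'.
  by exfalso; lra.
- move=> /horizontal_segment[]; first by rewrite nat1; lra.
  rewrite nat1 => Y1 A1 B1; have := lt_nat _ _ ik; rewrite nat1 => ub1.
  have lb1 := ge0 i.
  move=> /top_segment[A2 B2 X2].
  by exfalso; rewrite Y1 in X2; lra.
- move=> /horizontal_segment[]; first by rewrite nat1; lra.
  rewrite nat1 => Y1 A1 B1; have := lt_nat _ _ ik; rewrite nat1 => ub1.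
  have lb1 := ge0 i.
  rewrite segmentC => /top_segment[A2 B2 X2].
  by exfalso; rewrite Y1 in X2; lra.
- move=> /leg_segment[A1 B1 X1]; have /andP[j_gt1 j_le1] := jm.
  have [oj1 ojk1] := o_bd j; have L11 := L_le _ _ j_gt1; have Lm1 := L_le _ _ j_le1.
  move=> /horizontal_segment[]; first by rewrite nat1; lra.
  rewrite nat1 => Y2 A2 B2; have := lt_nat _ _ ik'; rewrite nat1 => ub2.
  have lb2 := ge0 i'.
  by left; rewrite Y2 in X1 *; congr pair; lra.
- move=> /leg_segment[A1 B1 X1]; have /andP[j_gt1 j_le1] := jm.
  have [oj1 ojk1] := o_bd j; have L11 := L_le _ _ j_gt1; have Lm1 := L_le _ _ j_le1.
  move=> /leg_segment[A2 B2 X2]; have /andP[j_gt2 j_le2] := jm'.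
  have [oj2 ojk2] := o_bd j'; have L12 := L_le _ _ j_gt2; have Lm2 := L_le _ _ j_le2.
  (* Legs are ordered alike at both ends, weakly by [o] and strictly by [L], so two of them meet at
     height 1 only. *)
  have Y1 : 1 - Y = 0.
    have /eqP : j <> j' by move=> e; apply: neq; rewrite e.
    rewrite neq_ltn => /orP[] lt_j; have lt_L := L_mono lt_j.
      have o1 : (o j)%:R <= (o j')%:R :> R.
        by rewrite ler_nat o_mono // (ltnW lt_j).
      apply: (@null_weight _ (Y * ((o j')%:R - (o j)%:R)) (L j' - L j)); try lra.
      by apply: mulr_ge0; lra.
    have o1 : (o j')%:R <= (o j)%:R :> R.
      by rewrite ler_nat o_mono // (ltnW lt_j).
    apply: (@null_weight _ (Y * ((o j)%:R - (o j')%:R)) (L j - L j')); try lra.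
    by apply: mulr_ge0; lra.
  have {}Y1 : Y = 1 by lra.
  by left; rewrite Y1 in X1 *; congr pair; lra.
- move=> /leg_segment[A1 B1 X1]; have /andP[j_gt1 j_le1] := jm.
  have [oj1 ojk1] := o_bd j; have L11 := L_le _ _ j_gt1; have Lm1 := L_le _ _ j_le1.
  move=> /vertical_segment[X2 A2 B2].
  have Y1 : Y = 1 by lra.
  by left; rewrite Y1 in X1 *; congr pair; lra.
- move=> /leg_segment[A1 B1 X1]; have /andP[j_gt1 j_le1] := jm.
  have [oj1 ojk1] := o_bd j; have L11 := L_le _ _ j_gt1; have Lm1 := L_le _ _ j_le1.
  move=> /horizontal_segment[]; first exact/ltW/L_mono.
  move=> Y2 A2 B2; have /andP[j_gt2 j_lt2] := jm'.
  by right; rewrite Y2 in X1 *; congr pair; lra.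
- move=> /leg_segment[A1 B1 X1]; have /andP[j_gt1 j_le1] := jm.
  have [oj1 ojk1] := o_bd j; have L11 := L_le _ _ j_gt1; have Lm1 := L_le _ _ j_le1.
  move=> /top_segment[A2 B2 X2].
  (* Leg against left rim edge: a common point satisfies 2(1 - Y)(L j - L 1) + Y(2 o j - o 0 - L 1)
     = 0, and the last factor is positive by [L_first]. *)
  have Y0 : Y = 0.
    apply: (@null_weight _ (2 * ((1 - Y) * (L j - L 1)))
      (2 * (o j)%:R - (o 0)%:R - L 1)); try lra.
    by rewrite mulr_ge0 // mulr_ge0; lra.
  by right; rewrite Y0 in X1 *; congr pair; lra.
- move=> /leg_segment[A1 B1 X1]; have /andP[j_gt1 j_le1] := jm.
  have [oj1 ojk1] := o_bd j; have L11 := L_le _ _ j_gt1; have Lm1 := L_le _ _ j_le1.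
  rewrite segmentC => /top_segment[A2 B2 X2].
  have Y0 : Y = 0.
    apply: (@null_weight _ (2 * ((1 - Y) * (L m - L j)))
      ((o 0)%:R + L m - 2 * (o j)%:R)); try lra.
    by rewrite mulr_ge0 // mulr_ge0; lra.
  by right; rewrite Y0 in X1 *; congr pair; lra.
- move=> /vertical_segment[X1 A1 B1].
  move=> /horizontal_segment[]; first by rewrite nat1; lra.
  rewrite nat1 => Y2 A2 B2; have := lt_nat _ _ ik'; rewrite nat1 => ub2.
  have lb2 := ge0 i'.
  by left; congr pair; lra.
- move=> /vertical_segment[X1 A1 B1].
  move=> /leg_segment[A2 B2 X2]; have /andP[j_gt2 j_le2] := jm'.
  have [oj2 ojk2] := o_bd j'; have L12 := L_le _ _ j_gt2; have Lm2 := L_le _ _ j_le2.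
  by left; congr pair; lra.
- move=> /vertical_segment[X1 A1 B1].
  move=> /horizontal_segment[]; first exact/ltW/L_mono.
  move=> Y2 A2 B2; have /andP[j_gt2 j_lt2] := jm'.
  by exfalso; lra.
- move=> /vertical_segment[X1 A1 B1].
  move=> /top_segment[A2 B2 X2].
  have Y2 : 2 - Y = 0 by apply: (@null_weight _ 0 ((o 0)%:R - L 1)); lra.
  by right; congr pair; lra.
- move=> /vertical_segment[X1 A1 B1].
  rewrite segmentC => /top_segment[A2 B2 X2].
  have Y2 : 2 - Y = 0 by apply: (@null_weight _ 0 (L m - (o 0)%:R)); lra.
  by right; congr pair; lra.
- move=> /horizontal_segment[]; first exact/ltW/L_mono.
  move=> Y1 A1 B1; have /andP[j_gt1 j_lt1] := jm.
  move=> /horizontal_segment[]; first by rewrite nat1; lra.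
  rewrite nat1 => Y2 A2 B2; have := lt_nat _ _ ik'; rewrite nat1 => ub2.
  have lb2 := ge0 i'.
  by exfalso; lra.
- move=> /horizontal_segment[]; first exact/ltW/L_mono.
  move=> Y1 A1 B1; have /andP[j_gt1 j_lt1] := jm.
  move=> /leg_segment[A2 B2 X2]; have /andP[j_gt2 j_le2] := jm'.
  have [oj2 ojk2] := o_bd j'; have L12 := L_le _ _ j_gt2; have Lm2 := L_le _ _ j_le2.
  rewrite Y1 in X2 *; have XL : X = L j' by lra.
  case: (leqP j' j) => [/L_le|/L_le] h; first by left; congr pair; lra.
  by right; congr pair; lra.
- move=> /horizontal_segment[]; first exact/ltW/L_mono.
  move=> Y1 A1 B1; have /andP[j_gt1 j_lt1] := jm.
  move=> /vertical_segment[X2 A2 B2].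
  by exfalso; lra.
- move=> /horizontal_segment[]; first exact/ltW/L_mono.
  move=> Y1 A1 B1; have /andP[j_gt1 j_lt1] := jm.
  move=> /horizontal_segment[]; first exact/ltW/L_mono.
  move=> Y2 A2 B2; have /andP[j_gt2 j_lt2] := jm'.
  have /eqP : j <> j' by move=> e; apply: neq; rewrite e.
  rewrite neq_ltn => /orP[/L_le|/L_le] h; first by right; congr pair; lra.
  by left; congr pair; lra.
- move=> /horizontal_segment[]; first exact/ltW/L_mono.
  move=> Y1 A1 B1; have /andP[j_gt1 j_lt1] := jm.
  move=> /top_segment[A2 B2 X2].
  have h := L_le _ _ j_gt1; rewrite Y1 in X2 *.
  by left; congr pair; lra.
- move=> /horizontal_segment[]; first exact/ltW/L_mono.
  move=> Y1 A1 B1; have /andP[j_gt1 j_lt1] := jm.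
  rewrite segmentC => /top_segment[A2 B2 X2].
  have h := L_le _ _ j_lt1; rewrite Y1 in X2 *.
  by right; congr pair; lra.
- move=> /top_segment[A1 B1 X1].
  move=> /horizontal_segment[]; first by rewrite nat1; lra.
  rewrite nat1 => Y2 A2 B2; have := lt_nat _ _ ik'; rewrite nat1 => ub2.
  have lb2 := ge0 i'.
  by exfalso; rewrite Y2 in X1; lra.
- move=> /top_segment[A1 B1 X1].
  move=> /leg_segment[A2 B2 X2]; have /andP[j_gt2 j_le2] := jm'.
  have [oj2 ojk2] := o_bd j'; have L12 := L_le _ _ j_gt2; have Lm2 := L_le _ _ j_le2.
  have Y0 : Y = 0.
    apply: (@null_weight _ (2 * ((1 - Y) * (L j' - L 1)))
      (2 * (o j')%:R - (o 0)%:R - L 1)); try lra.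
    by rewrite mulr_ge0 // mulr_ge0; lra.
  by right; rewrite Y0 in X1 *; congr pair; lra.
- move=> /top_segment[A1 B1 X1].
  move=> /vertical_segment[X2 A2 B2].
  have Y2 : 2 - Y = 0 by apply: (@null_weight _ 0 ((o 0)%:R - L 1)); lra.
  by left; congr pair; lra.
- move=> /top_segment[A1 B1 X1].
  move=> /horizontal_segment[]; first exact/ltW/L_mono.
  move=> Y2 A2 B2; have /andP[j_gt2 j_lt2] := jm'.
  by right; rewrite Y2 in X1 *; congr pair; lra.
- move=> /top_segment[A1 B1 X1].
  rewrite segmentC => /top_segment[A2 B2 X2].
  have Y2 : 2 - Y = 0 by apply: (@null_weight _ 0 (L m - L 1)); lra.
  have {}Y2 : Y = 2 by lra.
  by left; rewrite Y2 in X1 *; congr pair; lra.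
- rewrite segmentC => /top_segment[A1 B1 X1].
  move=> /horizontal_segment[]; first by rewrite nat1; lra.
  rewrite nat1 => Y2 A2 B2; have := lt_nat _ _ ik'; rewrite nat1 => ub2.
  have lb2 := ge0 i'.
  by exfalso; rewrite Y2 in X1; lra.
- rewrite segmentC => /top_segment[A1 B1 X1].
  move=> /leg_segment[A2 B2 X2]; have /andP[j_gt2 j_le2] := jm'.
  have [oj2 ojk2] := o_bd j'; have L12 := L_le _ _ j_gt2; have Lm2 := L_le _ _ j_le2.
  have Y0 : Y = 0.
    apply: (@null_weight _ (2 * ((1 - Y) * (L m - L j')))
      ((o 0)%:R + L m - 2 * (o j')%:R)); try lra.
    by rewrite mulr_ge0 // mulr_ge0; lra.
  by left; rewrite Y0 in X1 *; congr pair; lra.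
- rewrite segmentC => /top_segment[A1 B1 X1].
  move=> /vertical_segment[X2 A2 B2].
  have Y2 : 2 - Y = 0 by apply: (@null_weight _ 0 (L m - (o 0)%:R)); lra.
  by right; congr pair; lra.
- rewrite segmentC => /top_segment[A1 B1 X1].
  move=> /horizontal_segment[]; first exact/ltW/L_mono.
  move=> Y2 A2 B2; have /andP[j_gt2 j_lt2] := jm'.
  by left; rewrite Y2 in X1 *; congr pair; lra.
- rewrite segmentC => /top_segment[A1 B1 X1].
  move=> /top_segment[A2 B2 X2].
  have Y2 : 2 - Y = 0 by apply: (@null_weight _ 0 (L m - L 1)); lra.
  have {}Y2 : Y = 2 by lra.
  by right; rewrite Y2 in X1 *; congr pair; lra.
Qed.

End CaterpillarDrawing.

(** * Caterpillar frames *)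

(** On a cycle of length at least 3, a vertex of least rank would have two distinct neighbours of
    larger rank. *)
Lemma rank_acyclic (V : finType) (T : sgraph V) (r : V -> nat) :
  (forall x y, T x y -> r x <> r y) ->
  (forall x y z, T x y -> T x z -> r x < r y -> r x < r z -> y = z) ->
  acyclic T.
Proof.
move=> r_neq r_up p /andP[cyc_p uniq_p]; rewrite ltnNge; apply/negP => p_ge3.
have [x0 x0p] : exists x, x \in p.
  by case: p p_ge3 {cyc_p uniq_p} => // x p _; exists x; rewrite mem_head.
have [x xp x_min] := arg_minnP r x0p.
have [i p' def_p] := rot_to xp.
have mem_p y : y \in x :: p' -> y \in p by rewrite -def_p mem_rot.
move: cyc_p uniq_p p_ge3.
rewrite -(rot_cycle i) -(rot_uniq i) -(size_rot i) def_p /=.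
case: p' mem_p {def_p} => [//|y [//|z l]] mem_p /= /and3P[Txy _].
rewrite rcons_path => /andP[_ Tlx] /and3P[_ yNl _] _.
have up w : w \in x :: y :: z :: l -> T x w -> r x < r w.
  move=> /mem_p/x_min; rewrite leq_eqVlt => /orP[/eqP e Txw|//].
  by case: (r_neq _ _ Txw).
rewrite adj_sym in Tlx.
have y_in : y \in [:: x, y, z & l] by rewrite !in_cons eqxx orbT.
have l_in : last z l \in [:: x, y, z & l].
  by rewrite in_cons [in X in _ || X]in_cons mem_last !orbT.
have eq_y : y = last z l by apply: (r_up x) => //; apply: up.
by move: yNl; rewrite [X in X \notin _]eq_y mem_last.
Qed.

Definition hubs (T : Type) (s : seq (T * seq T)) : seq T := unzip1 s.
Definition leaves (T : Type) (s : seq (T * seq T)) : seq T := flatten (unzip2 s).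

Section Frame.
Variable V : finType.

(* A spanning Halin subgraph whose tree is a caterpillar: the hubs form the
   spine, each block of [s] is a hub with its leaves on one side of the spine,
   and [t] is the only leaf on the other side, hanging from the hub [h].  The
   cycle visits [t] and then the other leaves block by block. *)
Definition halin_frame (G : sgraph V) (h t : V) (s : seq (V * seq V)) : Prop :=
  [/\ uniq (hubs s ++ t :: leaves s) /\ (forall x, x \in hubs s ++ t :: leaves s),
      sorted G (hubs s),
      (forall b, b \in s -> all (G b.1) b.2) /\ (h \in hubs s /\ G h t),
      cycle G (t :: leaves s) /\ 1 < size (leaves s) &
      forall i, i < size s -> 2 < size (nth [::] (unzip2 s) i)
        + (h == nth h (hubs s) i) + (0 < i) + (i.+1 < size s)].

Definition block_index (s : seq (V * seq V)) (x : V) : nat :=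
  find (fun b => x \in b.2) s.

Lemma has_block s x : (x \in leaves s) = has (fun b : V * seq V => x \in b.2) s.
Proof. by elim: s => //= b s IHs; rewrite mem_cat IHs. Qed.

(** Along the rim the owners never step back on the spine; this provides [o_mono] for the
    drawing. *)
Lemma block_index_mono s x y :
  x \in leaves s -> y \in leaves s -> index x (leaves s) <= index y (leaves s) ->
  block_index s x <= block_index s y.
Proof.
elim: s => [//|[z B] s IHs]; rewrite /leaves /block_index /= !mem_cat !index_cat.
case: (boolP (x \in B)) => [xB|xNB] //= xs.
case: (boolP (y \in B)) => [yB _|yNB /= ys].
  by move=> /(leq_trans (leq_addr _ _)); rewrite leqNgt index_mem yB.
by rewrite leq_add2l ltnS; apply: IHs.
Qed.

Section FrameGraph.
Variables (G : sgraph V) (h t : V) (s : seq (V * seq V)).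
Hypothesis frame_s : halin_frame G h t s.

Let q := hubs s.
Let p := t :: leaves s.

Definition owner (x : V) : nat := if x == t then index h q else block_index s x.

Definition spine_rel : rel V :=
  [rel x y | [&& x \in q, y \in q & index y q == (index x q).+1]].
Definition leg_rel : rel V :=
  [rel x y | [&& x \in q, y \in p & index x q == owner y]].
Definition frame_tree_rel : rel V :=
  [rel x y | [|| spine_rel x y, spine_rel y x, leg_rel x y | leg_rel y x]].

Let uniq_q : uniq q.
Proof. by case: frame_s => -[]; rewrite cat_uniq => /andP[]. Qed.

Let uniq_p : uniq p.
Proof. by case: frame_s => -[]; rewrite cat_uniq => /and3P[]. Qed.

Let uniq_leaves : t \notin leaves s /\ uniq (leaves s).
Proof. by have := uniq_p; rewrite /p cons_uniq => /andP. Qed.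

Let qNp x : x \in q -> x \in p = false.
Proof.
case: frame_s => -[]; rewrite cat_uniq => /and3P[_ /hasPn disj _] _ _ _ _ _ xq.
by apply/negP => /disj; rewrite /= xq.
Qed.

Let q_or_p x : x \in q \/ x \in p.
Proof. by case: frame_s => -[_ /(_ x)]; rewrite mem_cat => /orP. Qed.

Let size_q : size q = size s. Proof. by rewrite size_map. Qed.

Let h_q : h \in q. Proof. by case: frame_s => _ _ [_ []]. Qed.

Let in_leaves x : x \in p -> x != t -> x \in leaves s.
Proof. by rewrite inE => /predU1P[->|//]; rewrite eqxx. Qed.

Let owner_lt x : x \in p -> owner x < size q.
Proof.
rewrite /owner; case: eqP => [_ _|/eqP xt xp]; first by rewrite index_mem.
by rewrite size_q -has_find -has_block in_leaves.
Qed.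

Lemma frame_tree_sym : symmetric frame_tree_rel.
Proof.
move=> x y; rewrite /frame_tree_rel /=.
by case: (spine_rel x y); case: (spine_rel y x); case: (leg_rel x y);
  case: (leg_rel y x).
Qed.

Lemma frame_tree_irrefl : irreflexive frame_tree_rel.
Proof.
move=> x; rewrite /frame_tree_rel /spine_rel /leg_rel /=.
case: (boolP (x \in q)) => [/qNp ->|] //=.
by rewrite eqn_leq ltnn andbF.
Qed.

Definition frame_tree : sgraph V := SGraph frame_tree_sym frame_tree_irrefl.

Let hub_of x0 x : x \in p -> leg_rel (nth x0 q (owner x)) x.
Proof.
move=> xp; rewrite /leg_rel /= xp mem_nth ?owner_lt //.
by rewrite index_uniq ?owner_lt ?eqxx.
Qed.

Let index_q_inj x y : x \in q -> index x q = index y q -> x = y.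
Proof.
move=> xq e; have yq : y \in q by rewrite -index_mem -e index_mem.
by rewrite -(nth_index x xq) e nth_index.
Qed.

Lemma leg_adj x y : leg_rel x y -> G x y.
Proof.
case: frame_s => _ _ [blocks [_ Ght]] _ _ /and3P[xq yp /eqP].
rewrite /owner; case: eqP => [-> /index_q_inj -> //|/eqP yt xy].
have hy : has (fun b : V * seq V => y \in b.2) s by rewrite -has_block in_leaves.
have /(nth_find (x, [::])) /= := hy; rewrite -/(block_index s y) => y_in.
have own_lt : block_index s y < size s by rewrite -has_find.
have := blocks _ (mem_nth (x, [::]) own_lt) => /allP /(_ _ y_in).
have -> // : (nth (x, [::]) s (block_index s y)).1 = x.
by rewrite -(nth_map _ x) // -xy nth_index.
Qed.

Lemma spine_adj x y : spine_rel x y -> G x y.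
Proof.
case: frame_s => _ /(sortedP x) sq _ _ _ /and3P[xq yq /eqP xy].
rewrite -{1}(nth_index x xq) -(nth_index x yq) xy; apply: sq.
by rewrite -xy index_mem.
Qed.

Lemma frame_tree_sub x y : frame_tree x y -> G x y.
Proof.
by move=> /or4P[/spine_adj|/spine_adj|/leg_adj|/leg_adj] //; rewrite adj_sym.
Qed.

Lemma rim_sub x y : cycle_adj p x y -> G x y.
Proof.
case: frame_s => _ _ _ [cyc _] _ /and3P[xp yp /orP[] /eqP <-].
  exact: next_cycle.
by rewrite adj_sym; apply: next_cycle.
Qed.

Lemma frame_tree_connected : connected_graph frame_tree.
Proof.
split; first by apply/card_gt0P; exists t.
have csym : connect_sym frame_tree by exact: (sym_connect_sym frame_tree_sym).
suff to0 x : connect frame_tree (nth t q 0) x.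
  by move=> x y; apply: connect_trans (to0 y); rewrite csym.
have hub i : i < size q -> connect frame_tree (nth t q 0) (nth t q i).
  elim: i => [//|i IHi] lt_i; apply: connect_trans (IHi (ltnW lt_i)) _.
  apply/connect1/orP; left; have lt_i' := ltnW lt_i.
  by rewrite /spine_rel /= !mem_nth // !index_uniq // eqxx.
case: (q_or_p x) => [xq|xp].
  by rewrite -(nth_index t xq) hub // index_mem.
apply: connect_trans (hub _ (owner_lt xp)) _.
by apply/connect1/or4P; apply: Or43; exact: hub_of.
Qed.

Lemma frame_tree_acyclic : acyclic frame_tree.
Proof.
(* Leaves get rank 0 and the hub of index i gets rank i + 1, so the only upward neighbour is the
   owner for a leaf and the next hub for a hub. *)
pose r x := if x \in p then 0 else (index x q).+1.
have r_hub x : x \in q -> r x = (index x q).+1 by move=> /qNp; rewrite /r => ->.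
have r_leaf x : x \in p -> r x = 0 by rewrite /r => ->.
apply: (@rank_acyclic _ _ r).
  move=> x y /or4P[] /and3P[] => [xq yq|yq xq|xq yp|yq xp] /eqP e.
  - by rewrite !r_hub // e; lia.
  - by rewrite !r_hub // e; lia.
  - by rewrite (r_hub x) ?(r_leaf y).
  - by rewrite (r_leaf x) ?(r_hub y).
have up x y : frame_tree x y -> r x < r y -> [/\ y \in q &
    index y q = if x \in p then owner x else (index x q).+1].
  move=> /or4P[] /and3P[] => [xq yq|yq xq|xq yp|yq xp] /eqP e.
  - by rewrite qNp ?e.
  - by rewrite !r_hub // e; lia.
  - by rewrite r_hub // r_leaf.
  - by rewrite xp.
move=> x y z Txy Txz /(up _ _ Txy)[yq ey] /(up _ _ Txz)[zq ez].
by apply: index_q_inj; rewrite // ey ez.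
Qed.

Lemma degree_leaf x : x \in p -> degree frame_tree x = 1.
Proof.
move=> xp; have xNq : x \in q = false by apply/negP => /qNp; rewrite xp.
rewrite /degree -(card1 (nth x q (owner x))); apply: eq_card => y.
rewrite !inE /= /in_mem /= /spine_rel /leg_rel /= xNq xp /=.
rewrite andbF /=; apply/andP/eqP => [[yq /eqP e]|->].
  by rewrite -e nth_index.
by rewrite mem_nth ?owner_lt ?index_uniq ?owner_lt ?eqxx.
Qed.

Lemma block_owner i x : i < size s -> x \in nth [::] (unzip2 s) i ->
  [/\ x \in p, x != t & owner x = i].
Proof.
move=> lt_i x_in; have lt_i' : i < size (unzip2 s) by rewrite size_map.
have xl : x \in leaves s.
  by apply/flattenP; exists (nth [::] (unzip2 s) i); rewrite ?mem_nth.
have [tNl uniq_l] := uniq_leaves.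
have xt : x != t by apply: contraNneq tNl => <-.
rewrite /owner (negPf xt) inE xl orbT; split=> //.
move: uniq_l lt_i x_in; rewrite /leaves /block_index {xl lt_i' xt tNl}.
elim: s i => [//|[z B] s' IHs] [|i] /=.
  by move=> _ _ ->.
rewrite cat_uniq => /and3P[_ disj us'] lt_i x_in; case: ifP => [xB|_].
  case/hasP: disj; exists x => //; apply/flattenP.
  by exists (nth [::] (unzip2 s') i) => //; rewrite mem_nth // size_map.
by rewrite (IHs i).
Qed.

Lemma degree_hub x : x \in q -> 2 < degree frame_tree x.
Proof.
move=> xq; case: frame_s => _ _ _ _ /(_ (index x q)).
rewrite -size_q index_mem nth_index // => /(_ xq) /leq_trans; apply.
set i := index x q; set B := nth _ _ i.
have lt_i : i < size q by rewrite index_mem.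
have lt_pi : i.-1 < size q by exact: leq_ltn_trans (leq_pred i) lt_i.
(* [l1] collects neighbours along legs and [l2] those along the spine; together they are as many as
   the sum bounded below in the frame. *)
pose l1 := B ++ (if h == x then [:: t] else [::]).
pose l2 := (if 0 < i then [:: nth x q i.-1] else [::])
            ++ (if i.+1 < size q then [:: nth x q i.+1] else [::]).
have -> : size B + (h == x) + (0 < i) + (i.+1 < size q) = size (l1 ++ l2).
  by rewrite !size_cat !addnA; case: ifP; case: ifP; case: ifP.
have B_owner y : y \in B -> [/\ y \in p, y != t & owner y = i].
  by apply: block_owner; rewrite -size_q.
have uniq_B : uniq B.
  have [_] := uniq_leaves; rewrite /leaves /B.
  have : i < size (unzip2 s) by rewrite size_map -size_q.
  elim: (unzip2 s) (i) => [//|C ss IHss] [|j] /= lt_j; rewrite cat_uniq.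
    by case/and3P.
  by case/and3P => _ _ /IHss; apply.
have l1_leg y : y \in l1 -> leg_rel x y.
  rewrite /leg_rel /= xq mem_cat => /orP[/B_owner[yp _ ->]|].
    by rewrite yp eqxx.
  case: ifP => // /eqP hx; rewrite !inE => /eqP ->.
  by rewrite /owner eqxx hx eqxx.
have l2_spine y : y \in l2 -> spine_rel x y || spine_rel y x.
  rewrite mem_cat => /orP[]; case: ifP => // hi; rewrite inE => /eqP ->;
    apply/orP; [right|left].
    by rewrite /spine_rel /= xq mem_nth ?index_uniq //= prednK.
  by rewrite /spine_rel /= xq mem_nth ?index_uniq //=.
have uniq_l : uniq (l1 ++ l2).
  rewrite !cat_uniq uniq_B /=; apply/and3P; split.
  - case: ifP => _ //=; rewrite andbT orbF.
    by apply/negP => /B_owner[_]; rewrite eqxx.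
  - apply/hasPn => y /l2_spine spine_y; apply/negP => /l1_leg/and3P[_ yp _].
    have : y \in q by case/orP: spine_y => /and3P[].
    by move/qNp; rewrite yp.
  - case: ifP => hi; case: ifP => hi' //=; rewrite inE andbT nth_uniq //.
    by rewrite orbF gtn_eqF // ltnS leq_pred.
rewrite -(card_uniqP uniq_l); apply/subset_leq_card/subsetP => y.
rewrite mem_cat => /orP[/l1_leg leg_y|/l2_spine /orP[sp_y|sp_y]];
  rewrite /in_mem /=; apply/or4P.
- exact: Or43.
- exact: Or41.
- exact: Or42.
Qed.

Definition rim_step : rel V := [rel x y | [&& x \in p, y \in p & next p x == y]].

(** The second case is the closing edge, from the last leaf back to [t]. *)
Lemma rim_step_index x y : rim_step x y ->
  index y p = (index x p).+1 \/ index x p = (size p).-1 /\ index y p = 0.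
Proof.
move=> /and3P[xp yp /eqP]; rewrite next_nth xp.
case: p uniq_p xp yp => // z r /= /andP[zNr uniq_r] xp yp.
case: (ltnP (index x (z :: r)) (size r)) => [lt_x|le_x] def_y.
  left; rewrite -def_y /= in lt_x *.
  rewrite [z == _](negPf _) ?index_uniq //.
  by apply/eqP => e; move: zNr; rewrite e mem_nth.
right; split.
  apply/eqP; rewrite eqn_leq le_x andbT.
  by have := xp; rewrite -index_mem ltnS.
by rewrite -def_y nth_default //= eqxx.
Qed.

Section FrameDrawing.
Variable R : realType.
Local Open Scope ring_scope.

(* The leaves other than [t] are spread over an interval extending far beyond
   both ends of the spine. *)
Definition leaf_abscissa (j : nat) : R :=
  (2 * size q)%:R * ((2 * j)%:R - (size p)%:R).

Definition frame_pos (x : V) : R * R :=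
  if x == t then ((owner t)%:R, 2)
  else if x \in p then (leaf_abscissa (index x p), 0)
  else ((index x q)%:R, 1).

Let size_q_gt0 : (0 < size q)%N.
Proof. by case: q h_q. Qed.

Let size_p_gt2 : (2 < size p)%N.
Proof. by case: frame_s => _ _ _ []. Qed.

Lemma leaf_abscissa_mono i j : (i < j)%N -> leaf_abscissa i < leaf_abscissa j.
Proof.
move=> lt_ij; rewrite /leaf_abscissa ltr_pM2l ?ltr0n ?muln_gt0 ?size_q_gt0 //.
by rewrite ltrD2r ltr_nat ltn_mul2l.
Qed.

Lemma leaf_abscissa_inj : injective leaf_abscissa.
Proof.
move=> i j e; case: (ltngtP i j) => [lt_ij|lt_ji|e_ij]; last exact: e_ij.
  by have := leaf_abscissa_mono lt_ij; rewrite e ltxx.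
by have := leaf_abscissa_mono lt_ji; rewrite e ltxx.
Qed.

Let index_p_inj x y : x \in p -> y \in p -> index x p = index y p -> x = y.
Proof. by move=> xp yp e; rewrite -(nth_index x xp) e nth_index. Qed.

Lemma frame_pos_inj : injective frame_pos.
Proof.
move=> x y; rewrite /frame_pos.
have n1 : (1 : R) <> 2 by lra.
have n2 : (0 : R) <> 2 by lra.
have n3 : (0 : R) <> 1 by lra.
case: (eqVneq x t) => [->|xt]; case: (eqVneq y t) => [->|yt] //.
- by case: ifP => _ [_ /esym]; [move/n2 | move/n1].
- by case: ifP => _ [_]; [move/n2 | move/n1].
case xp: (x \in p); case yp: (y \in p); case.
- by move=> /leaf_abscissa_inj /(index_p_inj xp yp) ->.
- by move=> _ /n3.
- by move=> _ /esym/n3.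
- move=> /eqP; rewrite eqr_nat => /eqP e; apply: index_q_inj => //.
  by case: (q_or_p x) => //; rewrite xp.
Qed.

Let index_le x : x \in p -> (index x p <= (size p).-1)%N.
Proof. by rewrite -index_mem. Qed.

Let own j := owner (nth t p j).

Lemma frame_edge_drawn x y :
  [|| spine_rel x y, leg_rel x y | rim_step x y] ->
  drawn_edge (size q) (size p).-1 own leaf_abscissa (frame_pos x) (frame_pos y).
Proof.
have t_p : t \in p by rewrite mem_head.
have t_idx z : z \in p -> (z == t) = (index z p == 0%N).
  by move=> zp; rewrite /p /= [z == t]eq_sym; case: (t == z).
have q_t z : z \in q -> (z == t) = false.
  by move=> zq; apply/eqP => e; move: (qNp zq); rewrite e t_p.
have own0 : owner t = own 0 by [].
move=> /or3P[/and3P[xq yq /eqP e]|/and3P[xq yp /eqP e]|xy].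
- rewrite /frame_pos !q_t // !qNp // e; apply: SpineEdge.
  by rewrite -e index_mem.
- rewrite /frame_pos q_t // qNp // e yp; case: (eqVneq y t) => [->|yt].
    by rewrite own0; exact: TopLeg.
  have -> : owner y = own (index y p) by rewrite /own nth_index.
  by apply: Leg; rewrite lt0n -t_idx // yt index_le.
- have /and3P[xp yp _] := xy; rewrite /frame_pos !t_idx // xp yp.
  case: (rim_step_index xy) => [ey|[-> ->]].
    rewrite ey; case: eqP => [->|/eqP x0]; first exact: LeftRimEdge.
    by apply: RimEdge; rewrite lt0n x0 -ey index_le.
  by rewrite ifN; [exact: RightRimEdge | rewrite -lt0n; exact: ltnW].
Qed.

Lemma frame_planar (H : sgraph V) :
  (forall x y, H x y = frame_tree x y || cycle_adj p x y) -> planar R H.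
Proof.
move=> HE.
pose E := [rel x y | [|| spine_rel x y, leg_rel x y | rim_step x y]].
have size_p : (size p).-1.+1 = size p by apply: prednK; exact: ltnW (ltnW _).
apply: (@straight_line_planar R V H E frame_pos frame_pos_inj).
- move=> x y; rewrite HE /E /= /frame_tree_rel /= /rim_step /cycle_adj /=.
  rewrite [y \in p]lock [x \in p]lock; case: (spine_rel x y) => //=.
  case: (spine_rel y x); rewrite /= ?orbT //.
  case: (leg_rel x y) => //=; case: (leg_rel y x); rewrite /= ?orbT //.
  by rewrite -!lock; case: (x \in p); case: (y \in p).
- move=> x; case: (q_or_p x) => [xq|xp].
    have /ltnW/ltnW/card_gt0P[y Txy] := degree_hub xq.
    by exists y; rewrite HE; apply/orP; left.
  exists (next p x); rewrite HE; apply/orP; right.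
  by apply/and3P; rewrite mem_next eqxx.
- move=> x y u v Exy Euv neq _.
  have k0 : 0 <= (size q)%:R :> R by rewrite ler0n.
  have p3 : 0 <= (size p)%:R - 3 :> R by rewrite subr_ge0 (ler_nat R 3).
  apply: (@drawn_noncrossing R (size q) (size p).-1 own leaf_abscissa).
  + move=> j; case: (ltnP j (size p)) => [lt_j|le_j].
      by apply: owner_lt; exact: mem_nth.
    by rewrite /own nth_default // owner_lt // mem_head.
  + move=> i j i_gt0 /andP[le_ij le_j].
    have lt_j : (j < size p)%N by rewrite -size_p ltnS.
    have lt_i := leq_ltn_trans le_ij lt_j.
    have own_leaf l : (0 < l < size p)%N ->
        [/\ own l = block_index s (nth t p l), nth t p l \in leaves s &
            index (nth t p l) (leaves s) = l.-1].
      case: l => [//|l] /=; rewrite ltnS => lt_l; have [tNl uniq_l] := uniq_leaves.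
      rewrite /own /owner /= ifN ?mem_nth ?index_uniq //.
      by apply: contraNneq tNl => <-; rewrite mem_nth.
    have [|-> xl ex] := own_leaf i; first by rewrite i_gt0.
    have [|-> yl ey] := own_leaf j; first by rewrite lt_j (leq_trans i_gt0).
    by apply: block_index_mono; rewrite // ex ey -!subn1 leq_sub2r.
  + exact: leaf_abscissa_mono.
  + by rewrite -ltnS size_p.
  + have own_k : (own 0)%:R + 1 <= (size q)%:R :> R.
      by rewrite natr1 ler_nat owner_lt // mem_head.
    (* With k hubs and n >= 3 rim vertices the leaf 1 has abscissa 2k(2 - n) <= -2k, while the top
       leaf is at most at k - 1. Symmetrically the last leaf has abscissa 2k(n - 2) >= 2k. *)
    have := mulr_ge0 k0 p3; rewrite /leaf_abscissa !natrM; lra.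
  + have own_k : 0 <= (own 0)%:R :> R by rewrite ler0n.
    have pE : (size p)%:R = (size p).-1%:R + 1 :> R by rewrite natr1 size_p.
    have := mulr_ge0 k0 p3; rewrite /leaf_abscissa !natrM pE; lra.
  + exact: frame_edge_drawn.
  + exact: frame_edge_drawn.
  + by case=> /frame_pos_inj exu /frame_pos_inj eyv; case/eqP: neq; rewrite exu eyv.
Qed.
End FrameDrawing.

Lemma frame_halin (R : realType) : has_spanning_halin_subgraph R G.
Proof.
pose hh := [rel x y | frame_tree x y || cycle_adj p x y].
have h_sym : symmetric hh.
  move=> x y; rewrite /hh /= frame_tree_sym; congr orb.
  by rewrite /cycle_adj /= andbCA orbC.
have h_irr : irreflexive hh.
  move=> x; apply/negP => /orP[]; first by rewrite adj_irrefl.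
  by move=> /rim_sub; rewrite adj_irrefl.
exists (SGraph h_sym h_irr); split.
  by move=> x y /orP[/frame_tree_sub|/rim_sub].
have deg x : (x \in p /\ degree frame_tree x = 1) \/
             ((x \in p) = false /\ 2 < degree frame_tree x).
  case: (q_or_p x) => [xq|xp]; first by right; rewrite qNp ?degree_hub.
  by left; rewrite degree_leaf.
exists frame_tree, p; split.
- split; last by move=> x; case: (deg x) => -[_] //; [move->|lia].
  by split; [exact: frame_tree_connected | exact: frame_tree_acyclic].
- by split=> //; case: frame_s => _ _ _ [].
- by move=> x; case: (deg x) => -[-> deg_x]; split=> // e; rewrite e in deg_x.
- by [].
- exact: frame_planar.
Qed.

End FrameGraph.

(* One-sided frames: the leaf at the top is the first leaf of the first block. *)
Definition simple_frame (G : sgraph V) (s : seq (V * seq V)) : Prop :=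
  [/\ uniq (hubs s ++ leaves s) /\ (forall x, x \in hubs s ++ leaves s),
      sorted G (hubs s),
      all (fun b => all (G b.1) b.2) s,
      cycle G (leaves s) /\ 2 < size (leaves s) &
      forall i, i < size s ->
        2 < size (nth [::] (unzip2 s) i) + (0 < i) + (i.+1 < size s)].

Lemma simple_frame_halin (R : realType) (G : sgraph V) s :
  simple_frame G s -> has_spanning_halin_subgraph R G.
Proof.
case: s => [|[z [|t B]] s]; first by case=> _ _ _ [_].
  by case=> _ _ _ _ /(_ 0 isT); rewrite /= addn0; case: (1 < _).
case=> -[us cov] srt /allP blk [cyc sz] deg.
(* The first block gives up [t], which counts again in the degree of [z] through the term for
   [h]. *)
apply: (@frame_halin G z t ((z, B) :: s)); split => //.
- split; last by rewrite mem_head; have /andP[] := blk _ (mem_head _ _).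
  move=> b; rewrite inE => /predU1P[-> /=|b_s].
    by have /andP[] := blk _ (mem_head _ _).
  by apply: blk; rewrite inE b_s orbT.
- case=> [|i] lt_i; have := deg _ lt_i.
    by rewrite /= eqxx; lia.
  by rewrite /=; lia.
Qed.

End Frame.

(** * Small configurations by computation *)

Section Forbidden.
Variables (V : finType) (G : sgraph V).
Hypothesis claw_free : induced_free K13 G.
Hypothesis Z2_free : induced_free Z2 G.

Lemma no_claw a b c d : uniq [:: b; c; d] -> G a b -> G a c -> G a d ->
  [|| G b c, G b d | G c d].
Proof.
move=> ubcd Gab Gac Gad; apply: contra_notT claw_free => /norP[nbc /norP[nbd ncd]].
exists (tnth [tuple a; b; c; d]); split.
  apply/tuple_uniqP.
  have -> : uniq [tuple a; b; c; d] = (a \notin [:: b; c; d]) && uniq [:: b; c; d].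
    by [].
  rewrite ubcd andbT !inE.
  by apply/negP => /or3P[] /eqP e; [move: Gab|move: Gac|move: Gad];
    rewrite e adj_irrefl.
by case=> [[|[|[|[|i]]]] ltI] // [[|[|[|[|j]]]] ltJ] //; rewrite !(tnth_nth a) /=;
  rewrite ?adj_irrefl ?Gab ?Gac ?Gad //= ?(negPf nbc) ?(negPf nbd) ?(negPf ncd) //;
  rewrite adj_sym ?Gab ?Gac ?Gad //= ?(negPf nbc) ?(negPf nbd) ?(negPf ncd).
Qed.

(** Distinctness follows from the adjacencies: if the five alternatives fail, any two of the
    vertices are adjacent or told apart by a third one. *)
Lemma no_Z2 a b c d e : G a b -> G b c -> G a c -> G a d -> G d e ->
  [|| G a e, G b d, G c d, G b e | G c e].
Proof.
move=> Gab Gbc Gac Gad Gde; apply: contra_notT Z2_free.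
move=> /norP[nae /norP[nbd /norP[ncd /norP[nbe nce]]]].
exists (tnth [tuple a; b; c; d; e]); split.
  apply/tuple_uniqP; rewrite /= !inE !negb_or !andbT.
  have neq u v : G u v -> u != v by apply: contraTneq => ->; rewrite adj_irrefl.
  have nae' : a != e by apply: contraNneq nbe => <-; rewrite adj_sym.
  have nbd' : b != d by apply: contraNneq nbe => ->.
  have nbe' : b != e by apply: contraNneq nbd => ->; rewrite adj_sym.
  have ncd' : c != d by apply: contraNneq nce => ->.
  have nce' : c != e by apply: contraNneq ncd => ->; rewrite adj_sym.
  by rewrite nae' nbd' nbe' ncd' nce' !neq.
by case=> [[|[|[|[|[|i]]]]] ltI] // [[|[|[|[|[|j]]]]] ltJ] //;
  rewrite !(tnth_nth a) /= ?adj_irrefl ?Gab ?Gbc ?Gac ?Gad ?Gde //=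
    ?(negPf nae) ?(negPf nbd) ?(negPf ncd) ?(negPf nbe) ?(negPf nce) //;
  rewrite adj_sym ?Gab ?Gbc ?Gac ?Gad ?Gde //=
    ?(negPf nae) ?(negPf nbd) ?(negPf ncd) ?(negPf nbe) ?(negPf nce).
Qed.

(* Adjacency matrices of short vertex lists: freeness of a concrete matrix, and
   the possible neighbourhoods of a further vertex, are found by computation. *)
Definition adj_mx (vs : seq V) : seq (seq bool) :=
  [seq [seq G u v | v <- vs] | u <- vs].

Definition mx_adj (A : seq (seq bool)) (i j : nat) : bool :=
  nth false (nth [::] A i) j.

(** Claws and copies of Z2 share one search, for a vertex a with neighbours b, c, d such that d sees
    neither b nor c: a claw if bc is a non-edge, otherwise a Z2 as soon as d has a suitable
    neighbour e. The nested conditionals prune the enumeration, as call-by-value evaluation would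
    compute both sides of an implication. *)
Definition free_mx (A : seq (seq bool)) : bool :=
  let r := iota 0 (size A) in
  let g := mx_adj A in
  all (fun a => all (fun b => if ~~ g a b then true else
    all (fun c => if ~~ g a c || (b == c) then true else
      all (fun d => if ~~ g a d then true else
        if g b d || g c d then true else
        if g b c then
          all (fun e => if ~~ g d e then true else [|| g a e, g b e | g c e]) r
        else (b == d) || (c == d)) r) r) r) r.

Lemma adj_mxE x0 vs i j : i < size vs -> j < size vs ->
  mx_adj (adj_mx vs) i j = G (nth x0 vs i) (nth x0 vs j).
Proof.
move=> lt_i lt_j; rewrite /mx_adj /adj_mx (nth_map x0) // (nth_map x0) //.
Qed.

Lemma free_adj_mx vs : uniq vs -> free_mx (adj_mx vs).
Proof.
case: vs => [//|x0 vs0]; set vs := x0 :: vs0 => uniq_vs; rewrite /free_mx size_map.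
have lt_r i : i \in iota 0 (size vs) -> i < size vs by rewrite mem_iota.
apply/allP => a /lt_r lt_a; apply/allP => b /lt_r lt_b.
rewrite (adj_mxE x0) //; case: ifP => // /negbFE Gab.
apply/allP => c /lt_r lt_c; rewrite (adj_mxE x0) //.
case: ifP => // /norP[/negPn Gac nbc]; apply/allP => d /lt_r lt_d.
rewrite !(adj_mxE x0) //; case: ifP => // /negbFE Gad.
case: ifP => // /norP[nbd ncd]; case: ifP => Gbc.
  apply/allP => e /lt_r lt_e; rewrite !(adj_mxE x0) //; case: ifP => // /negbFE Gde.
  by have := no_Z2 Gab Gbc Gac Gad Gde; rewrite (negPf nbd) (negPf ncd).
apply: contraTT isT => /norP[ebd ecd].
have := @no_claw (nth x0 vs a) (nth x0 vs b) (nth x0 vs c) (nth x0 vs d).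
rewrite Gbc (negPf nbd) (negPf ncd) /= !inE !nth_uniq // negb_or nbc ebd ecd.
by move=> /(_ isT Gab Gac Gad).
Qed.

(** The new vertex comes first, so each extension raises the indices of all earlier vertices by one;
    the tables of frames are to be read this way. *)
Definition ext_mx (t : seq bool) (A : seq (seq bool)) : seq (seq bool) :=
  (false :: t) :: [seq b.1 :: b.2 | b <- zip t A].

Lemma adj_mx_cons v vs t A : [seq G v u | u <- vs] = t -> adj_mx vs = A ->
  adj_mx (v :: vs) = ext_mx t A.
Proof.
move=> <- <-; rewrite /adj_mx /ext_mx /= adj_irrefl; congr cons.
have sym : [seq G v u | u <- vs] = [seq G u v | u <- vs].
  by apply: eq_map => u; rewrite adj_sym.
by rewrite [in RHS]sym zip_map -map_comp.
Qed.

Fixpoint bitseqs (n : nat) : seq (seq bool) :=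
  if n is k.+1 then
    [seq true :: t | t <- bitseqs k] ++ [seq false :: t | t <- bitseqs k]
  else [:: [::]].

Lemma mem_bitseqs t : t \in bitseqs (size t).
Proof.
elim: t => [//|[] t IHt] /=; rewrite mem_cat; apply/orP; [left|right];
by apply/mapP; exists t.
Qed.

Lemma new_vertex_pred (vs : seq V) (A : seq (seq bool)) (P : pred (seq bool)) v :
  all (fun t => free_mx (ext_mx t A) ==> P t) (bitseqs (size A)) ->
  adj_mx vs = A -> uniq vs -> v \notin vs -> P [seq G v u | u <- vs].
Proof.
move=> /allP chk mxA uniq_vs vNvs; set t := map _ _.
have free_v : free_mx (ext_mx t A).
  by rewrite -(adj_mx_cons (erefl t) mxA) free_adj_mx //= vNvs.
have := mem_bitseqs t; rewrite size_map -(size_map (fun u => [seq G u w | w <- vs])).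
by rewrite -/(adj_mx vs) mxA => /chk; rewrite free_v.
Qed.

Lemma new_vertex_type (vs : seq V) (A ok : seq (seq bool)) v :
  all (fun t => free_mx (ext_mx t A) ==> (t \in ok)) (bitseqs (size A)) ->
  adj_mx vs = A -> uniq vs -> v \notin vs -> [seq G v u | u <- vs] \in ok.
Proof. exact: new_vertex_pred. Qed.

End Forbidden.

(** * Consequences of 3-connectivity *)

Section Connectivity.
Variables (V : finType) (G : sgraph V).
Hypothesis G3 : k_connected 3 G.

Definition nbrs (x : V) : {set V} := [set y | G x y].

(** A walk that avoids [S] cannot leave [A], and any two vertices outside [S] are joined by such a
    walk. *)
Lemma small_cut (S A : {set V}) x y : #|S| < 3 ->
  (forall u v, u \in A -> G u v -> v \notin S -> v \in A) ->
  x \notin S -> x \in A -> y \notin S -> y \in A.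
Proof.
move=> ltS clA xS xA yS; have [_ /(_ S ltS x y xS yS)/connectP[p]] := G3.
elim: p x {xS} xA => [|z p IHp] x xA /=; first by move=> _ ->.
move=> /andP[/and3P[Gxz _ zS] pth]; apply: IHp => //.
exact: clA Gxz zS.
Qed.

Lemma adj_closed (A : {set V}) x y :
  (forall u v, u \in A -> G u v -> v \in A) -> x \in A -> y \in A.
Proof.
move=> clA xA; apply: (@small_cut set0 A x); rewrite ?inE ?cards0 //.
by move=> u v uA /(clA _ _ uA).
Qed.

(** Two or fewer neighbours would separate [x] from a fourth vertex. *)
Lemma nbrs_ge3 x : 2 < #|nbrs x|.
Proof.
rewrite ltnNge; apply/negP => le2; have [n4 _] := G3.
have [y] : exists y, y \notin x |: nbrs x.
  apply/existsP; rewrite -negb_forall; apply/negP => /forallP all_in.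
  have : #|V| <= #|x |: nbrs x| by apply/subset_leq_card/subsetP.
  by rewrite leqNgt cardsU1 inE adj_irrefl (leq_ltn_trans _ n4).
rewrite !inE negb_or => /andP[nyx nGxy].
have := @small_cut (nbrs x) [set x] x y; rewrite !inE adj_irrefl nGxy eqxx.
rewrite (negPf nyx) ltnS le2 => cut; suff : false by []; apply: cut => // u v.
by rewrite !inE => /eqP -> ->.
Qed.

Lemma third_nbr x u v : exists w, [/\ G x w, w != u & w != v].
Proof.
have : ~~ (nbrs x \subset [set u; v]).
  apply: contraTN (nbrs_ge3 x) => /subset_leq_card le; rewrite -leqNgt.
  by apply: leq_trans le _; rewrite cards2; case: (u != v).
case/subsetPn => w; rewrite !inE negb_or => Gxw /andP[nu nv].
by exists w.
Qed.

End Connectivity.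

(** * Cliques with attached vertices *)

(** In frames over arbitrary graphs, the partition into hubs and leaves is checked by adding up
    occurrence counts, which leaves a goal of linear arithmetic. *)
Lemma count_mem1_cover (T : eqType) (s : seq T) :
  (forall x, count_mem x s = 1) -> uniq s /\ (forall x, x \in s).
Proof.
move=> cnt; have s_all x : x \in s by rewrite -has_pred1 has_count cnt.
by split=> //; apply: count_mem_uniq => x; rewrite cnt s_all.
Qed.

Lemma count_enum (T : finType) (A : {set T}) x : count_mem x (enum A) = (x \in A).
Proof. by rewrite count_uniq_mem ?enum_uniq // mem_enum. Qed.

Section Blocks.
Variables (V : finType) (G : sgraph V).

Definition clique (A : {set V}) : Prop :=
  {in A &, forall u v, u != v -> G u v}.

(** The first hypothesis serves an empty block, where the path steps from [a] to [b] directly. *)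
Lemma block_path (B : {set V}) a b s :
  (B = set0 -> G a b) -> {in B, forall u, G a u} -> {in B, forall u, G u b} ->
  clique B -> path G b s -> path G a (enum B ++ b :: s).
Proof.
move=> B0 aB Bb clB pth.
have : enum B = [::] -> G a b.
  by move=> e; apply: B0; apply/setP => u; rewrite inE -mem_enum e.
have {}aB : all (G a) (enum B) by apply/allP => u; rewrite mem_enum => /aB.
have : {subset enum B <= B} by move=> u; rewrite mem_enum.
have := enum_uniq B; elim: (enum B) a aB {B0} => [|u l IHl] a /=.
  by move=> _ _ _ /(_ erefl) ->.
move=> /andP[-> _] /andP[uNl uniq_l] sub _ /=; apply: IHl => //.
- apply/allP => v vl; apply: clB; rewrite ?sub ?inE ?eqxx ?vl ?orbT //.
  by apply: contraNneq uNl => ->.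
- by move=> v vl; apply: sub; rewrite inE vl orbT.
- by move=> _; apply: Bb; apply: sub; rewrite mem_head.
Qed.

End Blocks.

Section SplitFrames.
Variables (R : realType) (V : finType) (G : sgraph V).
Hypothesis G3 : k_connected 3 G.

(** * A clique and an independent set attached to disjoint parts of it *)

Section DisjointAttachments.
Variable K : {set V}.
Hypothesis clK : clique G K.
Hypothesis indep : {in ~: K &, forall u v, ~~ G u v}.
Hypothesis one_out : {in K, forall k, {in ~: K &, forall u v, G k u -> G k v -> u = v}}.

(** For i < 3 the index is in range by minimum degree 3, and the default [o] does not occur. Each
    outside vertex spends neighbour 0 as a hub and neighbours 1 and 2 as its own neighbours on the
    rim. *)
Let att i o := nth o (enum (nbrs G o)) i.

Let att_nbr i o : i < 3 -> G o (att i o).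
Proof.
move=> lt_i; suff : att i o \in nbrs G o by rewrite inE.
by rewrite -mem_enum mem_nth // -cardE (leq_trans lt_i) // nbrs_ge3.
Qed.

Let att_K i o : i < 3 -> o \notin K -> att i o \in K.
Proof.
move=> lt_i oK; apply: contraTT (att_nbr o lt_i) => aK.
by apply: indep; rewrite inE.
Qed.

Let att_inj i j o o' : i < 3 -> j < 3 -> o \notin K -> o' \notin K ->
  att i o = att j o' -> o = o' /\ i = j.
Proof.
move=> lt_i lt_j oK o'K e.
have eo : o = o'.
  apply: (one_out (att_K lt_i oK)); rewrite ?inE //.
    by rewrite adj_sym att_nbr.
  by rewrite e adj_sym att_nbr.
split=> //; rewrite -eo in e; apply/eqP; move/eqP: e.
rewrite nth_uniq ?enum_uniq // -cardE; apply: leq_trans (nbrs_ge3 G3 o) => //.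
Qed.

Let tri o := [:: att 1 o; o; att 2 o].

Let count_tri (a : pred V) os :
  count a (flatten (map tri os)) =
  count a (map (att 1) os) + count a os + count a (map (att 2) os).
Proof. by elim: os => //= o os ->; lia. Qed.

Let tri_path a b os : a \in K -> b \in K -> {subset os <= ~: K} ->
  uniq (a :: rcons (flatten (map tri os)) b) ->
  path G a (rcons (flatten (map tri os)) b).
Proof.
elim: os a => [|o os IHos] a aK bK sub /=.
  by rewrite !andbT inE => ab; exact: clK.
have oK : o \notin K by have := sub o (mem_head _ _); rewrite inE.
move=> /andP[aN /and3P[_ _ uniq2]]; apply/and4P; split.
- by apply: clK; rewrite ?att_K //; apply: contraNneq aN => ->; rewrite mem_head.
- by rewrite adj_sym att_nbr.
- exact: att_nbr.
- apply: IHos => //; first exact: att_K.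
  by move=> u uos; apply: sub; rewrite inE uos orbT.
Qed.

(** The hubs [att 0 o] form a path inside the clique and the rim runs through the triples [tri o].
    The block of [o1] also absorbs the rest of the clique. Every block has at least three leaves, so
    the hub degrees are right even for a single hub. *)
Lemma disjoint_attachments_halin o1 : o1 \notin K -> has_spanning_halin_subgraph R G.
Proof.
move=> o1K; pose At i := [set v | [exists o, (o \notin K) && (v == att i o)]].
have AtP i v : reflect (exists2 o, o \notin K & v = att i o) (v \in At i).
  rewrite inE; apply: (iffP existsP) => [[o /andP[oK /eqP ->]]|[o oK ->]].
    by exists o.
  by exists o; rewrite oK eqxx.
pose rest := K :\: (At 0 :|: At 1 :|: At 2).
pose os := enum (~: K :\ o1).
pose s := (att 0 o1, tri o1 ++ enum rest) :: [seq (att 0 o, tri o) | o <- os].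
have os_sub : {subset os <= ~: K}.
  by move=> u; rewrite mem_enum !inE => /andP[].
have hubsE : hubs s = map (att 0) (o1 :: os) by rewrite /hubs /= /unzip1 -map_comp.
have leavesE : leaves s = tri o1 ++ enum rest ++ flatten (map tri os).
  by rewrite /leaves /= /unzip2 -map_comp.
have osK o : o \in o1 :: os -> o \notin K.
  by rewrite inE => /predU1P[-> //|/os_sub]; rewrite inE.
have os_all o : o \notin K -> o \in o1 :: os.
  by move=> oK; rewrite inE mem_enum !inE oK andbT orbN.
have uniq_os : uniq (o1 :: os) by rewrite /= mem_enum !inE eqxx enum_uniq.
have mem_att i v : (v \in map (att i) (o1 :: os)) = (v \in At i).
  apply/mapP/AtP => -[o h ->]; exists o => //; first exact: osK.
  exact: os_all.
have att_count i v : i < 3 -> count_mem v (map (att i) (o1 :: os)) = (v \in At i).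
  move=> lt_i; rewrite count_uniq_mem ?mem_att // map_inj_in_uniq //.
  by move=> o o' /osK oK /osK o'K /(att_inj lt_i lt_i oK o'K)[].
have cnt v : count_mem v (hubs s ++ leaves s) = 1.
  rewrite hubsE leavesE !count_cat count_tri count_enum in_setD !in_setU.
  have c1 := att_count 1 v isT; have c2 := att_count 2 v isT.
  have c0 := att_count 0 v isT.
  have co : count_mem v (o1 :: os) = (v \notin K).
    rewrite count_uniq_mem //; congr nat_of_bool.
    by apply/idP/idP => [/osK|/os_all].
  have excl i j : i < 3 -> j < 3 -> i != j -> v \in At i -> v \in At j = false.
    move=> lt_i lt_j /eqP ij /AtP[o oK ev]; apply/negP => /AtP[o' o'K ev'].
    by rewrite ev in ev'; case: (att_inj lt_i lt_j oK o'K ev') => _ /ij.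
  have inK i : i < 3 -> v \in At i -> v \in K.
    by move=> lt_i /AtP[o oK ->]; exact: att_K.
  move: (excl 0 1 isT isT isT) (excl 0 2 isT isT isT) (excl 1 2 isT isT isT).
  move: (inK 0 isT) (inK 1 isT) (inK 2 isT) c0 c1 c2 co.
  case: (v \in At 0); case: (v \in At 1); case: (v \in At 2); case: (v \in K);
  move=> i0 i1 i2 c0 c1 c2 co e01 e02 e12;
  (try by have := e01 isT); (try by have := e02 isT); (try by have := e12 isT);
  (try by have := i0 isT); (try by have := i1 isT); (try by have := i2 isT);
  by move: c0 c1 c2 co => /=; lia.
have [uniq_s cover_s] := count_mem1_cover cnt.
apply: (@simple_frame_halin _ R G s); split.
- by [].
- rewrite hubsE; have : uniq (map (att 0) (o1 :: os)).
    by move: uniq_s; rewrite hubsE cat_uniq => /andP[].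
  have : {subset map (att 0) (o1 :: os) <= K}.
    by move=> v; rewrite mem_att => /AtP[o oK ->]; exact: att_K.
  elim: (map _ _) => [//|a [//|b l] IHl] sub /= /andP[aN ubl].
  rewrite clK ?sub ?inE ?eqxx ?orbT //=; last first.
    by apply: contraNneq aN => ->; rewrite mem_head.
  by apply: IHl => // v vl; apply: sub; rewrite inE vl orbT.
- apply/allP => b; rewrite inE => /predU1P[->|/mapP[o oos ->]] /=; last first.
    have oK : o \notin K by have := os_sub o oos; rewrite inE.
    rewrite [G _ o]adj_sym att_nbr //=.
    have ne i j : i < 3 -> j < 3 -> i != j -> att i o != att j o.
      by move=> li lj /eqP ij; apply/eqP => /(att_inj li lj oK oK)[_ /ij].
    by rewrite !clK ?att_K ?ne.
  have ne i j : i < 3 -> j < 3 -> i != j -> att i o1 != att j o1.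
    by move=> li lj /eqP ij; apply/eqP => /(att_inj li lj o1K o1K)[_ /ij].
  rewrite [G _ o1]adj_sym att_nbr // !clK ?att_K ?ne //=.
  apply/allP => v; rewrite mem_enum in_setD !in_setU !negb_or -!andbA.
  case/and4P => nv _ _ vK; rewrite clK ?att_K //.
  by apply: contraNneq nv => <-; apply/AtP; exists o1.
- have size_l : 2 < size (leaves s) by rewrite leavesE.
  split=> //; rewrite leavesE /= [G _ o1]adj_sym !att_nbr //=.
  have uniq_l : uniq (leaves s) by move: uniq_s; rewrite cat_uniq => /and3P[].
  move: uniq_l; rewrite leavesE /= rcons_cat.
  set F := flatten _ => /and4P[x1N _ y1N uniq_RF].
  have uniq_all : uniq (att 2 o1 :: enum rest ++ rcons F (att 1 o1)).
    rewrite cons_uniq -rcons_cat rcons_uniq mem_rcons inE negb_or y1N uniq_RF.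
    move: x1N; rewrite !inE !negb_or => /and3P[_ ne x1N].
    by rewrite x1N eq_sym ne.
  move: uniq_all; have : {subset enum rest <= K}.
    by move=> v; rewrite mem_enum in_setD => /andP[].
  have : att 2 o1 \in K by exact: att_K.
  elim: (enum rest) (att 2 o1) => [|u l IHl] a aK sub.
    by apply: tri_path => //; exact: att_K.
  move=> /= /andP[aN uu]; rewrite clK //; last 2 first.
  + by apply: sub; rewrite mem_head.
  + by apply: contraNneq aN => ->; rewrite mem_head.
  by apply: IHl => //= [|v vl]; apply: sub; rewrite inE ?eqxx ?vl ?orbT.
- case=> [|i] lt_i; first by [].
  rewrite /= in lt_i *; rewrite size_map ltnS in lt_i.
  by rewrite /unzip2 -map_comp (nth_map o1).
Qed.

End DisjointAttachments.

(** * A clique whose members each see exactly two of three further vertices *)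

Section Sun.
Variables x y z : V.
Hypothesis uniq_xyz : uniq [:: x; y; z].
Let K : {set V} := ~: [set x; y; z].
Hypothesis clK : clique G K.
Hypothesis typeK : {in K, forall k,
  [:: G k x; G k y; G k z] \in [:: [:: true; true; false];
     [:: true; false; true]; [:: false; true; true]]}.
Hypothesis indep : [/\ ~~ G x y, ~~ G x z & ~~ G y z].

(** The rim is x, D, z, W, y, C and back to x, with one vertex of D and one of W withdrawn as hubs.
    Each class must keep a vertex on the rim to link its two ends: hence two vertices in D and in W,
    and one in C. *)
Lemma sun_frame : 1 < #|nbrs G x :&: nbrs G z| -> 1 < #|nbrs G y :&: nbrs G z| ->
  nbrs G x :&: nbrs G y != set0 -> has_spanning_halin_subgraph R G.
Proof.
set D := _ :&: _; set W := _ :&: _ => D2 W2; set C := _ :&: _ => Cn0.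
have [d1 d1D] : exists d, d \in D by apply/card_gt0P; exact: ltnW.
have [w1 w1W] : exists w, w \in W by apply/card_gt0P; exact: ltnW.
have [nxy nxz nyz] := indep.
have Dd : D :\ d1 != set0.
  by apply: contraTneq D2 => e; rewrite (cardsD1 d1) d1D e cards0.
have Ww : W :\ w1 != set0.
  by apply: contraTneq W2 => e; rewrite (cardsD1 w1) w1W e cards0.
have [nexy nexz neyz] : [/\ x != y, x != z & y != z].
  by move: uniq_xyz; rewrite /= !inE negb_or andbT => /andP[/andP[-> ->] ->].
have inK v : (v \in K) = [&& v != x, v != y & v != z] by rewrite !inE !negb_or -andbA.
have part v : v \in K -> (v \in C) + (v \in D) + (v \in W) = 1.
  move=> vK; have := typeK vK; rewrite !inE ![G _ v]adj_sym.
  by case: (G v x); case: (G v y); case: (G v z).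
have CK v : v \in C -> v \in K.
  rewrite inK !inE => /andP[Gxv Gyv]; apply/and3P; split.
  - by apply: contraTneq Gxv => ->; rewrite adj_irrefl.
  - by apply: contraTneq Gyv => ->; rewrite adj_irrefl.
  - by apply: contraTneq Gxv => ->.
have DK v : v \in D -> v \in K.
  rewrite inK !inE => /andP[Gxv Gyv]; apply/and3P; split.
  - by apply: contraTneq Gxv => ->; rewrite adj_irrefl.
  - by apply: contraTneq Gxv => ->.
  - by apply: contraTneq Gyv => ->; rewrite adj_irrefl.
have WK v : v \in W -> v \in K.
  rewrite inK !inE => /andP[Gxv Gyv]; apply/and3P; split.
  - by apply: contraTneq Gxv => ->; rewrite adj_sym.
  - by apply: contraTneq Gxv => ->; rewrite adj_irrefl.
  - by apply: contraTneq Gyv => ->; rewrite adj_irrefl.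
have Cx v : v \in C -> G x v /\ G y v by rewrite !inE => /andP[].
have Dx v : v \in D -> G x v /\ G z v by rewrite !inE => /andP[].
have Wx v : v \in W -> G y v /\ G z v by rewrite !inE => /andP[].
have d1w1 : d1 != w1.
  apply/eqP => e; have := part _ (DK _ d1D); rewrite d1D.
  by have -> : d1 \in W by [rewrite e]; case: (d1 \in C).
pose s := [:: (d1, x :: enum (D :\ d1) ++ [:: z]); (w1, enum (W :\ w1) ++ y :: enum C)].
have leavesE : leaves s = [:: x] ++ enum (D :\ d1) ++ [:: z] ++ enum (W :\ w1)
    ++ [:: y] ++ enum C by rewrite /leaves /= cats0 -catA.
have cnt v : count_mem v (hubs s ++ leaves s) = 1.
  rewrite leavesE !count_cat !count_enum !in_setD1 /= !addn0.
  rewrite ![_ == v]eq_sym; case: (boolP (v \in K)) => [vK|vNK].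
    have := part _ vK; move: vK; rewrite inK => /and3P[/negPf-> /negPf-> /negPf->].
    have := w1W; have := d1D; case: (eqVneq v d1) => [->|_] /=.
      by rewrite (negPf d1w1) => ->; case: (d1 \in C); case: (d1 \in W).
    case: (eqVneq v w1) => [->|_] /=.
      by move=> _ ->; case: (w1 \in C); case: (w1 \in D).
    by move=> _ _; case: (v \in C); case: (v \in D); case: (v \in W).
  have [vC vD vW] : [/\ v \in C = false, v \in D = false & v \in W = false].
    by split; apply/negP; [move/CK|move/DK|move/WK]; apply/negP.
  rewrite vC vD vW !andbF.
  have -> : (v == d1) = false by apply/eqP => e; rewrite e d1D in vD.
  have -> : (v == w1) = false by apply/eqP => e; rewrite e w1W in vW.
  move: vNK; rewrite inK -!negb_or negbK.
  case: (eqVneq v x) => [->|_]; first by rewrite (negPf nexy) (negPf nexz).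
  case: (eqVneq v y) => [->|_]; first by rewrite (negPf neyz).
  by case: (v == z).
have [uniq_s cover_s] := count_mem1_cover cnt.
have clD : clique G (D :\ d1).
  by move=> u v; rewrite !in_setD1 => /andP[_ /DK uK] /andP[_ /DK vK]; exact: clK.
have clW : clique G (W :\ w1).
  by move=> u v; rewrite !in_setD1 => /andP[_ /WK uK] /andP[_ /WK vK]; exact: clK.
have clC : clique G C by move=> u v /CK uK /CK vK; exact: clK.
apply: (@simple_frame_halin _ R G s); split => //.
- by rewrite /= andbT; exact: clK (DK _ d1D) (WK _ w1W) d1w1.
- rewrite /= !all_cat /= !andbT; have [Gxd Gzd] := Dx _ d1D.
  have [Gyw Gzw] := Wx _ w1W.
  rewrite [G d1 x]adj_sym Gxd [G d1 z]adj_sym Gzd [G w1 y]adj_sym Gyw /= andbT.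
  apply/and3P; split; apply/allP => v; rewrite mem_enum ?in_setD1.
  + by move=> /andP[nv vD]; rewrite clK ?DK // eq_sym.
  + by move=> /andP[nv vD]; rewrite clK ?WK // eq_sym.
  + move=> vC; apply: clK (WK _ w1W) (CK _ vC) _; apply/eqP => e.
    have := part _ (CK _ vC); rewrite vC.
    by have -> : v \in W by [rewrite -e]; case: (v \in D).
- split; last first.
    rewrite leavesE !size_cat; move: (size (enum _)) (size (enum _)) (size (enum _)).
    by clear; move=> a b c /=; lia.
  rewrite leavesE /= rcons_cat /= rcons_cat /= -cats1.
  apply: block_path => //.
  + by move=> e; rewrite e eqxx in Dd.
  + by move=> u; rewrite in_setD1 => /andP[_ /Dx[]].
  + by move=> u; rewrite in_setD1 adj_sym => /andP[_ /Dx[]].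
  apply: block_path => //.
  + by move=> e; rewrite e eqxx in Ww.
  + by move=> u; rewrite in_setD1 => /andP[_ /Wx[]].
  + by move=> u; rewrite in_setD1 adj_sym => /andP[_ /Wx[]].
  apply: block_path => //.
  + by move=> e; rewrite e eqxx in Cn0.
  + by move=> u /Cx[].
  + by move=> u /Cx[]; rewrite adj_sym.
- case=> [|[|//]] _ /=; rewrite !size_cat /=.
    by move: (size (enum _)); clear; lia.
  have : 0 < size (enum (W :\ w1)) by rewrite -cardE card_gt0.
  by move: (size (enum C)) (size (enum (W :\ w1))); clear; lia.
Qed.

End Sun.
End SplitFrames.

(** * Independent triples with common neighbours *)

Definition bits (s : seq nat) : seq bool := [seq b != 0 | b <- s].

(* [halin_frame] on the indices of an adjacency matrix. *)
Definition frame_mx (A : seq (seq bool)) (h t : nat) (s : seq (nat * seq nat)) :=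
  let q := hubs s in
  let p := t :: leaves s in
  let e : rel nat := mx_adj A in
  [&& perm_eq (q ++ p) (iota 0 (size A)), sorted e q,
      all (fun b => all (e b.1) b.2) s, h \in q, e h t, cycle e p,
      1 < size (leaves s) &
      all (fun i => 2 < size (nth [::] (unzip2 s) i) + (h == nth h q i)
                        + (0 < i) + (i.+1 < size s)) (iota 0 (size s))].

Section SmallCases.
Variables (R : realType) (V : finType) (G : sgraph V).
Hypothesis G3 : k_connected 3 G.
Hypothesis claw_free : induced_free K13 G.
Hypothesis Z2_free : induced_free Z2 G.

Lemma frame_mx_halin (vs : seq V) A h t s :
  adj_mx G vs = A -> uniq vs -> (forall x, x \in vs) -> frame_mx A h t s ->
  has_spanning_halin_subgraph R G.
Proof.
move=> mxA uniq_vs all_vs /and5P[perm_s srt blk h_q /and4P[Ght cyc sz deg]].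
have sizeA : size A = size vs by rewrite -mxA size_map.
have [x0 _] : exists x, x \in vs.
  have [n4 _] := G3; have /card_gt0P[x _] : 0 < #|V| by apply: leq_trans n4.
  by exists x.
pose f := nth x0 vs.
pose s' := [seq (f b.1, map f b.2) | b <- s].
have hubsE : hubs s' = map f (hubs s) by rewrite /hubs /unzip1 -!map_comp.
have leavesE : leaves s' = map f (leaves s).
  by rewrite /leaves /unzip2 map_flatten -!map_comp.
have lt_n i : i \in hubs s ++ t :: leaves s -> i < size vs.
  by rewrite (perm_mem perm_s) mem_iota -sizeA.
have GE i j : i < size vs -> j < size vs -> mx_adj A i j = G (f i) (f j).
  by rewrite -mxA; exact: adj_mxE.
have lt_q : all (fun i => i < size vs) (hubs s).
  by apply/allP => i iq; apply: lt_n; rewrite mem_cat iq.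
have lt_p : all (fun i => i < size vs) (t :: leaves s).
  by apply/allP => i ip; apply: lt_n; rewrite mem_cat ip orbT.
have sub : {in (fun i => i < size vs) &, subrel (mx_adj A) (relpre f G)}.
  by move=> i j lt_i lt_j; rewrite GE.
have h_lt : h < size vs by exact: (allP lt_q).
have t_lt : t < size vs by case/andP: lt_p.
have all_eq : hubs s' ++ f t :: leaves s' = map f (hubs s ++ t :: leaves s).
  by rewrite hubsE leavesE map_cat.
apply: (@frame_halin _ G (f h) (f t) s'); split.
- rewrite all_eq; split.
    rewrite map_inj_in_uniq; first by rewrite (perm_uniq perm_s) iota_uniq.
    move=> i j /lt_n lt_i /lt_n lt_j /eqP; rewrite nth_uniq // => /eqP //.
  move=> x; apply/mapP; exists (index x vs); last by rewrite /f nth_index.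
  by rewrite (perm_mem perm_s) mem_iota sizeA /= index_mem.
- by rewrite hubsE sorted_map; apply: (sub_in_sorted sub).
- split; last by rewrite hubsE map_f // -GE.
  move=> b /mapP[[i l] il ->] /=; rewrite all_map; apply/allP => j jl /=.
  rewrite -GE; first exact: (allP (allP blk _ il)).
    by apply: (allP lt_q); apply/mapP; exists (i, l).
  apply: (allP lt_p); rewrite inE; apply/orP; right; apply/flattenP; exists l => //.
  by apply/mapP; exists (i, l).
- split; last by rewrite leavesE size_map.
  by rewrite leavesE -map_cons cycle_map; apply: (sub_in_cycle sub).
- move=> i; rewrite size_map => lt_i.
  have := allP deg i; rewrite mem_iota => /(_ lt_i).
  have -> : nth [::] (unzip2 s') i = map f (nth [::] (unzip2 s) i).
    rewrite /unzip2 -map_comp (nth_map (0, [::])) // (nth_map (0, [::])) //.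
  rewrite size_map hubsE (nth_map h) ?size_map // /f.
  rewrite nth_uniq //; apply: (allP lt_q); apply: mem_nth.
  by rewrite size_map.
Qed.

Lemma isolated_cover (vs : seq V) v0 : v0 \in vs ->
  (forall v, v \notin vs -> [seq G v u | u <- vs] = nseq (size vs) false) ->
  forall x, x \in vs.
Proof.
move=> v0vs iso x; have := @adj_closed _ _ G3 [set v in vs] v0 x.
rewrite !inE; apply=> // u v; rewrite !inE => uvs Guv.
apply: contraTT Guv => /iso e; rewrite adj_sym.
have : G v u \in [seq G v u | u <- vs] by apply: map_f.
by rewrite e mem_nseq => /andP[_ /eqP ->].
Qed.

(* Applied to the line graph [A] of K33 minus an edge: a further vertex can only
   have the neighbourhood [tau], which gives the line graph of K33, and this one
   has no connected free extension. *)
Lemma rook_halin (vs : seq V) A tau h t s h' t' s' :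
  adj_mx G vs = A -> uniq vs -> vs != [::] ->
  [&& all (fun u => free_mx (ext_mx u A) ==>
             (u \in [:: nseq (size A) false; tau])) (bitseqs (size A)),
      all (fun u => free_mx (ext_mx u (ext_mx tau A)) ==>
             (u \in [:: nseq (size A).+1 false])) (bitseqs (size (ext_mx tau A))),
      frame_mx A h t s & frame_mx (ext_mx tau A) h' t' s'] ->
  has_spanning_halin_subgraph R G.
Proof.
move=> mxA uniq_vs vs_n0 /and4P[chk1 chk2 fr fr'].
have sizeA : size A = size vs by rewrite -mxA size_map.
case: (pickP (fun v => (v \notin vs) && ([seq G v u | u <- vs] == tau))).
  move=> v /andP[vNvs /eqP type_v].
  have mxA' := adj_mx_cons type_v mxA.
  have uniq_vs' : uniq (v :: vs) by rewrite /= vNvs.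
  apply: (frame_mx_halin mxA' uniq_vs' _ fr').
  apply: (isolated_cover (mem_head v vs)) => u uN.
  have := new_vertex_type claw_free Z2_free chk2 mxA' uniq_vs' uN.
  by rewrite inE sizeA => /eqP.
move=> no_tau; apply: (frame_mx_halin mxA uniq_vs _ fr).
have [v0 v0vs] : exists v, v \in vs.
  by case: (vs) vs_n0 => // v l _; exists v; rewrite mem_head.
apply: (isolated_cover v0vs) => u uN.
have := new_vertex_type claw_free Z2_free chk1 mxA uniq_vs uN.
rewrite !inE sizeA => /orP[/eqP //|type_u].
by have := no_tau u; rewrite uN type_u.
Qed.

(** A vertex with fewer than three neighbours in the list has one outside it, and only the types in
    [ok] remain for that neighbour. This drives the growth from six to eight vertices. *)
Lemma extra_vertex (vs : seq V) (A ok : seq (seq bool)) i :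
  adj_mx G vs = A -> uniq vs -> i < size vs ->
  (count id (nth [::] A i) < 3) &&
  all (fun t => free_mx (ext_mx t A) ==> (nth false t i ==> (t \in ok)))
    (bitseqs (size A)) ->
  exists2 u, u \notin vs & [seq G u v | v <- vs] \in ok.
Proof.
move=> mxA uniq_vs lt_i /andP[few chk].
have [x0 _] : exists x, x \in vs.
  by case: (vs) lt_i => // v l _; exists v; exact: mem_head.
set a := nth x0 vs i.
have : ~~ (nbrs G a \subset [seq v <- vs | G a v]).
  apply: contraTN (nbrs_ge3 G3 a) => /subset_leq_card le; rewrite -leqNgt.
  apply: leq_trans le _; apply: leq_trans (card_size _) _.
  have -> : size [seq v <- vs | G a v] = count id (nth [::] A i).
    by rewrite -mxA (nth_map x0) // count_map size_filter.
  by rewrite -ltnS.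
case/subsetPn => u; rewrite mem_filter inE => Gau; rewrite Gau /= => uN.
exists u => //.
have := new_vertex_pred claw_free Z2_free chk mxA uniq_vs uN.
by rewrite (nth_map x0) //= -/a adj_sym Gau.
Qed.

(* Rows: pairwise non-adjacent x, y, z, then c, d, w, where c is joined to x and y,
   d to x and z, and w to y and z; the parameters tell whether cd, cw, dw are
   edges. *)
Definition six_mx (b1 b2 b3 : bool) : seq (seq bool) :=
  ext_mx (bits [:: 0; 0; 1; 1; 0]) (ext_mx (bits [:: 0; 1; 0; 1])
    (ext_mx (bits [:: 0; 1; 1]) (ext_mx [:: b1; b2] (ext_mx [:: b3]
    (ext_mx [::] [::]))))).

(** The hexagon x, c, y, w, z, d is the line graph of a 6-cycle of K33. A further neighbour of x
    plays the part of a long diagonal and sees two opposite edges of the hexagon; one of y, z is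
    missed by it, still has degree 2 and yields the eighth vertex. *)
Lemma hexagon_halin (vs : seq V) : uniq vs ->
  adj_mx G vs = six_mx false false false -> has_spanning_halin_subgraph R G.
Proof.
move=> uniq_vs mxA; have size_vs : size vs = 6.
  by rewrite -(size_map (fun u => [seq G u v | v <- vs])) -/(adj_mx G vs) mxA.
have lt6 : 0 < size vs by rewrite size_vs.
have [v vN] := @extra_vertex _ _
    (map bits [:: [:: 1; 0; 1; 1; 0; 1];
      [:: 1; 1; 0; 0; 1; 1]]) 0
  mxA uniq_vs lt6 ltac:(vm_cast_no_check (erefl true)).
have uniq7 : uniq (v :: vs) by rewrite /= vN.
rewrite !inE => /orP[] /eqP type_v; have mx7 := adj_mx_cons type_v mxA.
- have lt7 : 2 < size (v :: vs) by rewrite /= size_vs.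
  have [u uN] := @extra_vertex _ _
    (map bits [:: [:: 0; 0; 1; 1; 1; 1; 0];
      [:: 0; 1; 1; 0; 0; 1; 1]]) 2
    mx7 uniq7 lt7 ltac:(vm_cast_no_check (erefl true)).
  have uniq8 : uniq (u :: v :: vs) by rewrite cons_uniq uN.
  rewrite !inE => /orP[] /eqP type_u; have mx8 := adj_mx_cons type_u mx7.
  + apply: (@rook_halin _ _ (bits [:: 0; 0; 1; 1; 0; 0; 1; 1])
      5 2 [:: (0, [:: 6; 4]); (3, [:: 7]); (5, [:: 1])]
      3 2 [:: (0, [:: 8; 4]); (3, [:: 6]); (7, [:: 1; 5])] mx8 uniq8 isT).
    by vm_cast_no_check (erefl true).
  + apply: (@rook_halin _ _ (bits [:: 0; 0; 0; 1; 1; 1; 1; 0])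
      7 4 [:: (0, [:: 6; 2]); (3, [:: 5]); (7, [:: 1])]
      4 1 [:: (0, [:: 7; 5]); (4, [:: 8]); (6, [:: 2; 3])] mx8 uniq8 isT).
    by vm_cast_no_check (erefl true).
- have lt7 : 3 < size (v :: vs) by rewrite /= size_vs.
  have [u uN] := @extra_vertex _ _
    (map bits [:: [:: 0; 0; 1; 1; 1; 1; 0];
      [:: 0; 1; 0; 1; 1; 0; 1]]) 3
    mx7 uniq7 lt7 ltac:(vm_cast_no_check (erefl true)).
  have uniq8 : uniq (u :: v :: vs) by rewrite cons_uniq uN.
  rewrite !inE => /orP[] /eqP type_u; have mx8 := adj_mx_cons type_u mx7.
  + apply: (@rook_halin _ _ (bits [:: 0; 0; 1; 0; 1; 1; 0; 1])
      6 2 [:: (0, [:: 5; 3]); (4, [:: 7]); (6, [:: 1])]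
      3 2 [:: (0, [:: 8; 5]); (3, [:: 7]); (6, [:: 1; 4])] mx8 uniq8 isT).
    by vm_cast_no_check (erefl true).
  + apply: (@rook_halin _ _ (bits [:: 0; 0; 0; 1; 1; 1; 1; 0])
      7 3 [:: (0, [:: 5; 2]); (4, [:: 6]); (7, [:: 1])]
      4 2 [:: (0, [:: 7; 5]); (4, [:: 8]); (6, [:: 1; 3])] mx8 uniq8 isT).
    by vm_cast_no_check (erefl true).
Qed.

(** In the 3 by 3 rook graph, which is the line graph of K33, put c in a corner, x and d in its row,
    y and w in its column, and z where the lines of d and w cross. The new vertices fill the cells
    that remain. *)
Lemma two_chords_halin (vs : seq V) : uniq vs ->
  adj_mx G vs = six_mx true true false -> has_spanning_halin_subgraph R G.
Proof.
move=> uniq_vs mxA; have size_vs : size vs = 6.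
  by rewrite -(size_map (fun u => [seq G u v | v <- vs])) -/(adj_mx G vs) mxA.
have lt6 : 2 < size vs by rewrite size_vs.
have [v vN] := @extra_vertex _ _
    (map bits [:: [:: 0; 1; 1; 0; 1; 0];
      [:: 1; 0; 1; 0; 0; 1]]) 2
  mxA uniq_vs lt6 ltac:(vm_cast_no_check (erefl true)).
have uniq7 : uniq (v :: vs) by rewrite /= vN.
rewrite !inE => /orP[] /eqP type_v; have mx7 := adj_mx_cons type_v mxA.
- have lt7 : 1 < size (v :: vs) by rewrite /= size_vs.
  have [u uN] := @extra_vertex _ _
    (map bits [:: [:: 0; 1; 0; 1; 0; 0; 1];
      [:: 1; 1; 1; 0; 0; 0; 0]]) 1
    mx7 uniq7 lt7 ltac:(vm_cast_no_check (erefl true)).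
  have uniq8 : uniq (u :: v :: vs) by rewrite cons_uniq uN.
  rewrite !inE => /orP[] /eqP type_u; have mx8 := adj_mx_cons type_u mx7.
  + apply: (@rook_halin _ _ (bits [:: 1; 1; 1; 1; 0; 0; 0; 0])
      4 1 [:: (4, [:: 6]); (0, [:: 2]); (7, [:: 5; 3])]
      1 5 [:: (0, [:: 2; 4]); (1, [:: 8]); (3, [:: 6; 7])] mx8 uniq8 isT).
    by vm_cast_no_check (erefl true).
  + apply: (@rook_halin _ _ (bits [:: 1; 0; 1; 0; 1; 0; 0; 1])
      0 2 [:: (1, [:: 6; 4]); (0, [::]); (3, [:: 7; 5])]
      1 2 [:: (0, [:: 5; 8]); (1, [:: 4]); (3, [:: 6; 7])] mx8 uniq8 isT).
    by vm_cast_no_check (erefl true).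
- have lt7 : 2 < size (v :: vs) by rewrite /= size_vs.
  have [u uN] := @extra_vertex _ _
    (map bits [:: [:: 0; 0; 1; 1; 0; 1; 0];
      [:: 1; 1; 1; 0; 0; 0; 0]]) 2
    mx7 uniq7 lt7 ltac:(vm_cast_no_check (erefl true)).
  have uniq8 : uniq (u :: v :: vs) by rewrite cons_uniq uN.
  rewrite !inE => /orP[] /eqP type_u; have mx8 := adj_mx_cons type_u mx7.
  + apply: (@rook_halin _ _ (bits [:: 1; 1; 1; 1; 0; 0; 0; 0])
      4 1 [:: (4, [:: 7]); (0, [:: 3]); (6, [:: 5; 2])]
      1 5 [:: (0, [:: 2; 3]); (1, [:: 7]); (4, [:: 6; 8])] mx8 uniq8 isT).
    by vm_cast_no_check (erefl true).
  + apply: (@rook_halin _ _ (bits [:: 1; 0; 0; 1; 1; 0; 1; 0])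
      0 3 [:: (1, [:: 7; 4]); (0, [::]); (2, [:: 6; 5])]
      1 2 [:: (0, [:: 5; 7]); (1, [:: 3]); (4, [:: 6; 8])] mx8 uniq8 isT).
    by vm_cast_no_check (erefl true).
Qed.

(** By computation, an outside vertex that sees the sun sees c, d, w and exactly two of x, y, z, and
    any vertex joined to such a vertex sees the sun too. Connectedness spreads this over the
    graph. *)
Lemma sun_halin x y z c d w : uniq [:: x; y; z; c; d; w] ->
  adj_mx G [:: x; y; z; c; d; w] = six_mx true true true ->
  has_spanning_halin_subgraph R G.
Proof.
set vs := [:: x; y; z; c; d; w] => uniq_vs mxA.
pose ok3 := map bits [:: [:: 1; 1; 0; 1; 1; 1]; [:: 1; 0; 1; 1; 1; 1];
  [:: 0; 1; 1; 1; 1; 1]].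
pose type v := [seq G v u | u <- vs].
have type6 v : v \notin vs -> type v \in nseq 6 false :: ok3.
  by apply: new_vertex_type mxA uniq_vs => //; vm_cast_no_check (erefl true).
have type7 u v : u \notin vs -> v \notin u :: vs -> type u \in ok3 ->
    G v u :: type v \in nseq 7 false :: [seq true :: t | t <- ok3].
  move=> uN vN type_u; have uniq7 : uniq (u :: vs) by rewrite cons_uniq uN.
  have tu : [|| type u == bits [:: 1; 1; 0; 1; 1; 1],
      type u == bits [:: 1; 0; 1; 1; 1; 1] | type u == bits [:: 0; 1; 1; 1; 1; 1]].
    by move: type_u; rewrite !inE.
  by case/or3P: tu => /eqP tu; have mx7 := adj_mx_cons tu mxA;
    apply: (new_vertex_type claw_free Z2_free _ mx7 uniq7 vN);
    vm_cast_no_check (erefl true).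
have ok_has t : t \in ok3 -> has id t by rewrite !inE => /or3P[] /eqP ->.
have has_ok v : v \notin vs -> has id (type v) -> type v \in ok3.
  by move=> /type6; rewrite in_cons => /predU1P[->|].
have type_ok v : v \notin vs -> type v \in ok3.
  move=> vN; apply: (has_ok v vN).
  have := @adj_closed _ _ G3 [set v | (v \in vs) || has id (type v)] x v.
  rewrite !in_set (negPf vN) orFb; apply; last by rewrite mem_head.
  move=> {v vN} u v; rewrite !in_set => u_in Guv; apply/orP.
  case: (boolP (v \in vs)) => [vvs|vN]; [by left|right].
  case: (boolP (u \in vs)) u_in => [uvs _|uN].
    by apply/hasP; exists (G v u); [exact: map_f | rewrite adj_sym].
  rewrite orFb => /(has_ok _ uN) type_u.
  have vNu : v \notin u :: vs.
    rewrite in_cons negb_or vN andbT.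
    by apply: contraTneq Guv => ->; rewrite adj_irrefl.
  have := type7 _ _ uN vNu type_u; rewrite adj_sym Guv in_cons => /predU1P[//|].
  by case/mapP => t t_ok [->]; exact: ok_has.
have row i j : i < 6 -> j < 6 ->
    G (nth x vs i) (nth x vs j) = mx_adj (six_mx true true true) i j.
  by move=> lt_i lt_j; rewrite -mxA (adj_mxE _ x).
pose K := ~: [set x; y; z].
have K_vs v : v \in K -> v \in vs -> [\/ v = c, v = d | v = w].
  rewrite !inE => vK; case/orP => [e|]; first by rewrite e in vK.
  case/orP => [e|]; first by rewrite e orbT in vK.
  case/orP => [e|]; first by rewrite e !orbT in vK.
  by case/or3P => /eqP ->; [apply: Or31|apply: Or32|apply: Or33].
have clK : clique G K.
  have out v u : v \notin vs -> u \in K -> v != u -> G v u.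
    move=> vN uK vu; have := type_ok v vN.
    case: (boolP (u \in vs)) => [/(K_vs _ uK)[] -> | uN type_v].
    - by rewrite !inE => /or3P[] /eqP[].
    - by rewrite !inE => /or3P[] /eqP[].
    - by rewrite !inE => /or3P[] /eqP[].
    have vNu : v \notin u :: vs by rewrite in_cons negb_or vN vu.
    have := type7 _ _ uN vNu (type_ok _ uN); rewrite in_cons => /predU1P[e|].
      by have := ok_has _ type_v; rewrite (congr1 behead e : type v = nseq 6 false).
    by case/mapP => t _ [->].
  move=> u v uK vK uv.
  case: (boolP (u \in vs)) => [uvs|uN]; last exact: out.
  case: (boolP (v \in vs)) => [vvs|vN]; last by rewrite adj_sym out // eq_sym.
  move: uv; case: (K_vs _ uK uvs) => ->; case: (K_vs _ vK vvs) => ->;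
    rewrite ?eqxx // => _.
  - exact: (row 3 4).
  - exact: (row 3 5).
  - exact: (row 4 3).
  - exact: (row 4 5).
  - exact: (row 5 3).
  - exact: (row 5 4).
have typeK : {in K, forall k, [:: G k x; G k y; G k z] \in
    [:: [:: true; true; false]; [:: true; false; true]; [:: false; true; true]]}.
  move=> k kK; case: (boolP (k \in vs)) => [/(K_vs _ kK)[] ->|/type_ok].
  - by rewrite (row 3 0) // (row 3 1) // (row 3 2).
  - by rewrite (row 4 0) // (row 4 1) // (row 4 2).
  - by rewrite (row 5 0) // (row 5 1) // (row 5 2).
  by rewrite !inE => /or3P[] /eqP[-> -> -> _ _ _].
have nxy : ~~ G x y by rewrite (row 0 1).
have nxz : ~~ G x z by rewrite (row 0 2).
have nyz : ~~ G y z by rewrite (row 1 2).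
have uniq_xyz : uniq [:: x; y; z].
  by move: uniq_vs; rewrite (cat_uniq [:: x; y; z]) => /andP[].
set C := nbrs G x :&: nbrs G y; set D := nbrs G x :&: nbrs G z.
set W := nbrs G y :&: nbrs G z.
have C0 : C != set0.
  by apply/set0Pn; exists c; rewrite !inE (row 0 3) // (row 1 3).
have D0 : D != set0.
  by apply/set0Pn; exists d; rewrite !inE (row 0 4) // (row 2 4).
have W0 : W != set0.
  by apply/set0Pn; exists w; rewrite !inE (row 1 5) // (row 2 5).
have nbr_K a k : a \in [:: x; y; z] -> G a k -> k \in K.
  move=> a_in Gak; rewrite !inE; apply/negP; move: a_in; rewrite !inE.
  by case/or3P => /eqP ea; rewrite ea in Gak => /orP[/orP[]|] /eqP ek;
    move: Gak; rewrite ek ?adj_irrefl ?(negPf nxy) ?(negPf nxz) ?(negPf nyz) //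
      adj_sym ?(negPf nxy) ?(negPf nxz) ?(negPf nyz).
have cover_x : nbrs G x \subset C :|: D.
  apply/subsetP => k; rewrite !inE => Gxk.
  have := typeK k (nbr_K x k _ Gxk); rewrite !inE eqxx Gxk => /(_ isT).
  by rewrite ![G k _]adj_sym; case: (G y k); case: (G z k); rewrite Gxk.
have cover_y : nbrs G y \subset C :|: W.
  apply/subsetP => k; rewrite !inE => Gxk.
  have := typeK k (nbr_K y k _ Gxk); rewrite !inE eqxx orbT Gxk => /(_ isT).
  by rewrite ![G k _]adj_sym; case: (G x k); case: (G z k); rewrite Gxk.
have cover_z : nbrs G z \subset D :|: W.
  apply/subsetP => k; rewrite !inE => Gxk.
  have := typeK k (nbr_K z k _ Gxk); rewrite !inE eqxx !orbT Gxk => /(_ isT).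
  by rewrite ![G k _]adj_sym; case: (G x k); case: (G y k); rewrite Gxk.
(* Since x, y, z have degree at least 3, no two of C, D, W are singletons. Renaming makes the two
   larger classes those that meet at the third vertex of [sun_frame]. *)
have two (a : V) A B : nbrs G a \subset A :|: B -> #|A| <= 1 -> 1 < #|B|.
  move=> /subset_leq_card le A1; have := nbrs_ge3 G3 a.
  move=> /leq_trans /(_ le) /leq_trans /(_ (leq_card_setU A B)).
  by move: A1; clear; lia.
case: (leqP #|D| 1) => [D1|D2].
  have C2 : 1 < #|C| by apply: (two x D); rewrite // setUC.
  have W2 : 1 < #|W| by apply: (two z D).
  have KE : K = ~: [set x; z; y].
    by apply/setP => k; rewrite !inE -!orbA; congr negb; congr orb; rewrite orbC.
  apply: (@sun_frame R _ _ x z y) => //.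
  - move: uniq_xyz; rewrite /= !inE !andbT !negb_or [z == y]eq_sym.
    by case/andP => /andP[-> ->] ->.
  - by rewrite -KE.
  - move=> k; rewrite -KE => /typeK; rewrite !inE.
    by case: (G k x); case: (G k y); case: (G k z).
  - by rewrite [G z y]adj_sym.
  - by rewrite setIC.
case: (leqP #|W| 1) => [W1|W2].
  have C2 : 1 < #|C| by apply: (two y W); rewrite // setUC.
  have KE : K = ~: [set z; y; x].
    apply/setP => k; rewrite !inE; congr negb.
    by case: (k == x); case: (k == y); case: (k == z).
  apply: (@sun_frame R _ _ z y x) => //.
  - move: uniq_xyz; rewrite /= !inE !andbT !negb_or.
    by rewrite [z == y]eq_sym [z == x]eq_sym [y == x]eq_sym => /andP[/andP[-> ->] ->].
  - by rewrite -KE.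
  - move=> k; rewrite -KE => /typeK; rewrite !inE.
    by case: (G k x); case: (G k y); case: (G k z).
  - by rewrite [G z y]adj_sym [G z x]adj_sym [G y x]adj_sym.
  - by rewrite setIC.
  - by rewrite setIC.
  - by rewrite setIC.
exact: (@sun_frame R _ _ x y z).
Qed.

Lemma independent_triple_halin x y z c d w :
  uniq [:: x; y; z] -> ~~ G x y -> ~~ G x z -> ~~ G y z ->
  G c x -> G c y -> G d x -> G d z -> G w y -> G w z ->
  has_spanning_halin_subgraph R G.
Proof.
move=> uniq_xyz nxy nxz nyz Gcx Gcy Gdx Gdz Gwy Gwz.
have ncz : ~~ G c z.
  by apply/negP => Gcz; have := no_claw claw_free uniq_xyz Gcx Gcy Gcz;
    rewrite (negPf nxy) (negPf nxz) (negPf nyz).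
have ndy : ~~ G d y.
  by apply/negP => Gdy; have := no_claw claw_free uniq_xyz Gdx Gdy Gdz;
    rewrite (negPf nxy) (negPf nxz) (negPf nyz).
have nwx : ~~ G w x.
  by apply/negP => Gwx; have := no_claw claw_free uniq_xyz Gwx Gwy Gwz;
    rewrite (negPf nxy) (negPf nxz) (negPf nyz).
have uniq6 : uniq [:: x; y; z; c; d; w].
  have neq u v a : G u a -> ~~ G v a -> u != v.
    by move=> Gua; apply: contraNneq => <-.
  have irr u : ~~ G u u by rewrite adj_irrefl.
  have nyx : ~~ G y x by rewrite adj_sym.
  have nzx : ~~ G z x by rewrite adj_sym.
  have nzy : ~~ G z y by rewrite adj_sym.
  rewrite (cat_uniq [:: x; y; z]) uniq_xyz /= !inE !negb_or /= !andbT.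
  rewrite (neq c x x) // (neq c y y) // (neq c z x) // (neq d x x) // (neq d y x) //.
  rewrite (neq d z z) // (neq w x y) // (neq w y y) // (neq w z z) //.
  by rewrite (neq c d y) // (neq c w x) // (neq d w x).
have mxE a1 a2 a3 b1 b2 b3 :
    (forall u v, u \in [:: a1; a2; a3] -> v \in [:: a1; a2; a3] -> G u v = false) ->
    [/\ G b1 a1, G b1 a2 & ~~ G b1 a3] -> [/\ G b2 a1, ~~ G b2 a2 & G b2 a3] ->
    [/\ ~~ G b3 a1, G b3 a2 & G b3 a3] ->
    adj_mx G [:: a1; a2; a3; b1; b2; b3] = six_mx (G b1 b2) (G b1 b3) (G b2 b3).
  move=> ind [p1 p2 /negPf p3] [q1 /negPf q2 q3] [/negPf r1 r2 r3].
  have [i12 i13 i23] : [/\ G a1 a2 = false, G a1 a3 = false & G a2 a3 = false].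
    by split; apply: ind; rewrite !inE eqxx ?orbT.
  apply: adj_mx_cons.
    by rewrite /= i12 i13 [G a1 b1]adj_sym [G a1 b2]adj_sym [G a1 b3]adj_sym p1 q1 r1.
  apply: adj_mx_cons.
    by rewrite /= i23 [G a2 b1]adj_sym [G a2 b2]adj_sym [G a2 b3]adj_sym p2 q2 r2.
  apply: adj_mx_cons.
    by rewrite /= [G a3 b1]adj_sym [G a3 b2]adj_sym [G a3 b3]adj_sym p3 q3 r3.
  by do 3!(apply: adj_mx_cons; first by []).
have ind : forall u v, u \in [:: x; y; z] -> v \in [:: x; y; z] -> G u v = false.
  move=> u v; rewrite !inE => /or3P[] /eqP -> /or3P[] /eqP ->;
    rewrite ?adj_irrefl ?(negPf nxy) ?(negPf nxz) ?(negPf nyz) //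
    adj_sym ?(negPf nxy) ?(negPf nxz) ?(negPf nyz) //.
have mx6 : adj_mx G [:: x; y; z; c; d; w] = six_mx (G c d) (G c w) (G d w).
  exact: mxE.
have perm_uniq6 l : perm_eq l [:: x; y; z; c; d; w] -> uniq l.
  by move=> /perm_uniq ->.
have := free_adj_mx claw_free Z2_free uniq6; rewrite mx6.
(* A single chord is excluded: for cd, the triangle d, x, c has the tail d, z, w. Two chords are
   renamed so as to meet in the fourth vertex of the list. *)
case Gcd: (G c d); case Gcw: (G c w); case Gdw: (G d w) => //; try by move/(_ =P true).
- by move=> _; apply: (sun_halin uniq6); rewrite mx6 Gcd Gcw Gdw.
- by move=> _; apply: (two_chords_halin uniq6); rewrite mx6 Gcd Gcw Gdw.
- move=> _; apply: (@two_chords_halin [:: x; z; y; d; c; w]).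
    by apply: perm_uniq6; apply/permP => a /=; clear; lia.
  rewrite mxE //; last 1 first.
    move=> u v hu hv; apply: ind; [move: hu | move: hv];
      by rewrite !inE => /or3P[] ->; rewrite ?orbT.
  by rewrite [G d c]adj_sym Gcd Gcw Gdw.
- move=> _; apply: (@two_chords_halin [:: y; z; x; w; c; d]).
    by apply: perm_uniq6; apply/permP => a /=; clear; lia.
  rewrite mxE //; last 1 first.
    move=> u v hu hv; apply: ind; [move: hu | move: hv];
      by rewrite !inE => /or3P[] ->; rewrite ?orbT.
  by rewrite [G w c]adj_sym [G w d]adj_sym Gcd Gcw Gdw.
- by move=> _; apply: (hexagon_halin uniq6); rewrite mx6 Gcd Gcw Gdw.
Qed.

End SmallCases.

(** * Two vertices at distance three *)

Section FarPairs.
Variables (R : realType) (V : finType) (G : sgraph V).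
Hypothesis G3 : k_connected 3 G.
Hypothesis claw_free : induced_free K13 G.
Hypothesis Z2_free : induced_free Z2 G.

Definition geodesic3 a d e f : Prop :=
  [/\ G a d, G d e, G e f & [/\ ~~ G a e, ~~ G d f, ~~ G a f &
      forall v, G v a -> ~~ G v f]].

Lemma geodesic3_sym a d e f : geodesic3 a d e f -> geodesic3 f e d a.
Proof.
case=> Gad Gde Gef [nae ndf naf far]; rewrite /geodesic3 ![G f _]adj_sym.
rewrite [G e d]adj_sym [G e a]adj_sym [G d a]adj_sym; split=> //; split=> //.
by move=> v Gvf; apply: contraTN Gvf => /far.
Qed.

(* Neighbourhoods of a further vertex on a geodesic a, d, e, f. *)
Definition on_a := [:: true; false; false; false].
Definition on_de := [:: false; true; true; false].
Definition on_ade := [:: true; true; true; false].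
Definition on_def := [:: false; true; true; true].
Definition on_f := [:: false; false; false; true].
Definition on_none := [:: false; false; false; false].

(** [b] tells whether the two vertices are adjacent. All facts about pairs are gathered here so that
    one enumeration proves them. The restriction to six types discards the common neighbours of a
    and f, which freeness alone would allow: a 5-cycle is free. *)
Definition far_pair_pred (b : bool) (tu tv : seq bool) : bool :=
  let ok t := t \in [:: on_none; on_a; on_f; on_de; on_ade; on_def] in
  let inK t := t \in [:: on_de; on_ade; on_def] in
  ok tu ==> ok tv ==>
  [&& inK tu && inK tv ==> b, ~~ ((tu == on_a) && (tv == on_a)),
      ~~ ((tu == on_f) && (tv == on_f)),
      (tu == on_none) && (tv \in [:: on_ade; on_def]) ==> ~~ b &
      (tu == on_a) && (tv \in [:: on_ade; on_def]) ==> ~~ b].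

Definition P4_mx : seq (seq bool) :=
  ext_mx [:: true; false; false] (ext_mx [:: true; false] (ext_mx [:: true]
    (ext_mx [::] [::]))).

Section Geodesic.
Variables a d e f : V.
Hypothesis geo : geodesic3 a d e f.

Let ty v := [:: G v a; G v d; G v e; G v f].
Let vs := [:: a; d; e; f].

Let Gad : G a d. Proof. by case: geo. Qed.
Let Gde : G d e. Proof. by case: geo. Qed.
Let Gef : G e f. Proof. by case: geo. Qed.
Let nae : G a e = false. Proof. by case: geo => _ _ _ [/negPf]. Qed.
Let ndf : G d f = false. Proof. by case: geo => _ _ _ [_ /negPf]. Qed.
Let naf : G a f = false. Proof. by case: geo => _ _ _ [_ _ /negPf]. Qed.

Let uniq_vs : uniq vs.
Proof.
have neq u v b : G u b -> G v b = false -> u != v.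
  by move=> Gub Gvb; apply: contraTneq Gub => ->; rewrite Gvb.
rewrite /= !inE !negb_or andbT.
rewrite (neq a d d) ?adj_irrefl // (neq d e e) ?adj_irrefl //.
rewrite (neq e f f) ?adj_irrefl // [a == e]eq_sym (neq e a f) //.
rewrite (neq a f d) //; last by rewrite adj_sym.
by rewrite (neq d f a) // adj_sym.
Qed.

Let mx_vs : adj_mx G vs = P4_mx.
Proof.
apply: adj_mx_cons; first by rewrite /= Gad nae naf.
apply: adj_mx_cons; first by rewrite /= Gde ndf.
apply: adj_mx_cons; first by rewrite /= Gef.
by apply: adj_mx_cons.
Qed.

Lemma geodesic_type v : v \notin vs ->
  ty v \in [:: on_none; on_a; on_f; on_de; on_ade; on_def].
Proof.
move=> vN; case: geo => _ _ _ [_ _ _ /(_ v) far].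
have := @new_vertex_pred _ _ claw_free Z2_free vs _ (fun t =>
  ~~ (nth false t 0 && nth false t 3) ==>
  (t \in [:: on_none; on_a; on_f; on_de; on_ade; on_def])) v _ mx_vs uniq_vs vN.
move=> /(_ ltac:(vm_cast_no_check (erefl true))) /implyP; apply.
by rewrite /= negb_and -implybE; apply/implyP.
Qed.

Lemma geodesic_pair u v : u \notin vs -> v \notin vs -> u != v ->
  far_pair_pred (G u v) (ty u) (ty v).
Proof.
move=> uN vN uv; have uniq5 : uniq (v :: vs) by rewrite cons_uniq vN.
have uN' : u \notin v :: vs by rewrite in_cons negb_or uv uN.
have chk : all (fun tv => all (fun t => free_mx (ext_mx t (ext_mx tv P4_mx)) ==>
    far_pair_pred (head false t) (behead t) tv) (bitseqs 5)) (bitseqs 4).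
  by vm_cast_no_check (erefl true).
have tyE : [seq G v w | w <- vs] = ty v by [].
have mx5 := adj_mx_cons tyE mx_vs.
have := allP chk _ (mem_bitseqs (ty v)) => chk_v.
exact: (@new_vertex_pred _ _ claw_free Z2_free _ _ (fun t =>
  far_pair_pred (head false t) (behead t) (ty v)) u chk_v mx5 uniq5 uN').
Qed.

(** [f] has two neighbours besides [e], each of type [on_f] or [on_def], and two of type [on_f]
    cannot coexist. *)
Lemma geodesic_def : exists2 y, y \notin vs & ty y = on_def.
Proof.
have f_nbr y : G f y -> y != e -> y \notin vs.
  move=> Gfy ye; rewrite !inE (negPf ye) !negb_or /=; apply/and3P; split.
  - by apply: contraTneq Gfy => ->; rewrite adj_sym naf.
  - by apply: contraTneq Gfy => ->; rewrite adj_sym ndf.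
  - by apply: contraTneq Gfy => ->; rewrite adj_irrefl.
have f_type y : G f y -> y \notin vs -> ty y = on_f \/ ty y = on_def.
  move=> Gfy /geodesic_type; rewrite /ty [G y f]adj_sym Gfy !inE.
  by case: (G y a); case: (G y d); case: (G y e) => // _; [right | left].
have [y1 [Gy1 y1e _]] := third_nbr G3 f e e.
have [y2 [Gy2 y2e y21]] := third_nbr G3 f e y1.
have y1N := f_nbr _ Gy1 y1e; have y2N := f_nbr _ Gy2 y2e.
case: (f_type _ Gy1 y1N) => t1; last by exists y1.
case: (f_type _ Gy2 y2N) => t2; last by exists y2.
by have := geodesic_pair y2N y1N y21; rewrite t1 t2; case: (G y2 y1).
Qed.

(** Other neighbours of such a vertex miss both [a] and [d]. Two of them are adjacent, to avoid a
    claw with [a], and their triangle with [v] has the tail v, a, d. *)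
Lemma geodesic_no_tail v : v \notin vs -> ty v <> on_a.
Proof.
move=> vN tv; have [y yN yt] := geodesic_def.
have [Gva nvd nve nvf] : [/\ G v a, G v d = false, G v e = false & G v f = false].
  by case: tv.
have tail_nbr u : G v u -> u != a -> G u a = false /\ G u d = false.
  move=> Gvu ua.
  have uN : u \notin vs.
    rewrite !inE (negPf ua) !negb_or /=; apply/and3P; split.
    - by apply: contraTneq Gvu => ->; rewrite nvd.
    - by apply: contraTneq Gvu => ->; rewrite nve.
    - by apply: contraTneq Gvu => ->; rewrite nvf.
  have vu : v != u by apply: contraTneq Gvu => ->; rewrite adj_irrefl.
  have := geodesic_pair vN uN vu; rewrite tv Gvu.
  have := geodesic_type uN; rewrite !in_cons in_nil orbF.
  case/or4P => [|||/or3P[]] /eqP tu; rewrite tu //.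
  - by move=> _; case: tu.
  - by move=> _; case: tu.
  (* Type [on_de] is left, and it is excluded by the triangle u, e, y with tail u, v, a. *)
  have uy : u != y by apply: contraTneq isT => e1; move: tu; rewrite e1 yt.
  have vy : v != y by apply: contraTneq isT => e1; move: tv; rewrite e1 yt.
  have Guy : G u y.
    by have := geodesic_pair uN yN uy; rewrite tu yt; case: (G u y).
  have nvy : ~~ G v y.
    by have := geodesic_pair vN yN vy; rewrite tv yt; case: (G v y).
  case: tu => nua Gud Gue nuf; case: yt => nya _ Gye _.
  have := no_Z2 Z2_free (a := u) (b := e) (c := y) (d := v) (e := a).
  rewrite [G e y]adj_sym [G u v]adj_sym [G e v]adj_sym [G y v]adj_sym [G e a]adj_sym.
  by rewrite Gue Gye Guy Gvu Gva nua nve (negPf nvy) nae nya => /(_ isT isT isT isT isT).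
have [u1 [Gu1 u1a _]] := third_nbr G3 v a a.
have [u2 [Gu2 u2a u21]] := third_nbr G3 v a u1.
have [n1a n1d] := tail_nbr _ Gu1 u1a; have [n2a n2d] := tail_nbr _ Gu2 u2a.
have G12 : G u1 u2.
  have := @no_claw _ _ claw_free v a u1 u2.
  rewrite /= !inE negb_or ![a == _]eq_sym [u1 == u2]eq_sym u1a u2a u21.
  rewrite [G a u1]adj_sym [G a u2]adj_sym n1a n2a => h.
  by apply: h.
have := no_Z2 Z2_free (a := v) (b := u1) (c := u2) (d := a) (e := d).
rewrite Gu1 G12 Gu2 Gva Gad nvd n1a n2a n1d n2d => h.
by have := h isT isT isT isT isT.
Qed.

End Geodesic.

Lemma geodesic_halin a d e f : geodesic3 a d e f -> has_spanning_halin_subgraph R G.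
Proof.
move=> geo; have geo' := geodesic3_sym geo.
have [Gad Gde Gef [/negPf nae /negPf ndf /negPf naf far]] := geo.
set vs := [:: a; d; e; f]; pose ty v := [:: G v a; G v d; G v e; G v f].
have typ v : v \notin vs -> ty v \in [:: on_none; on_de; on_ade; on_def].
  move=> vN; have vN' : v \notin [:: f; e; d; a].
    by move: vN; rewrite !inE !negb_or => /and4P[-> -> -> ->].
  have := geodesic_type geo vN; rewrite !in_cons in_nil orbF /ty.
  case/or4P => [|||/or3P[]] /eqP tv; rewrite ?tv //.
  - by case: (geodesic_no_tail geo vN tv).
  - by case: (geodesic_no_tail geo' vN'); case: tv => -> -> -> ->.
have pr u v : u \notin vs -> v \notin vs -> u != v -> far_pair_pred (G u v) (ty u) (ty v).
  exact: geodesic_pair.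
(* With the type [on_a] and its mirror image gone, [K] is a clique, and outside it there are only
   [a], [f] and vertices of type [on_none]. *)
pose K := [set v | [|| v == d, v == e | G v d && G v e]].
have aK : a \notin K.
  rewrite inE nae andbF orbF negb_or; apply/andP; split.
    by apply: contraTneq Gad => ->; rewrite adj_irrefl.
  by apply: contraFneq naf => ->.
have fK : f \notin K.
  rewrite inE ![G f _]adj_sym ndf orbF negb_or; apply/andP; split.
    by apply: contraFneq naf => ->.
  by apply: contraTneq Gef => ->; rewrite adj_irrefl.
have dK : d \in K by rewrite inE eqxx.
have eK : e \in K by rewrite inE eqxx orbT.
have K_cases k : k \in K -> [\/ k = d, k = e | k \notin vs /\
    ty k \in [:: on_de; on_ade; on_def]].
  move=> kK; case: (eqVneq k d) => [->|kd]; first exact: Or31.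
  case: (eqVneq k e) => [->|ke]; first exact: Or32.
  have kN : k \notin vs.
    rewrite !inE !negb_or kd ke /=; apply/andP; split.
      by apply: contraNneq aK => <-.
    by apply: contraNneq fK => <-.
  apply: Or33; split=> //; have := typ k kN; move: kK.
  rewrite inE (negPf kd) (negPf ke) /= => /andP[Gkd _].
  by rewrite in_cons => /predU1P[[_ e1 _ _]|//]; rewrite e1 in Gkd.
have out_cases v : v \notin K -> [\/ v = a, v = f | v \notin vs /\ ty v = on_none].
  move=> vK; case: (eqVneq v a) => [->|va]; first exact: Or31.
  case: (eqVneq v f) => [->|vf]; first exact: Or32.
  have vN : v \notin vs.
    rewrite !inE !negb_or va vf /= andbT; apply/andP; split.
      by apply: contraNneq vK => ->.
    by apply: contraNneq vK => ->.
  apply: Or33; split=> //; have := typ v vN; move: vK; rewrite inE !negb_or /ty.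
  case/and3P => _ _; rewrite !inE.
  by case: (G v a); case: (G v d); case: (G v e); case: (G v f).
have clK : clique G K.
  have dk k : k \in K -> k != d -> G d k.
    move=> /K_cases[->|->|[_]]; [by rewrite eqxx | by [] |].
    by rewrite adj_sym !inE => /or3P[] /eqP[].
  have ek k : k \in K -> k != e -> G e k.
    move=> /K_cases[->|->|[_]]; [by rewrite adj_sym | by rewrite eqxx |].
    by rewrite adj_sym !inE => /or3P[] /eqP[].
  move=> u v uK vK uv; case: (K_cases _ uK) => [eu|eu|[uN tu]].
  - by rewrite eu dk // -eu eq_sym.
  - by rewrite eu ek // -eu eq_sym.
  case: (K_cases _ vK) => [ev|ev|[vN tv]].
  - by rewrite adj_sym ev dk // -ev.
  - by rewrite adj_sym ev ek // -ev.
  have := pr _ _ uN vN uv; rewrite /far_pair_pred.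
  have okK t : t \in [:: on_de; on_ade; on_def] ->
      t \in [:: on_none; on_a; on_f; on_de; on_ade; on_def].
    by rewrite !in_cons => ->; rewrite !orbT.
  by rewrite (okK _ tu) (okK _ tv) tu tv /= => /andP[].
have none_K w k : w \notin vs -> ty w = on_none -> k \in K -> G w k ->
    [/\ k \notin vs, G k d, G k e & G k a = false].
  move=> wN tw kK Gwk; have [nwa nwd nwe nwf] := tw.
  case: (K_cases _ kK) => [ek|ek|[kN tk]].
  - by rewrite ek nwd in Gwk.
  - by rewrite ek nwe in Gwk.
  have wk : w != k by apply: contraTneq Gwk => ->; rewrite adj_irrefl.
  have := pr _ _ wN kN wk; move: tk; rewrite !in_cons in_nil orbF tw Gwk.
  by case/or3P => /eqP tk; rewrite tk //; case: tk.
(* Both vertices are adjacent, by the claw at [k] with [d], and their triangle with [k] has the tail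
   k, d, a. *)
have no_fan w w' k : w \notin vs -> ty w = on_none -> w' \notin vs ->
    ty w' = on_none -> k \in K -> G w k -> G w' k -> w = w'.
  move=> wN tw w'N tw' kK Gwk Gw'k; apply: contraTeq isT => ww'.
  have [kN Gkd Gke nka] := none_K _ _ wN tw kK Gwk.
  have [nwa nwd nwe _] := tw; have [nwa' nwd' nwe' _] := tw'.
  have neqd u : u \notin vs -> d != u by apply: contraNneq => <-; rewrite !inE eqxx orbT.
  have Gww' : G w w'.
    have := @no_claw _ _ claw_free k d w w'.
    rewrite /= !inE negb_or !neqd // ww' [G d w]adj_sym [G d w']adj_sym nwd nwd'.
    by rewrite [G k w]adj_sym [G k w']adj_sym => h; apply: h.
  have := no_Z2 Z2_free (a := k) (b := w) (c := w') (d := d) (e := a).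
  rewrite [G k w]adj_sym [G k w']adj_sym [G d a]adj_sym Gwk Gw'k Gww' Gkd Gad.
  by rewrite nka nwd nwd' nwa nwa' => /(_ isT isT isT isT isT).
have a_nbr v : G a v -> v \in K.
  move=> Gav; apply: contraTT Gav => /out_cases[->|->|[_ [+ _ _ _]]].
  - by rewrite adj_irrefl.
  - by rewrite naf.
  - by rewrite adj_sym => ->.
have f_nbr v : G f v -> v \in K.
  move=> Gav; apply: contraTT Gav => /out_cases[->|->|[_ [_ _ _ +]]].
  - by rewrite adj_sym naf.
  - by rewrite adj_irrefl.
  - by rewrite adj_sym => ->.
(* For [u] of type [on_none], the triangle k, d, e with tail k, u, v forces the edge kv, against
   [no_fan]. *)
have no_edge u v k : u \notin K -> v \notin K -> k \in K -> G u k -> ~~ G u v.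
  move=> uK vK kK Guk; apply/negP => Guv.
  case: (out_cases _ uK) => [eu|eu|[uN tu]].
  - by case/negP: vK; apply: a_nbr; rewrite -eu.
  - by case/negP: vK; apply: f_nbr; rewrite -eu.
  case: (out_cases _ vK) => [ev|ev|[vN tv]].
  - by case: tu; rewrite -ev Guv.
  - by case: tu => _ _ _; rewrite -ev Guv.
  have [kN Gkd Gke nka] := none_K _ _ uN tu kK Guk.
  have Gkv : G k v.
    have := no_Z2 Z2_free (a := k) (b := d) (c := e) (d := u) (e := v).
    have [_ nud nue _] := tu; have [_ nvd nve _] := tv.
    rewrite Gkd Gde Gke [G k u]adj_sym Guk Guv [G d u]adj_sym [G e u]adj_sym.
    rewrite [G d v]adj_sym [G e v]adj_sym nud nue nvd nve !orbF => h.
    exact: h.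
  have uv : u = v by apply: (no_fan _ _ k); rewrite // adj_sym.
  by move: Guv; rewrite uv adj_irrefl.
(* [K] and its neighbours are closed under adjacency by [no_edge], so connectedness gives all
   vertices. *)
have has_K v : v \in K \/ exists2 k, k \in K & G v k.
  pose S := [set v | (v \in K) || [exists k in K, G v k]].
  have SE u : (u \in S) = (u \in K) || [exists k in K, G u k] by rewrite [LHS]in_set.
  have : v \in S.
    apply: (@adj_closed _ _ G3 S d v); last by rewrite SE dK.
    move=> u w; rewrite !SE => u_S Guw; apply/orP.
    case: (boolP (u \in K)) u_S => [uK _|uK /existsP[k /andP[kK Guk]]].
      by right; apply/existsP; exists u; rewrite uK adj_sym.
    by left; apply: contraTT Guw => wK; apply: no_edge Guk.
  rewrite SE.
  by case/orP => [|/existsP[k /andP[kK Gvk]]]; [left | right; exists k].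
apply: (@disjoint_attachments_halin R V G G3 K clK _ _ a aK).
- move=> u v; rewrite !in_setC => uK vK.
  case: (has_K u) => [|[k kK Guk]]; first by rewrite (negPf uK).
  exact: no_edge Guk.
- move=> k kK u v; rewrite !in_setC => uK vK Gku Gkv.
  have Kd w : w \notin K -> G d w -> w = a.
    move=> /out_cases[//|->|[_ [_ + _ _]]]; first by rewrite ndf.
    by rewrite adj_sym => ->.
  have Ke w : w \notin K -> G e w -> w = f.
    move=> /out_cases[->|//|[_ [_ _ + _]]]; first by rewrite adj_sym nae.
    by rewrite adj_sym => ->.
  case: (K_cases _ kK) => [ek|ek|[kN tk]].
  + by rewrite ek in Gku Gkv; rewrite (Kd u uK Gku) (Kd v vK Gkv).
  + by rewrite ek in Gku Gkv; rewrite (Ke u uK Gku) (Ke v vK Gkv).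
  have kK' w : w \notin K -> G k w -> [\/ w = a /\ ty k = on_ade,
      w = f /\ ty k = on_def | [/\ w \notin vs, ty w = on_none & ty k = on_de]].
    move=> wK Gkw; move: tk; rewrite !in_cons in_nil orbF.
    case: (out_cases _ wK) => [ew|ew|[wN tw]].
    - rewrite ew in Gkw; move=> /or3P[] /eqP tk; rewrite tk; apply: Or31 => //.
        by case: tk; rewrite Gkw.
      by case: tk; rewrite Gkw.
    - rewrite ew in Gkw; move=> /or3P[] /eqP tk; rewrite tk; apply: Or32 => //.
        by case: tk => _ _ _; rewrite Gkw.
      by case: tk => _ _ _; rewrite Gkw.
    - have wk : w != k by apply: contraTneq Gkw => ->; rewrite adj_irrefl.
      rewrite adj_sym in Gkw; have := pr _ _ wN kN wk; rewrite tw Gkw.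
      by move=> + /or3P[] /eqP tk; rewrite tk // => _; apply: Or33.
  case: (kK' u uK Gku) => [[-> tu]|[-> tu]|[uN tu tk']];
  case: (kK' v vK Gkv) => [[-> tv]|[-> tv]|[vN tv tk'']] //;
  do ?by [rewrite tu in tv | rewrite tu in tk'' | rewrite tk' in tv].
  by apply: (no_fan _ _ k); rewrite // adj_sym.
Qed.

End FarPairs.

(** * Graphs without independent triples *)

Section HamiltonPaths.
Variables (V : finType) (G : sgraph V).
Hypothesis alpha2 : forall x y z, uniq [:: x; y; z] -> [|| G x y, G x z | G y z].

Lemma clique_sorted (A : {set V}) l :
  clique G A -> uniq l -> {subset l <= A} -> sorted G l.
Proof.
move=> clA; elim: l => [//|a [//|b l] IHl] /andP[aN uniq_l] sub /=.
rewrite clA ?sub ?inE ?eqxx ?orbT //=; last first.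
  by apply: contraNneq aN => ->; rewrite mem_head.
by apply: IHl => // v vl; apply: sub; rewrite inE vl orbT.
Qed.

Lemma clique_order (A : {set V}) a b : clique G A -> a \in A -> b \in A ->
  (a = b -> A = [set a]) ->
  exists l, [/\ uniq (a :: l), a :: l =i A, path G a l & last a l = b].
Proof.
move=> clA aA bA; case: (eqVneq a b) => [<- /(_ erefl) ->|ab _].
  by exists [::]; split=> // v; rewrite !inE.
exists (rcons (enum (A :\ a :\ b)) b).
have mem_l : a :: rcons (enum (A :\ a :\ b)) b =i A.
  move=> v; rewrite in_cons mem_rcons in_cons mem_enum !in_setD1.
  by case: (eqVneq v a) => [->|_] /=; [|case: (eqVneq v b) => [->|_] /=].
have uniq_l : uniq (a :: rcons (enum (A :\ a :\ b)) b).
  rewrite cons_uniq mem_rcons in_cons mem_enum !in_setD1 eqxx /= andbF orbF ab.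
  by rewrite rcons_uniq mem_enum in_setD1 eqxx enum_uniq.
split=> //; last by rewrite last_rcons.
by apply: (clique_sorted clA uniq_l) => v; rewrite mem_l.
Qed.

(** Induction, adding [w]. A path whose ends both miss [w] closes to a cycle, which is opened at a
    neighbour of [w]; if there is none, the old vertices form a clique. Given two cliques, [w] links
    them to a path if it sees both; if it misses one entirely, it sees all of the other and joins
    that one. *)
Lemma hamilton_path_or_split (D : {set V}) :
  (exists p, [/\ uniq p, p =i D & sorted G p]) \/
  (exists C1 C2 : {set V}, [/\ C1 :|: C2 = D, C1 :&: C2 = set0,
     C1 != set0 /\ C2 != set0, clique G C1 /\ clique G C2 &
     {in C1 & C2, forall u v, G u v = false}]).
Proof.
have [n] := ubnP #|D|; elim: n D => [//|n IHn] D; rewrite ltnS => leDn.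
have [->|[w wD]] := set_0Vmem D.
  by left; exists [::]; split=> // v; rewrite inE.
have wN : w \notin D :\ w by rewrite !inE eqxx.
have DE : w |: (D :\ w) = D by rewrite setD1K.
have /IHn : #|D :\ w| < n by move: leDn; rewrite (cardsD1 w) wD.
move: (D :\ w) wN DE => D' wN DE.
have far2 u v : u \in D' -> v \in D' -> u != v -> ~~ G w u -> ~~ G w v -> G u v.
  move=> uD vD uv nwu nwv; have := alpha2 (x := w) (y := u) (z := v).
  rewrite /= !inE uv andbT negb_or (negPf nwu) (negPf nwv) /=; apply.
  by rewrite andbT; apply/andP; split; apply: contraNneq wN => ->.
case=> [[p [uniq_p mem_p srt]]|[C1 [C2 [CE C12 [C1n C2n] [cl1 cl2] no]]]].
  have wNp : w \notin p by rewrite mem_p.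
  have path_done q : perm_eq q (w :: p) -> sorted G q ->
      exists p, [/\ uniq p, p =i D & sorted G p].
    move=> pq sq; exists q; split=> //; first by rewrite (perm_uniq pq) /= wNp.
    by move=> v; rewrite (perm_mem pq) in_cons mem_p -DE !inE.
  case: p uniq_p mem_p srt wNp path_done => [|x p] uniq_p mem_p srt wNp path_done.
    by left; apply: (path_done [:: w]).
  have pth : path G x p by [].
  case: (boolP (G w x)) => [Gwx|nwx].
    by left; apply: (path_done (w :: x :: p)) => //=; rewrite Gwx.
  case: (boolP (G (last x p) w)) => [Gyw|nyw].
    left; apply: (path_done (x :: rcons p w)).
      by rewrite -rcons_cons perm_rcons.
    by rewrite /= rcons_path pth.
  have [v|none] := pickP (fun v => (v \in x :: p) && G w v).
    move=> /andP[vp Gwv].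
    have xy : x != last x p.
      case: (p) uniq_p vp => [_|y l /andP[xN _] _].
        by rewrite inE => /eqP ev; rewrite ev (negPf nwx) in Gwv.
      by apply/eqP => /= e; move: xN; rewrite [X in X \notin _]e mem_last.
    have Gyx : G (last x p) x.
      rewrite adj_sym; apply: far2; rewrite // -?mem_p ?mem_head ?mem_last //.
      by rewrite adj_sym.
    have cyc : cycle G (x :: p) by rewrite /= rcons_path Gyx pth.
    have [i p' rot_p] := rot_to vp.
    left; apply: (path_done (w :: v :: p')).
      by rewrite perm_cons -rot_p perm_rot.
    have : cycle G (v :: p') by rewrite -rot_p rot_cycle.
    by rewrite /= rcons_path Gwv => /andP[].
  have nw u : u \in D' -> ~~ G w u.
    by rewrite -mem_p => up; have := none u; rewrite up /= => ->.
  right; exists [set w], D'; split=> //.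
  - by apply/setP => v; rewrite !inE; apply/andP => -[/eqP -> wD']; rewrite wD' in wN.
  - split; first by apply/set0Pn; exists w; rewrite inE.
    by apply/set0Pn; exists x; rewrite -mem_p mem_head.
  - split; first by move=> u v /set1P -> /set1P ->; rewrite eqxx.
    by move=> u v uD vD uv; apply: far2; rewrite ?nw.
  - by move=> u v /set1P -> vD; apply/negbTE/nw.
have join (A B : {set V}) : A :|: B = D' -> A :&: B = set0 -> A != set0 -> B != set0 ->
    clique G A -> clique G B -> {in A & B, forall u v, G u v = false} ->
    (forall a, a \in A -> ~~ G w a) ->
    exists C1 C2 : {set V}, [/\ C1 :|: C2 = D, C1 :&: C2 = set0,
      C1 != set0 /\ C2 != set0, clique G C1 /\ clique G C2 &
      {in C1 & C2, forall u v, G u v = false}].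
  move=> AB AB0 An Bn clA clB noAB wA; exists A, (w |: B).
  have wNA : w \notin A by apply: contra wN; rewrite -AB inE => ->.
  have wNB : w \notin B by apply: contra wN; rewrite -AB inE orbC => ->.
  have wB b : b \in B -> G w b.
    move=> bB; case/set0Pn: An => a aA.
    have := alpha2 (x := w) (y := a) (z := b).
    rewrite (negPf (wA _ aA)) (noAB a b) // orbF; apply.
    rewrite /= !inE andbT negb_or; apply/andP; split.
      apply/andP; split; [by apply: contraNneq wNA => ->|].
      by apply: contraNneq wNB => ->.
    apply/eqP => e; have : a \in A :&: B by rewrite inE aA e.
    by rewrite AB0 inE.
  split=> //.
  - by rewrite setUCA AB.
  - apply/setP => v; rewrite !inE; apply/andP => -[vA /predU1P[e|vB]].
      by rewrite -e vA in wNA.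
    have : v \in A :&: B by rewrite inE vA vB.
    by rewrite AB0 inE.
  - by split=> //; apply/set0Pn; exists w; rewrite !inE eqxx.
  - split=> // u v; rewrite !inE => /predU1P[->|uB] /predU1P[->|vB].
    + by rewrite eqxx.
    + by move=> _; exact: wB.
    + by move=> _; rewrite adj_sym wB.
    + exact: clB.
  - move=> u v uA; rewrite !inE => /predU1P[->|]; last exact: noAB.
    by rewrite adj_sym; apply/negbTE/wA.
have [c1 /andP[c1C Gwc1]|no1] := pickP (fun c => (c \in C1) && G w c); last first.
  right; apply: (join C1 C2) => // a aC; have := no1 a; by rewrite aC /= => ->.
have [c2 /andP[c2C Gwc2]|no2] := pickP (fun c => (c \in C2) && G w c); last first.
  right; apply: (join C2 C1); rewrite // 1?setUC 1?setIC //.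
    by move=> u v uC vC; rewrite adj_sym no.
  by move=> a aC; have := no2 a; rewrite aC /= => ->.
left; exists (enum (C1 :\ c1) ++ c1 :: w :: c2 :: enum (C2 :\ c2)).
have cnt v : count_mem v (enum (C1 :\ c1) ++ c1 :: w :: c2 :: enum (C2 :\ c2)) = (v \in D).
  have : (v \in D) = (w == v) + ((v \in C1) + (v \in C2)) :> nat.
    rewrite -DE in_setU1 [w == v]eq_sym; case: (eqVneq v w) => [->|_] /=.
      by have := wN; rewrite -CE inE; case: (w \in C1); case: (w \in C2).
    rewrite -CE inE; have : (v \in C1 :&: C2) = false by rewrite C12 inE.
    by rewrite inE; case: (v \in C1); case: (v \in C2).
  have -> : (v \in C1) = (c1 == v) + (v \in C1 :\ c1) :> nat.
    by rewrite in_setD1 [c1 == v]eq_sym; case: eqVneq => [->|_]; rewrite ?c1C.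
  have -> : (v \in C2) = (c2 == v) + (v \in C2 :\ c2) :> nat.
    by rewrite in_setD1 [c2 == v]eq_sym; case: eqVneq => [->|_]; rewrite ?c2C.
  move=> ->; rewrite count_cat /= !count_enum; clear; lia.
have mem_l v : (v \in enum (C1 :\ c1) ++ c1 :: w :: c2 :: enum (C2 :\ c2)) = (v \in D).
  by rewrite -has_pred1 has_count cnt; case: (v \in D).
split=> //; first by apply: count_mem_uniq => v; rewrite cnt mem_l.
rewrite sorted_cat_cons; apply/andP; split.
  apply: (clique_sorted cl1); first by rewrite rcons_uniq mem_enum !inE eqxx enum_uniq.
  by move=> v; rewrite mem_rcons inE mem_enum in_setD1 => /predU1P[->|/andP[]].
rewrite /= adj_sym Gwc1 Gwc2 /=.
apply: (clique_sorted cl2 (l := c2 :: _)); first by rewrite /= mem_enum !inE eqxx enum_uniq.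
by move=> v; rewrite inE mem_enum in_setD1 => /predU1P[->|/andP[]].
Qed.

End HamiltonPaths.

Section Alpha2.
Variables (R : realType) (V : finType) (G : sgraph V).
Hypothesis G3 : k_connected 3 G.
Hypothesis Z2_free : induced_free Z2 G.
Hypothesis alpha2 : forall x y z, uniq [:: x; y; z] -> [|| G x y, G x z | G y z].

Lemma adj_neq u v : G u v -> u != v.
Proof. by apply: contraTneq => ->; rewrite adj_irrefl. Qed.

Definition misses (v : V) : {set V} := [set m | (m != v) && ~~ G v m].

Lemma missesC u v : (u \in misses v) = (v \in misses u).
Proof. by rewrite !inE eq_sym adj_sym. Qed.

Lemma missesP u v : u \in misses v -> u != v /\ G v u = false.
Proof. by rewrite inE => /andP[-> /negPf]. Qed.

Lemma count_of (l : seq V) (A : {set V}) v : uniq l -> l =i A -> count_mem v l = (v \in A).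
Proof. by move=> ul lA; rewrite count_uniq_mem // lA. Qed.

Lemma seq_card (l : seq V) (A : {set V}) : uniq l -> l =i A -> size l = #|A|.
Proof. by move=> ul lA; rewrite -(card_uniqP ul); apply: eq_card. Qed.

(** * A vertex with the most non-neighbours *)

Section MaxMisses.
Variable e : V.
Hypothesis e_max : forall v, #|misses v| <= #|misses e|.
Let M := misses e.
Let D := nbrs G e.

(** The working form of maximality: non-neighbours exhibited at any vertex bound |M| from below. *)
Lemma misses_max v l : uniq l -> {subset l <= misses v} -> size l <= #|M|.
Proof.
move=> ul sub; apply: leq_trans (e_max v); rewrite -(card_uniqP ul).
by apply/subset_leq_card/subsetP.
Qed.

Lemma parts v : (e == v) + (v \in D) + (v \in M) = 1.
Proof.
rewrite /M /misses /D !inE eq_sym; case: (eqVneq v e) => [->|_] /=.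
  by rewrite adj_irrefl.
by case: (G e v).
Qed.

Lemma M_clique : clique G M.
Proof.
move=> u v /missesP[ue nu] /missesP[ve nv] uv.
have := alpha2 (x := e) (y := u) (z := v); rewrite nu nv /=; apply.
by rewrite !inE ![e == _]eq_sym negb_or ue ve uv.
Qed.

Lemma not_MD m : m \in M -> m \in D = false.
Proof. by rewrite !inE => /andP[_ /negPf ->]. Qed.

Definition D1 : {set V} := [set d in D | [exists m in M, G d m]].

Lemma D1P d : reflect (G e d /\ exists2 m, m \in M & G d m) (d \in D1).
Proof.
rewrite inE /D inE; apply: (iffP andP) => [[Ged /existsP[m /andP[mM Gdm]]]|[Ged [m mM Gdm]]].
  by split=> //; exists m.
by split=> //; apply/existsP; exists m; rewrite mM.
Qed.

(** Let [m] be a neighbour of [d] in M. If both were missed, the triangle m, m1, m2 would have the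
    tail m, d, e. *)
Lemma miss_one d m1 m2 : d \in D1 -> m1 \in M -> m2 \in M -> m1 != m2 ->
  G d m1 || G d m2.
Proof.
move=> /D1P[Ged [m mM Gdm]] m1M m2M m12; apply: contraT => /norP[n1 n2].
have mn1 : m != m1 by apply: contraNneq n1 => <-.
have mn2 : m != m2 by apply: contraNneq n2 => <-.
have [_ nem] := missesP mM; have [_ nem1] := missesP m1M; have [_ nem2] := missesP m2M.
have := no_Z2 Z2_free (a := m) (b := m1) (c := m2) (d := d) (e := e).
rewrite (M_clique mM m1M mn1) (M_clique m1M m2M m12) (M_clique mM m2M mn2).
rewrite [G m d]adj_sym Gdm [G d e]adj_sym Ged [G m e]adj_sym [G m1 e]adj_sym.
rewrite [G m2 e]adj_sym nem nem1 nem2 [G m1 d]adj_sym [G m2 d]adj_sym (negPf n1) (negPf n2).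
by move=> /(_ isT isT isT isT isT).
Qed.

Lemma D1_ge3 : M != set0 -> 2 < #|D1|.
Proof.
case/set0Pn => m mM; rewrite ltnNge; apply/negP => le2.
have eND1 : e \notin D1 by apply/negP => /D1P[]; rewrite adj_irrefl.
have mND1 : m \notin D1 by apply/negP => /D1P[Gem _]; have [_] := missesP mM; rewrite Gem.
have [me nem] := missesP mM.
suff : m \in e |: (D :\: D1).
  by rewrite in_setU1 in_setD (negPf me) not_MD // andbF.
apply: (@small_cut _ _ G3 D1 _ e) => //; last by rewrite in_setU1 eqxx.
move=> u v.
rewrite !in_setU1 !in_setD => /predU1P[->|/andP[uN uD]] Guv vN.
  by rewrite vN /= inE Guv orbT.
rewrite vN; have := parts v; case: (boolP (v \in M)) => [vM|_].
  case/negP: uN; apply/D1P; split; first by rewrite inE in uD.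
  by exists v.
by rewrite [v == e]eq_sym /=; case: (e == v) => //; case: (v \in D).
Qed.

(** The graph is complete, and the frame is a wheel around [e]. *)
Lemma complete_halin : M = set0 -> has_spanning_halin_subgraph R G.
Proof.
move=> M0; have all_adj u v : u != v -> G u v.
  move=> uv; apply: contraT => nuv; have : v \in misses u by rewrite inE eq_sym uv.
  have : #|misses u| <= 0 by rewrite -(cards0 V) -M0.
  by rewrite leqn0 cards_eq0 => /eqP ->; rewrite inE.
have [n4 _] := G3; have [a aD] : exists a, a \in ~: [set e].
  by apply/card_gt0P; have := cardsC [set e]; rewrite cards1; move: n4; clear; lia.
pose B := ~: [set e; a]; have ea : a != e by rewrite !inE in aD.
have B2 : 1 < #|B|.
  have := cardsC [set e; a]; rewrite cards2 eq_sym ea -/B.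
  by move: n4 => /[swap] <-; clear; lia.
have inB v : (v \in B) = (v != e) && (v != a) by rewrite !inE negb_or.
apply: (@simple_frame_halin _ R G [:: (e, a :: enum B)]); split => //.
- apply: count_mem1_cover => v; rewrite /hubs /leaves /= cats0 count_enum inB.
  rewrite ![_ == v]eq_sym; case: (eqVneq v e) => [->|ve] /=.
    by rewrite eq_sym (negPf ea).
  by case: (v == a).
- rewrite /= !andbT all_adj 1?eq_sym //=; apply/allP => v; rewrite mem_enum inB.
  by case/andP => ve _; apply: all_adj; rewrite eq_sym.
- split; last by rewrite /leaves /= cats0 -cardE.
  rewrite /leaves /= cats0 -cats1; apply: block_path => //.
  + by move=> B0; rewrite B0 cards0 in B2.
  + by move=> u; rewrite inB => /andP[_ ua]; apply: all_adj; rewrite eq_sym.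
  + by move=> u; rewrite inB => /andP[_ ua]; exact: all_adj.
  + by move=> u v _ _; exact: all_adj.
- by case=> [|//] _ /=; rewrite -cardE; move: B2; clear; lia.
Qed.

(** Every vertex misses at most one other, so [m], which misses [e], sees all of D. *)
Lemma one_miss_halin : #|M| = 1 -> has_spanning_halin_subgraph R G.
Proof.
move=> /eqP/cards1P[m Mm]; have mM : m \in M by rewrite Mm inE.
have M1 : #|M| = 1 by rewrite Mm cards1.
have [me nem] := missesP mM.
have Dm d : d \in D -> G d m.
  move=> dD; apply: contraT => ndm.
  have ed : e != d by apply: adj_neq; rewrite inE in dD.
  have := @misses_max m [:: e; d]; rewrite /= M1 inE ed => h.
  have : 2 <= 1; last by []. apply: h => // u; rewrite !inE => /orP[] /eqP ->.
    by rewrite eq_sym me adj_sym nem.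
  by rewrite [G m d]adj_sym ndm andbT; apply: contraTneq dD => ->; rewrite not_MD.
have DD1 : D1 = D.
  apply/setP => d; apply/D1P/idP => [[Ged _]|dD]; first by rewrite inE.
  by split; [rewrite inE in dD | exists m; rewrite ?Dm].
have D3 : 2 < #|D| by rewrite -DD1 D1_ge3 // -card_gt0 M1.
have Ge d : d \in D -> G e d by rewrite inE.
have cM v : (m == v) = (v \in M) :> nat by rewrite Mm inE eq_sym.
have [[p [uniq_p mem_p srt]]|[C1 [C2 [CE C12 [C1n C2n] _ no]]]] :=
  hamilton_path_or_split alpha2 D; last first.
  (* In a split of D one part has two vertices, and a vertex of the other part would miss both. *)
  have two (A B : {set V}) : A :&: B = set0 -> A != set0 -> 1 < #|B| ->
      {in A & B, forall u v, G u v = false} -> False.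
    move=> AB /set0Pn[u uA] /card_gt1P[b1 [b2 [b1B b2B b12]]] noAB.
    have := @misses_max u [:: b1; b2]; rewrite /= M1 inE b12 => h.
    have : 2 <= 1; last by []. apply: h => // v.
    have vB : v \in [:: b1; b2] -> v \in B by rewrite !inE => /orP[] /eqP ->.
    move=> /vB {}vB; rewrite inE noAB // andbT.
    apply/eqP => evu; have : u \in A :&: B by rewrite inE uA -evu.
    by rewrite AB inE.
  have cardD : #|C1| + #|C2| = #|D| by rewrite -cardsUI CE C12 cards0 addn0.
  case: (leqP #|C1| 1) => C1s.
    by case: (two C1 C2) => //; move: cardD D3 C1s; clear; lia.
  by case: (two C2 C1) => //; [rewrite setIC | move=> u v uC vC; rewrite adj_sym no].
have size_p : 2 < size p by rewrite (seq_card uniq_p mem_p).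
case: p uniq_p mem_p srt size_p => [//|f [//|p1 [//|p2 r]]] uniq_p mem_p srt _.
have cD v := count_of v uniq_p mem_p.
have inD v : v \in [:: f, p1, p2 & r] -> v \in D by rewrite mem_p.
have fD : f \in D by rewrite inD // !inE eqxx.
have p1D : p1 \in D by rewrite inD // !inE eqxx !orbT.
have p2D : p2 \in D by rewrite inD // !inE eqxx !orbT.
move: srt => /= /and3P[Gfp Gpp pth].
case: r uniq_p mem_p cD inD pth => [|p3 r] uniq_p mem_p cD inD pth.
  (* For |D| = 3 the vertex [e] would have too low a degree as a hub; the frame is a wheel around
     [p1]. *)
  apply: (@simple_frame_halin _ R G [:: (p1, [:: e; f; m; p2])]); split => //.
  - apply: count_mem1_cover => v; have := parts v; rewrite -cM -cD.
    by rewrite /hubs /leaves /=; clear; lia.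
  - by rewrite /= [G p1 e]adj_sym Ge // [G p1 f]adj_sym Gfp Dm // Gpp.
  - split=> //; rewrite /leaves /= Ge // Dm // [G m p2]adj_sym Dm //.
    by rewrite adj_sym Ge.
  - by case.
apply: (@simple_frame_halin _ R G [:: (f, [:: m; p1]); (e, [:: p2, p3 & r])]); split => //.
- apply: count_mem1_cover => v; have := parts v; rewrite -cM -cD.
  by rewrite /hubs /leaves /= cats0; clear; lia.
- by rewrite /= [G f e]adj_sym Ge.
- rewrite /= Dm // Gfp !Ge //= ?andbT; last by rewrite inD // !inE eqxx !orbT.
  by apply/allP => u ur; apply: Ge; rewrite inD // !inE ur !orbT.
- split=> //; rewrite /leaves /= cats0 [G m p1]adj_sym Dm // Gpp.
  move: pth => /= /andP[-> pth]; rewrite rcons_path pth Dm // inD //.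
  by rewrite !in_cons [_ == p3]lock -lock -in_cons mem_last !orbT.
- by case=> [|[|//]] _ /=; lia.
Qed.

Section TwoMisses.
Hypothesis M2 : 1 < #|M|.

Let M_n0 : M != set0. Proof. by rewrite -card_gt0 ltnW. Qed.

Lemma third_M m1 m2 : 2 < #|M| -> exists m3, [/\ m3 \in M, m3 != m1 & m3 != m2].
Proof.
move=> M3; have : ~~ (M \subset [set m1; m2]).
  apply: contraTN M3 => /subset_leq_card le; rewrite -leqNgt.
  by apply: leq_trans le _; rewrite cards2; case: (m1 != m2).
case/subsetPn => m3 m3M; rewrite !inE negb_or => /andP[n1 n2].
by exists m3.
Qed.

Lemma neq_DM d m : d \in D -> m \in M -> d != m.
Proof. by move=> dD mM; apply: contraTneq dD => ->; rewrite not_MD. Qed.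

Lemma D_adj d : d \in D -> G e d. Proof. by rewrite inE. Qed.

Lemma D_neq d : d \in D -> e != d. Proof. by move=> /D_adj/adj_neq. Qed.

Lemma D1_D d : d \in D1 -> d \in D. Proof. by case/D1P; rewrite inE. Qed.

Lemma e_miss m : m \in M -> e \in misses m. Proof. by rewrite missesC. Qed.

Lemma D_miss d m : d \in D -> m \in M -> ~~ G d m -> d \in misses m.
Proof. by move=> dD mM nd; rewrite inE neq_DM // adj_sym. Qed.

(** The only obstacle is a vertex of M missed by both. It misses [e], [a] and [b], so |M| >= 3, and
    [a] and [b] see all the rest of M. *)
Lemma distinct_nbrs a b : a \in D1 -> b \in D1 -> a != b ->
  exists g g', [/\ g \in M, g' \in M, g != g', G a g & G b g'].
Proof.
move=> aD bD ab; have /card_gt1P[m1 [m2 [m1M m2M m12]]] := M2.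
have both m m' : m \in M -> m' \in M -> m != m' -> ~~ G a m -> ~~ G b m ->
    exists g g', [/\ g \in M, g' \in M, g != g', G a g & G b g'].
  move=> mM m'M mm' na nb.
  have M3 : 2 < #|M|.
    apply: (@misses_max m [:: e; a; b]).
      by rewrite /= !inE negb_or !D_neq ?D1_D // ab.
    by move=> u; rewrite in_cons !inE => /or3P[] /eqP ->;
      [have := e_miss mM | have := D_miss (D1_D aD) mM na
      | have := D_miss (D1_D bD) mM nb]; rewrite inE.
  have [m3 [m3M m3m m3m']] := third_M m m' M3.
  exists m', m3; split=> //; first by rewrite eq_sym.
    by have := miss_one aD mM m'M mm'; rewrite (negPf na).
  by have := miss_one bD mM m3M; rewrite (negPf nb) eq_sym; apply.
have a12 := miss_one aD m1M m2M m12; have b12 := miss_one bD m1M m2M m12.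
case a1: (G a m1); case b2: (G b m2); first by exists m1, m2.
- case a2: (G a m2); last first.
    by apply: (both m2 m1); rewrite ?a2 ?b2 // eq_sym.
  exists m2, m1; split=> //; first by rewrite eq_sym.
  by rewrite b2 orbF in b12.
- rewrite a1 /= in a12; case b1: (G b m1).
    by exists m2, m1; rewrite eq_sym.
  by apply: (both m1 m2); rewrite ?a1 ?b1.
- by rewrite a1 /= in a12; rewrite b2 orbF in b12; exists m2, m1; rewrite eq_sym.
Qed.

(** All edges between D0 and D1 and between D1 and M turn out to be present. So D0 can be threaded
    between any two vertices of D1, and any [f] in D1 serves as the hub of M. *)
Lemma isolated_nbr_halin d0 : d0 \in D -> d0 \notin D1 -> has_spanning_halin_subgraph R G.
Proof.
pose D0 := D :\: D1 => d0D d0N.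
have d0D0 : d0 \in D0 by rewrite in_setD d0N.
have D0M d m : d \in D0 -> m \in M -> G d m = false.
  rewrite in_setD => /andP[dN dD] mM; apply: contraNF dN => Gdm; apply/D1P.
  by split; [exact: D_adj | exists m].
have D0D d : d \in D0 -> d \in D by rewrite in_setD => /andP[].
have D01 d d1 : d \in D0 -> d1 \in D1 -> d != d1.
  by rewrite in_setD => /andP[dN _]; apply: contraTneq => <-.
(* [d0], [d1] and a missed [m] are not independent, so d0 d1 is an edge; then the triangle d1, e, d0
   has the tail d1, m2, m. *)
have full d1 m : d1 \in D1 -> m \in M -> G d1 m.
  move=> d1D m1M; apply: contraT => n1; have /D1P[Ged1 [m2 m2M G2]] := d1D.
  have m21 : m2 != m by apply: contraNneq n1 => <-.
  have G01 : G d0 d1.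
    have := alpha2 (x := d0) (y := d1) (z := m).
    rewrite (D0M d0 m) // (negPf n1) !orbF; apply.
    rewrite /= !inE negb_or (D01 d0 d1) // (neq_DM d0D m1M).
    by rewrite (neq_DM (D1_D d1D) m1M).
  have [_ nem] := missesP m1M; have [_ nem2] := missesP m2M.
  have := no_Z2 Z2_free (a := d1) (b := e) (c := d0) (d := m2) (e := m).
  rewrite [G d1 e]adj_sym [G d1 d0]adj_sym Ged1 D_adj // G01 G2 M_clique //.
  by rewrite (negPf n1) nem nem2 (D0M d0 m) // (D0M d0 m2) // => /(_ isT isT isT isT isT).
(* Otherwise the triangle d1, m1, m2 has the tail d1, e, d. *)
have join d d1 : d \in D0 -> d1 \in D1 -> G d d1.
  move=> dD d1D; apply: contraT => nd; have /card_gt1P[m1 [m2 [m1M m2M m12]]] := M2.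
  have [_ ne1] := missesP m1M; have [_ ne2] := missesP m2M.
  have := no_Z2 Z2_free (a := d1) (b := m1) (c := m2) (d := e) (e := d).
  rewrite (full d1 m1) // (full d1 m2) // (M_clique m1M m2M m12) [G d1 e]adj_sym.
  rewrite (D_adj (D1_D d1D)) (D_adj (D0D _ dD)).
  rewrite [G d1 d]adj_sym (negPf nd) [G m1 e]adj_sym [G m2 e]adj_sym ne1 ne2.
  rewrite [G m1 d]adj_sym [G m2 d]adj_sym (D0M d m1) // (D0M d m2) //.
  by move=> /(_ isT isT isT isT isT).
have clD0 : clique G D0.
  case/set0Pn: M_n0 => m mM u v uD vD uv.
  have := alpha2 (x := u) (y := v) (z := m); rewrite (D0M u m) // (D0M v m) // !orbF; apply.
  rewrite /= !inE negb_or uv (neq_DM (D0D _ uD) mM).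
  by rewrite (neq_DM (D0D _ vD) mM).
have D1_3 := D1_ge3 M_n0.
have /card_gt0P[f fD1] : 0 < #|D1| by exact: ltnW (ltnW _).
have D1f : 1 < #|D1 :\ f| by move: D1_3; rewrite (cardsD1 f D1) fD1.
have splitD v : (f == v) + (v \in D0) + (v \in D1 :\ f) = (v \in D) :> nat.
  rewrite in_setD in_setD1 [f == v]eq_sym; case: (eqVneq v f) => [->|_] /=.
    by rewrite fD1 (D1_D fD1).
  by case: (boolP (v \in D1)) => [/D1_D -> //|_]; case: (v \in D).
have splitD0 v : (d0 == v) + (v \in D0 :\ d0) = (v \in D0) :> nat.
  by rewrite in_setD1 [d0 == v]eq_sym; case: (eqVneq v d0) => [->|_]; rewrite ?d0D0.
have clD0' : clique G (D0 :\ d0).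
  by move=> u v; rewrite !in_setD1 => /andP[_ uD] /andP[_ vD]; exact: clD0.
(* A Hamilton path of D minus [f] with both ends in D1, where it attaches to M. D0 is inserted after
   the first vertex of a path of D1 minus [f], or between its two cliques. *)
have [h [P [Pcnt Ppath hD1 lD1 Pn]]] : exists h P, [/\
    forall v, (f == v) + count_mem v (h :: P) = (v \in D) :> nat,
    path G h P, h \in D1, last h P \in D1 & P != [::]].
  have [[p [uniq_p mem_p srt]]|[C1 [C2 [CE C12 [C1n C2n] [cl1 cl2] no]]]] :=
    hamilton_path_or_split alpha2 (D1 :\ f).
    have size_p : 1 < size p by rewrite (seq_card uniq_p mem_p).
    case: p uniq_p mem_p srt size_p => [//|h [//|h' r]] uniq_p mem_p srt _.
    have inD1 v : v \in [:: h, h' & r] -> v \in D1.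
      by rewrite mem_p in_setD1 => /andP[].
    have hD : h \in D1 by rewrite inD1 // mem_head.
    have h'D : h' \in D1 by rewrite inD1 // !inE eqxx orbT.
    exists h, (d0 :: enum (D0 :\ d0) ++ h' :: r); split=> //.
    - move=> v; rewrite -splitD -splitD0 -(count_of v uniq_p mem_p) /= count_cat count_enum /=.
      by clear; lia.
    - rewrite /= [G h d0]adj_sym join //=; apply: block_path => //.
      + by move=> _; exact: join.
      + move=> u; rewrite in_setD1 => /andP[ud uD]; apply: clD0 => //.
        by rewrite eq_sym.
      + by move=> u; rewrite in_setD1 => /andP[_ uD]; exact: join.
      + by move: srt => /= /andP[].
    - by rewrite /= last_cat /= inD1 // in_cons mem_last orbT.
  case/set0Pn: C1n => c1 c1C; case/set0Pn: C2n => c2 c2C.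
  have inC1 v : v \in C1 -> v \in D1.
    move=> vC; have : v \in D1 :\ f by rewrite -CE inE vC.
    by rewrite in_setD1 => /andP[].
  have inC2 v : v \in C2 -> v \in D1.
    move=> vC; have : v \in D1 :\ f by rewrite -CE inE vC orbT.
    by rewrite in_setD1 => /andP[].
  exists c1, (enum (C1 :\ c1) ++ d0 :: enum (D0 :\ d0) ++ c2 :: enum (C2 :\ c2)).
  split=> //.
  - move=> v; rewrite -splitD -splitD0 /= count_cat /= count_cat /= !count_enum.
    have -> : (v \in D1 :\ f) = (c1 == v) + (v \in C1 :\ c1)
        + ((c2 == v) + (v \in C2 :\ c2)) :> nat.
      have -> : (c1 == v) + (v \in C1 :\ c1) = (v \in C1).
        by rewrite in_setD1 [c1 == v]eq_sym; case: (eqVneq v c1) => [->|_]; rewrite ?c1C.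
      have -> : (c2 == v) + (v \in C2 :\ c2) = (v \in C2).
        by rewrite in_setD1 [c2 == v]eq_sym; case: (eqVneq v c2) => [->|_]; rewrite ?c2C.
      rewrite -CE inE; have : (v \in C1 :&: C2) = false by rewrite C12 inE.
      by rewrite inE; case: (v \in C1); case: (v \in C2).
    by clear; lia.
  - apply: block_path.
    + by move=> _; rewrite adj_sym join // inC1.
    + move=> u; rewrite in_setD1 => /andP[uc uC]; apply: cl1 => //.
      by rewrite eq_sym.
    + by move=> u; rewrite in_setD1 => /andP[_ uC]; rewrite adj_sym join // inC1.
    + by move=> u v; rewrite !in_setD1 => /andP[_ uC] /andP[_ vC]; exact: cl1.
    apply: block_path => //.
    + by move=> _; rewrite join // inC2.
    + move=> u; rewrite in_setD1 => /andP[ud uD]; apply: clD0 => //.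
      by rewrite eq_sym.
    + by move=> u; rewrite in_setD1 => /andP[_ uD]; rewrite join // inC2.
    apply: (clique_sorted cl2 (l := c2 :: _)).
      by rewrite /= mem_enum in_setD1 eqxx enum_uniq.
    by move=> v; rewrite inE mem_enum in_setD1 => /predU1P[->|/andP[]].
  - exact: inC1.
  - rewrite last_cat /= last_cat /=; apply: inC2.
    have := mem_last c2 (enum (C2 :\ c2)).
    by rewrite in_cons mem_enum in_setD1 => /predU1P[->|/andP[]].
  - by case: (enum _).
apply: (@simple_frame_halin _ R G [:: (e, h :: P); (f, enum M)]); split => //.
- apply: count_mem1_cover => v; have := parts v; rewrite -Pcnt.
  by rewrite /hubs /leaves /= cats0 count_cat count_enum; clear; lia.
- by rewrite /= D_adj // D1_D.
- have inD v : v \in h :: P -> G e v.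
    move=> vP; apply: D_adj; have := Pcnt v.
    have : 0 < count_mem v (h :: P) by rewrite -has_count has_pred1.
    by case: (v \in D) => //; clear; lia.
  rewrite /= andbT inD ?mem_head //=; apply/andP; split.
    by apply/allP => v vP; apply: inD; rewrite inE vP orbT.
  by apply/allP => v; rewrite mem_enum; exact: full.
- split; last first.
    rewrite /leaves /= cats0 size_cat -cardE; move: M2 Pn; case: (P) => //= a l.
    by clear; lia.
  rewrite /leaves /= cats0 rcons_cat cat_path Ppath /= -cats1.
  apply: block_path => //; last exact: M_clique.
  + by move=> M0; have := M_n0; rewrite M0 eqxx.
  + by move=> u uM; exact: full.
  + by move=> u uM; rewrite adj_sym full.
- case=> [|[|//]] _ /=; first by case: (P) Pn => //= a l _; clear; lia.
  by rewrite -cardE; move: M2; clear; lia.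
Qed.

(** * Every neighbour of e has a neighbour in M *)

Section AllReachM.
Hypothesis D_D1 : D \subset D1.

Let in_D1 d : d \in D -> d \in D1. Proof. exact: (subsetP D_D1). Qed.

Let D3 : 2 < #|D|.
Proof. by apply: leq_trans (D1_ge3 M_n0) _; apply/subset_leq_card/subsetP => d /D1_D. Qed.

Lemma M_minus g v : g \in M -> (g == v) + (v \in M :\ g) = (v \in M).
Proof.
by move=> gM; rewrite in_setD1 [g == v]eq_sym; case: (eqVneq v g) => [->|_]; rewrite ?gM.
Qed.

Lemma M_minus_clique g : clique G (M :\ g).
Proof. by move=> u v; rewrite !in_setD1 => /andP[_ uM] /andP[_ vM]; exact: M_clique. Qed.

(** [f] is the hub of M and [e] the hub of the remaining path; [distinct_nbrs] lets the rim enter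
    and leave M at different vertices. *)
Lemma full_end_halin f p1 r : uniq [:: f, p1 & r] -> [:: f, p1 & r] =i D ->
  path G p1 r -> r != [::] -> {in M, forall m, G f m} -> has_spanning_halin_subgraph R G.
Proof.
move=> uniq_p mem_p pth r0 full.
have inD v : v \in [:: f, p1 & r] -> v \in D by rewrite mem_p.
have p1D : p1 \in D by rewrite inD // !inE eqxx orbT.
have lD : last p1 r \in D by rewrite inD // in_cons mem_last orbT.
have p1l : p1 != last p1 r.
  case: r uniq_p r0 {mem_p pth inD lD} => [//|a l] /= /and3P[_ p1N _] _.
  by apply: contraNneq p1N => ->; rewrite mem_last.
have [m' [m [m'M mM mm' Gpm' Glm]]] := distinct_nbrs (in_D1 p1D) (in_D1 lD) p1l.
have [|l [uniq_l mem_l pth_l last_l]] := clique_order M_clique mM m'M.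
  by move=> e1; rewrite e1 eqxx in mm'.
have size_l := seq_card uniq_l mem_l.
apply: (@simple_frame_halin _ R G [:: (f, m :: l); (e, p1 :: r)]); split => //.
- apply: count_mem1_cover => v; have := parts v.
  rewrite -(count_of v uniq_p mem_p) -(count_of v uniq_l mem_l).
  by rewrite /hubs /leaves /= cats0 count_cat /=; clear; lia.
- by rewrite /= [G f e]adj_sym D_adj // inD // mem_head.
- rewrite /= full // D_adj //= andbT; apply/andP; split; apply/allP => v vl.
    by apply: full; rewrite -mem_l inE vl orbT.
  by apply/D_adj/inD; rewrite !inE vl !orbT.
- split; last first.
    rewrite /leaves /= cats0 size_cat /=; move: M2 r0; rewrite -size_l.
    by case: (r) => //= a r'; clear; lia.
  rewrite /leaves /= cats0 rcons_cat cat_path pth_l last_l /=.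
  by rewrite adj_sym Gpm' rcons_path pth.
- case=> [|[|//]] _ /=; first by move: M2; rewrite -size_l /=; clear; lia.
  by case: (r) r0 => //= a r' _; clear; lia.
Qed.

(** For [f] missing part of M: a vertex [g] of M becomes the hub of M, and [f], between [g] and [e]
    on the spine, needs only the leaf [p1]. *)
Lemma three_hubs_halin f p1 r g m m' : uniq [:: f, p1 & r] -> [:: f, p1 & r] =i D ->
  path G f (p1 :: r) -> 1 < size r -> g \in M -> m \in M -> m' \in M ->
  uniq [:: g; m'; m] -> G f g -> G p1 m' -> G (last p1 r) m ->
  has_spanning_halin_subgraph R G.
Proof.
move=> uniq_p mem_p /= /andP[Gfp pth] r2 gM mM m'M.
rewrite /= !inE !negb_or !andbT => /andP[/andP[gm' gm] m'm] Gfg Gpm Glm.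
have inD v : v \in [:: f, p1 & r] -> v \in D by rewrite mem_p.
have mMg : m \in M :\ g by rewrite in_setD1 eq_sym gm.
have m'Mg : m' \in M :\ g by rewrite in_setD1 eq_sym gm'.
have [|l [uniq_l mem_l pth_l last_l]] := clique_order (@M_minus_clique g) mMg m'Mg.
  by move=> e1; rewrite e1 eqxx in m'm.
have l0 : 0 < size l.
  by case: l last_l {uniq_l mem_l pth_l} => //= e1; rewrite e1 eqxx in m'm.
apply: (@simple_frame_halin _ R G [:: (g, m :: l); (f, [:: p1]); (e, r)]); split => //.
- apply: count_mem1_cover => v; have := parts v; rewrite -(M_minus v gM).
  rewrite -(count_of v uniq_p mem_p) -(count_of v uniq_l mem_l).
  by rewrite /hubs /leaves /= cats0 count_cat /=; clear; lia.
- by rewrite /= adj_sym Gfg adj_sym D_adj // inD // mem_head.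
- rewrite /= Gfp /= andbT; have inM v : v \in m :: l -> G g v.
    rewrite mem_l in_setD1 => /andP[vg vM]; apply: M_clique => //.
    by rewrite eq_sym.
  rewrite inM ?mem_head //=; apply/andP; split; apply/allP => v vl.
    by apply: inM; rewrite inE vl orbT.
  by apply/D_adj/inD; rewrite !inE vl !orbT.
- split; last by rewrite /leaves /= cats0 size_cat /=; move: r2; clear; lia.
  rewrite /leaves /= cats0 rcons_cat cat_path pth_l last_l /=.
  by rewrite adj_sym Gpm rcons_path pth.
- by case=> [|[|[|//]]] _ /=; move: l0 r2; clear; lia.
Qed.

(** Three vertices in D leave too few leaves for [e] as a third hub, so [e] goes on the rim between
    [p1] and [p2]. *)
Lemma leaf_e_halin f p1 p2 g m m' : uniq [:: f; p1; p2] -> [:: f; p1; p2] =i D ->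
  G f p1 -> g \in M -> m \in M -> m' \in M -> uniq [:: g; m; m'] ->
  G f g -> G p2 g -> G p2 m -> G p1 m' -> has_spanning_halin_subgraph R G.
Proof.
move=> uniq_p mem_p Gfp gM mM m'M.
rewrite /= !inE !negb_or !andbT => /andP[/andP[gm gm'] mm'] Gfg Gpg Gpm Gpm'.
have inD v : v \in [:: f; p1; p2] -> v \in D by rewrite mem_p.
have fD : f \in D by rewrite inD // !inE eqxx.
have p1D : p1 \in D by rewrite inD // !inE eqxx orbT.
have p2D : p2 \in D by rewrite inD // !inE eqxx !orbT.
have mMg : m \in M :\ g by rewrite in_setD1 eq_sym gm.
have m'Mg : m' \in M :\ g by rewrite in_setD1 eq_sym gm'.
have [|l [uniq_l mem_l pth_l last_l]] := clique_order (@M_minus_clique g) mMg m'Mg.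
  by move=> e1; rewrite e1 eqxx in mm'.
apply: (@simple_frame_halin _ R G [:: (f, [:: p1; e]); (g, p2 :: m :: l)]); split => //.
- apply: count_mem1_cover => v; have := parts v; rewrite -(M_minus v gM).
  rewrite -(count_of v uniq_p mem_p) -(count_of v uniq_l mem_l).
  by rewrite /hubs /leaves /= cats0; clear; lia.
- by rewrite /= Gfg.
- have inM v : v \in m :: l -> G g v.
    rewrite mem_l in_setD1 => /andP[vg vM]; apply: M_clique => //.
    by rewrite eq_sym.
  rewrite /= Gfp [G f e]adj_sym D_adj // [G g p2]adj_sym Gpg inM ?mem_head //= andbT.
  by apply/allP => v vl; apply: inM; rewrite inE vl orbT.
- split=> //; rewrite /leaves /= cats0 [G p1 e]adj_sym !D_adj // Gpm.
  by rewrite rcons_path pth_l last_l adj_sym Gpm'.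
- by case=> [|[|//]] _ /=; clear; lia.
Qed.

(** A vertex [m] of M missed by all three also misses [e], so |M| >= 4. By [miss_one] the three then
    see all of M except [m], and any three other vertices will do. *)
Lemma triple_M a b c : uniq [:: a; b; c] -> a \in D -> b \in D -> c \in D -> 2 < #|M| ->
  exists m1 m2 m3, [/\ uniq [:: m1; m2; m3], {subset [:: m1; m2; m3] <= M} &
    forall m, m \in [:: m1; m2; m3] -> [|| G a m, G b m | G c m]].
Proof.
move=> uabc aD bD cD M3; have /card_gt1P[m1 [m2 [m1M m2M m12]]] := M2.
have [m3 [m3M m31 m32]] := third_M m1 m2 M3.
have sys n1 n2 n3 : n1 \in M -> n2 \in M -> n3 \in M -> n1 != n2 -> n3 != n1 -> n3 != n2 ->
    uniq [:: n1; n2; n3] /\ {subset [:: n1; n2; n3] <= M}.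
  move=> h1 h2 h3 h12 h31 h32; split.
    by rewrite /= !inE negb_or h12 ![_ == n3]eq_sym h31 h32.
  by move=> u; rewrite !in_cons in_nil orbF => /or3P[] /eqP ->.
have [m m_in|ok] := pickP (fun m => (m \in [:: m1; m2; m3]) &&
    [&& ~~ G a m, ~~ G b m & ~~ G c m]); last first.
  have [u_sys sub_sys] := sys m1 m2 m3 m1M m2M m3M m12 m31 m32.
  exists m1, m2, m3; split=> // m m_in; have := ok m; rewrite m_in /=.
  by case: (G a m); case: (G b m); case: (G c m).
have [u_sys sub_sys] := sys m1 m2 m3 m1M m2M m3M m12 m31 m32.
case/andP: m_in => m_in /and3P[na nb nc]; have mM := sub_sys m m_in.
have M4 : 3 < #|M|.
  apply: (@misses_max m [:: e; a; b; c]).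
    by rewrite cons_uniq uabc andbT !inE !negb_or !D_neq.
  by move=> u; rewrite in_cons => /predU1P[->|]; [exact: e_miss|];
    rewrite !in_cons in_nil orbF => /or3P[] /eqP ->; apply: D_miss.
have Mm : 2 < #|M :\ m| by move: M4; rewrite (cardsD1 m M) mM.
have /card_gt1P[n1 [n2 [n1M n2M n12]]] : 1 < #|M :\ m| by exact: ltnW.
have [n3] : exists n3, n3 \in M :\ m :\: [set n1; n2].
  apply/card_gt0P; have := cardsID [set n1; n2] (M :\ m).
  have : #|(M :\ m) :&: [set n1; n2]| <= 2.
    by apply: leq_trans (subset_leq_card (subsetIr _ _)) _; rewrite cards2; case: (_ != _).
  by move: Mm; clear; lia.
rewrite !inE negb_or => /andP[/andP[n31 n32] /and3P[n3m n3e Gn3]].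
have n3M : n3 \in M by rewrite inE n3e Gn3.
move: n1M n2M; rewrite !in_setD1 => /andP[n1m n1M] /andP[n2m n2M].
have [u_n sub_n] := sys n1 n2 n3 n1M n2M n3M n12 n31 n32.
exists n1, n2, n3; split=> // n n_in; have nM := sub_n n n_in.
have nm : m != n.
  by move: n_in; rewrite !inE => /or3P[] /eqP ->; rewrite eq_sym.
by have := miss_one (in_D1 aD) mM nM nm; rewrite (negPf na) /= => ->.
Qed.

Lemma hamilton_path_halin f p1 r : uniq [:: f, p1 & r] -> [:: f, p1 & r] =i D ->
  path G f (p1 :: r) -> has_spanning_halin_subgraph R G.
Proof.
move=> uniq_p mem_p pth; have size_p := seq_card uniq_p mem_p.
have inD v : v \in [:: f, p1 & r] -> v \in D by rewrite mem_p.
have r0 : r != [::] by move: D3; rewrite -size_p; case: (r).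
have fD : f \in D by rewrite inD // mem_head.
have p1D : p1 \in D by rewrite inD // !inE eqxx orbT.
have lr : last p1 r \in r by case: (r) r0 => //= a l _; exact: mem_last.
have lD : last p1 r \in D by rewrite inD // !inE lr !orbT.
have [fN p1N uniq_r] : [/\ f \notin p1 :: r, p1 \notin r & uniq r].
  by move: uniq_p; rewrite cons_uniq cons_uniq => /and3P[].
have fl : f != last p1 r by apply: contraNneq fN => ->; rewrite inE lr orbT.
have p1l : p1 != last p1 r by apply: contraNneq p1N => {1}->.
have fp1 : f != p1 by apply: contraNneq fN => ->; rewrite mem_head.
have /andP[Gfp pth1] : G f p1 && path G p1 r by [].
have [m0 /andP[m0M nfm0]|full] := pickP (fun m => (m \in M) && ~~ G f m); last first.
  apply: (full_end_halin uniq_p mem_p) => // m mM.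
  by have := full m; rewrite mM /= => /negbFE.
case: (leqP 3 #|M|) => [M3|M_le2].
  have uniq3 : uniq [:: f; p1; last p1 r].
    by rewrite /= !inE negb_or fp1 fl p1l.
  have [m1 [m2 [m3 [u_m sub_m ok]]]] := triple_M uniq3 fD p1D lD M3.
  have m1M : m1 \in M by rewrite sub_m // !inE eqxx.
  have m2M : m2 \in M by rewrite sub_m // !inE eqxx orbT.
  have m3M : m3 \in M by rewrite sub_m // !inE eqxx !orbT.
  have [n12 n13 n23] : [/\ m1 != m2, m1 != m3 & m2 != m3].
    by move: u_m; rewrite /= !inE negb_or andbT => /andP[/andP[-> ->] ->].
  have col1 : [|| G f m1, G p1 m1 | G (last p1 r) m1] by rewrite ok // !inE eqxx.
  have col2 : [|| G f m2, G p1 m2 | G (last p1 r) m2] by rewrite ok // !inE eqxx orbT.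
  have col3 : [|| G f m3, G p1 m3 | G (last p1 r) m3] by rewrite ok // !inE eqxx !orbT.
  have row d : d \in D -> [&& G d m1 || G d m2, G d m1 || G d m3 & G d m2 || G d m3].
    by move=> /in_D1 dD; rewrite !miss_one.
  have uq (a b c : V) : a != b -> a != c -> b != c -> uniq [:: a; b; c].
    by move=> ab ac bc; rewrite /= !inE negb_or ab ac bc.
  have [n21 n31 n32] : [/\ m2 != m1, m3 != m1 & m3 != m2].
    by rewrite ![_ == m1]eq_sym [m3 == _]eq_sym.
  (* The table of [f], [p1] and the last vertex against m1, m2, m3 has at most one gap in each row
     and no empty column. Distinct attachments are found by running through all such tables and the
     six orders. *)
  move: (row _ fD) (row _ p1D) (row _ lD) col1 col2 col3.
  case: (ltnP 1 (size r)) => [r2|r1].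
    have H g m' m : g \in M -> m' \in M -> m \in M -> uniq [:: g; m'; m] ->
        G f g -> G p1 m' -> G (last p1 r) m -> has_spanning_halin_subgraph R G.
      by move=> gM m'M mM; exact: (three_hubs_halin uniq_p mem_p pth r2).
    have := H m1 m2 m3 m1M m2M m3M (uq _ _ _ n12 n13 n23).
    have := H m1 m3 m2 m1M m3M m2M (uq _ _ _ n13 n12 n32).
    have := H m2 m1 m3 m2M m1M m3M (uq _ _ _ n21 n23 n13).
    have := H m2 m3 m1 m2M m3M m1M (uq _ _ _ n23 n21 n31).
    have := H m3 m1 m2 m3M m1M m2M (uq _ _ _ n31 n32 n12).
    have := H m3 m2 m1 m3M m2M m1M (uq _ _ _ n32 n31 n21).
    case: (G f m1); case: (G f m2); case: (G f m3) => //;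
    case: (G p1 m1); case: (G p1 m2); case: (G p1 m3) => //;
    by case: (G _ m1); case: (G _ m2); case: (G _ m3) => //; auto.
  (* |D| = 3: [g] must be seen by both ends, and reversing the path lets either end provide the
     attachment [m]. *)
  case: r r1 r0 uniq_p mem_p pth
      {size_p inD lr lD fN p1N uniq_r fl p1l pth1 uniq3 ok}
    => [//|p2 [|//]] _ _ uniq_p mem_p pth /=.
  have uniq_p' : uniq [:: p2; p1; f] by rewrite -(rev_uniq [:: p2; p1; f]).
  have mem_p' : [:: p2; p1; f] =i D by move=> v; rewrite -mem_p -(mem_rev [:: p2; p1; f]).
  have Gpp : G p2 p1 by move: pth => /= /and3P[_]; rewrite adj_sym.
  have H g m m' : g \in M -> m \in M -> m' \in M -> uniq [:: g; m; m'] ->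
      G f g -> G p2 g -> G p2 m || G f m -> G p1 m' -> has_spanning_halin_subgraph R G.
    move=> gM mM m'M ugm Gfg Gpg /orP[Gpm|Gfm] Gpm'.
      exact: (leaf_e_halin uniq_p mem_p Gfp gM mM m'M ugm).
    exact: (leaf_e_halin uniq_p' mem_p' Gpp gM mM m'M ugm).
  have := H m1 m2 m3 m1M m2M m3M (uq _ _ _ n12 n13 n23).
  have := H m1 m3 m2 m1M m3M m2M (uq _ _ _ n13 n12 n32).
  have := H m2 m1 m3 m2M m1M m3M (uq _ _ _ n21 n23 n13).
  have := H m2 m3 m1 m2M m3M m1M (uq _ _ _ n23 n21 n31).
  have := H m3 m1 m2 m3M m1M m2M (uq _ _ _ n31 n32 n12).
  have := H m3 m2 m1 m3M m2M m1M (uq _ _ _ n32 n31 n21).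
  case: (G f m1); case: (G f m2); case: (G f m3) => //;
  case: (G p1 m1); case: (G p1 m2); case: (G p1 m3) => //;
  by case: (G _ m1); case: (G _ m2); case: (G _ m3) => //; auto.
(* Each vertex of D misses at most one of the two vertices of M, and each of
   these misses, besides e, at most one vertex. *)
have M_eq2 : #|M| = 2 by apply/eqP; rewrite eqn_leq M2 -ltnS M_le2.
have only m u v : m \in M -> u \in D -> v \in D -> u != v -> ~~ G u m -> G v m.
  move=> mM uD vD uv num; apply: contraT => nvm.
  have : 3 <= #|M|; last by rewrite M_eq2.
  apply: (@misses_max m [:: e; u; v]).
    by rewrite /= !inE negb_or !D_neq // uv.
  by move=> w; rewrite !in_cons in_nil orbF => /or3P[] /eqP ->;
    [exact: e_miss | apply: D_miss | apply: D_miss].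
have [m1 m1M m10] : exists2 m1, m1 \in M & m1 != m0.
  have /card_gt1P[a [b [aM bM ab]]] := M2.
  case: (eqVneq a m0) => [ea|]; [exists b | exists a] => //.
  by rewrite -ea eq_sym.
have M_two m : m \in M -> m = m0 \/ m = m1.
  move=> mM; case: (eqVneq m m0) => [|m0']; first by left.
  case: (eqVneq m m1) => [|m1']; first by right.
  have u3 : uniq [:: m; m0; m1] by rewrite /= !inE negb_or m0' m1' eq_sym m10.
  have : size [:: m; m0; m1] <= #|M|; last by rewrite M_eq2.
  rewrite -(card_uniqP u3).
  by apply/subset_leq_card/subsetP => u; rewrite !in_cons in_nil orbF => /or3P[] /eqP ->.
have Gfm1 : G f m1.
  by have := miss_one (in_D1 fD) m0M m1M; rewrite (negPf nfm0) eq_sym; apply.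
have Glm0 : G (last p1 r) m0 by exact: (only m0 f).
case: (boolP (G (last p1 r) m1)) => [Glm1|nlm1].
  have lrev : rev [:: f, p1 & r] = last p1 r :: rev (belast f (p1 :: r)).
    by rewrite lastI rev_rcons.
  have srev : path G (last p1 r) (rev (belast f (p1 :: r))).
    have := rev_path G f (p1 :: r); rewrite /= => ->.
    rewrite adj_sym Gfp /= (eq_path (e' := G)) //.
    by move=> u v; rewrite /= adj_sym.
  have [q1 [q2 def_q]] : exists q1 q2, rev (belast f (p1 :: r)) = q1 :: q2 /\ q2 != [::].
    have : 1 < size (rev (belast f (p1 :: r))).
      by rewrite size_rev size_belast /=; case: (r) r0.
    by case: (rev _) => [//|q1 [//|q2 q3]] _; exists q1, (q2 :: q3).
  case: def_q => def_q q20; rewrite def_q in lrev srev.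
  apply: (@full_end_halin (last p1 r) q1 q2) => //.
  - by rewrite -lrev rev_uniq.
  - by move=> v; rewrite -lrev mem_rev mem_p.
  - by move: srev => /= /andP[].
  - by move=> m /M_two[] ->.
(* [m0] already misses [e] and [f], and [m1] misses [e] and the last vertex; with |M| = 2 they miss
   nothing else. *)
have inner v : v \in D -> v != f -> v != last p1 r -> {in M, forall m, G v m}.
  move=> vD vf vl m /M_two[] ->; first by apply: (only m0 f); rewrite // eq_sym.
  by apply: (only m1 (last p1 r)); rewrite // eq_sym.
have p1full : {in M, forall m, G p1 m} by apply: inner; rewrite // eq_sym.
(* If the path closes to a cycle, it is reopened to start at [p1], which sees all of M. *)
case: (boolP (G f (last p1 r))) => [Gfl|nfl].
  case: r r0 uniq_p mem_p pth1 Gfl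
      {pth lr lD fN p1N uniq_r fl p1l Glm0 nlm1 inner inD size_p}
    => [//|p2 r] _ uniq_p mem_p pth1 Gfl.
  have perm : perm_eq (p1 :: p2 :: rcons r f) [:: f, p1, p2 & r].
    by rewrite -!rcons_cons perm_rcons.
  apply: (@full_end_halin p1 p2 (rcons r f)) => //.
  - by rewrite (perm_uniq perm).
  - by move=> v; rewrite (perm_mem perm) mem_p.
  - by move: pth1 => /= /andP[_ pth2]; rewrite rcons_path pth2 adj_sym.
  - by case: (r).
(* [f] has used up its two non-neighbours, [m0] and the last vertex. *)
have f_adj v : v \in D -> v != f -> v != last p1 r -> G f v.
  move=> vD vf vl; apply: contraT => nfv.
  have : 3 <= #|M|; last by rewrite M_eq2.
  apply: (@misses_max f [:: m0; last p1 r; v]).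
    by rewrite /= !inE negb_or [m0 == _]eq_sym neq_DM // [m0 == v]eq_sym neq_DM // eq_sym vl.
  move=> w; rewrite !in_cons in_nil orbF => /or3P[] /eqP ->; rewrite inE.
  - by rewrite eq_sym neq_DM.
  - by rewrite eq_sym fl.
  - by rewrite vf.
case: r r0 uniq_p mem_p pth1 lr lD fN p1N uniq_r fl p1l Glm0 nlm1 inner nfl f_adj inD
    {pth size_p} => [//|p2 [|p3 r]] _ uniq_p mem_p pth1 lr lD fN p1N uniq_r fl p1l
    Glm0 nlm1 inner nfl f_adj inD.
  apply: (@simple_frame_halin _ R G [:: (p1, [:: e; f; m1; m0; p2])]); split => //.
  - apply: count_mem1_cover => v; have := parts v.
    have -> : (v \in M) = (m0 == v) + (m1 == v) :> nat.
      have -> : (v \in M) = (v == m0) || (v == m1).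
        by apply/idP/orP => [/M_two[] ->|[] /eqP -> //]; [left|right].
      rewrite ![_ == v]eq_sym; case: (eqVneq v m0) => [->|//].
      by rewrite eq_sym (negPf m10).
    by rewrite -(count_of v uniq_p mem_p) /hubs /leaves /=; clear; lia.
  - rewrite /= [G p1 e]adj_sym D_adj // [G p1 f]adj_sym Gfp (p1full m0) //.
    by rewrite (p1full m1) //=; move: pth1 => /= /andP[->].
  - split=> //; rewrite /leaves /= D_adj // Gfm1 M_clique // [G m0 p2]adj_sym Glm0.
    by rewrite adj_sym D_adj.
  - by case.
(* Exchanging the first two vertices keeps a path, since [f] sees [p2], and puts [p1] at the end. *)
apply: (@full_end_halin p1 f [:: p2, p3 & r]) => //.
- by rewrite (perm_uniq (_ : perm_eq _ [:: f, p1, p2, p3 & r])) //;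
    rewrite (perm_catCA [:: p1] [:: f]).
- by move=> v; rewrite -mem_p !inE orbCA.
- move: pth1 => /= /andP[_ pth2]; rewrite f_adj //.
  + by rewrite inD // !inE eqxx !orbT.
  + by apply: contraNneq fN => <-; rewrite !inE eqxx orbT.
  + by move: uniq_r => /= /andP[p2N _]; apply: contraNneq p2N => ->; exact: mem_last.
Qed.

(** [d] is the hub of the rest of A and of [e], and [g] that of B and the rest of M. On the rim [e]
    bridges A and B, and [m'] returns to A at [q]. *)
Lemma split_hubs_halin (A B : {set V}) d q g m m' :
  A :|: B = D -> A :&: B = set0 -> B != set0 -> clique G A -> clique G B ->
  d \in A -> q \in A -> d != q -> g \in M -> m \in M :\ g -> m' \in M :\ g ->
  (m = m' -> M :\ g = [set m]) -> G d g -> G q m' ->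
  {in B, forall u, G u g} -> {in B, forall u, G u m} -> has_spanning_halin_subgraph R G.
Proof.
move=> AB AB0 B0 clA clB dA qA dq gM mMg m'Mg mm' Gdg Gqm' Bg Bm.
have AD a : a \in A -> a \in D by rewrite -AB inE => ->.
have BD b : b \in B -> b \in D by rewrite -AB inE orbC => ->.
have [l [uniq_l mem_l pth_l last_l]] := clique_order (@M_minus_clique g) mMg m'Mg mm'.
have inM v : v \in m :: l -> G g v.
  rewrite mem_l in_setD1 => /andP[vg vM]; apply: M_clique => //.
  by rewrite eq_sym.
pose C := A :\ d :\ q.
have CA v : v \in C -> [/\ v \in A, v != d & v != q].
  by rewrite !in_setD1 => /and3P[].
have splitD v : (d == v) + (q == v) + (v \in C) + (v \in B) = (v \in D) :> nat.
  have : (v \in A :&: B) = false by rewrite AB0 inE.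
  rewrite -AB in_setU in_setI !in_setD1 ![_ == v]eq_sym.
  case: (eqVneq v d) => [->|vd]; first by rewrite dA (negPf dq); case: (d \in B).
  case: (eqVneq v q) => [->|vq]; rewrite ?qA; first by case: (q \in B).
  by case: (v \in A); case: (v \in B).
apply: (@simple_frame_halin _ R G
  [:: (d, q :: enum C ++ [:: e]); (g, enum B ++ m :: l)]); split => //.
- apply: count_mem1_cover => v; have := parts v; rewrite -(M_minus v gM) -splitD.
  rewrite -(count_of v uniq_l mem_l) /hubs /leaves /= cats0 !count_cat /=.
  by rewrite ?count_cat !count_enum /=; clear; lia.
- by rewrite /= Gdg.
- rewrite /= !all_cat /= clA // [G d e]adj_sym (D_adj (AD _ dA)) inM ?mem_head //= !andbT.
  apply/and3P; split; apply/allP => v.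
  + by rewrite mem_enum => /CA[vA vd _]; apply: clA; rewrite // eq_sym.
  + by rewrite mem_enum => vB; rewrite adj_sym Bg.
  + by move=> vl; apply: inM; rewrite inE vl orbT.
- split; last first.
    rewrite /leaves /= cats0 !size_cat /=.
    by move: (size (enum C)) (size (enum B)) (size l); clear; lia.
  rewrite /leaves /= cats0 -catA /= rcons_cat /= rcons_cat /=.
  apply: block_path.
  + by move=> _; rewrite adj_sym (D_adj (AD _ qA)).
  + by move=> u /CA[uA _ uq]; apply: clA; rewrite // eq_sym.
  + by move=> u /CA[uA _ _]; rewrite adj_sym (D_adj (AD _ uA)).
  + by move=> u v /CA[uA _ _] /CA[vA _ _]; exact: clA.
  apply: block_path => //.
  + by move=> e1; rewrite e1 eqxx in B0.
  + by move=> u uB; apply/D_adj/BD.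
  by rewrite rcons_path pth_l last_l adj_sym.
- have B1 : 0 < size (enum B) by rewrite -cardE card_gt0.
  case=> [|[|//]] _ /=; rewrite !size_cat /=; first by move: (size (enum _)); clear; lia.
  by move: B1; clear; lia.
Qed.

Lemma split_halin (A B : {set V}) : A :|: B = D -> A :&: B = set0 -> 1 < #|A| ->
  B != set0 -> clique G A -> clique G B -> {in A & B, forall u v, G u v = false} ->
  has_spanning_halin_subgraph R G.
Proof.
move=> AB AB0 /card_gt1P[d [q [dA qA dq]]] B0 clA clB no.
have AD a : a \in A -> a \in D by rewrite -AB inE => ->.
have BD b : b \in B -> b \in D by rewrite -AB inE orbC => ->.
have neqAB a b : a \in A -> b \in B -> a != b.
  move=> aA bB; apply/eqP => e1; have : a \in A :&: B by rewrite inE aA e1.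
  by rewrite AB0 inE.
have [f /andP[fB /existsP[m0 /andP[m0M nf0]]]|full] :=
    pickP (fun f => (f \in B) && [exists m in M, ~~ G f m]); last first.
  have {}full u m : u \in B -> m \in M -> G u m.
    move=> uB mM; apply: contraT => num; have := full u; rewrite uB /=.
    by move/existsP; case; exists m; rewrite mM.
  have [g [m' [gM m'M gm' Gdg Gqm']]] :=
    distinct_nbrs (in_D1 (AD _ dA)) (in_D1 (AD _ qA)) dq.
  have m'Mg : m' \in M :\ g by rewrite in_setD1 eq_sym gm'.
  have [m mMg mm'] : exists2 m, m \in M :\ g & m = m' -> M :\ g = [set m].
    case: (leqP 3 #|M|) => [M3|M_le2].
      have [m [mM mg mm']] := third_M g m' M3.
      by exists m; [rewrite in_setD1 mg | move=> e1; rewrite e1 eqxx in mm'].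
    exists m' => // _; apply/esym/eqP; rewrite eqEcard sub1set m'Mg cards1.
    by move: M_le2; rewrite (cardsD1 g M) gM.
  apply: (split_hubs_halin AB AB0 B0 clA clB dA qA dq gM mMg m'Mg mm' Gdg Gqm').
    by move=> u uB; exact: full.
  by move=> u uB; apply: full => //; move: mMg; rewrite in_setD1 => /andP[].
have A0 a : a \in A -> G a m0.
  move=> aA; have := alpha2 (x := m0) (y := f) (z := a).
  rewrite [G m0 f]adj_sym (negPf nf0) [G f a]adj_sym (no a f) // orbF adj_sym; apply.
  rewrite /= !inE negb_or ![m0 == _]eq_sym (neq_DM (BD _ fB) m0M) (neq_DM (AD _ aA) m0M).
  by rewrite eq_sym (neqAB a f).
have [_ nem0] := missesP m0M.
(* A second vertex [u] of B gives a Z2: the triangle m0, d, q with tail m0, u, f if [u] sees [m0],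
   and the triangle e, f, u with tail e, d, m0 if not. *)
have B1 u : u \in B -> u = f.
  move=> uB; apply: contraTeq isT => uf.
  have Guf : G u f by exact: clB.
  case Gu0: (G u m0).
    have := no_Z2 Z2_free (a := m0) (b := d) (c := q) (d := u) (e := f).
    rewrite ![G m0 _]adj_sym (A0 d) // (A0 q) // (clA d q) // Gu0 Guf (negPf nf0).
    by rewrite (no d u) // (no q u) // (no d f) // (no q f) // => /(_ isT isT isT isT isT).
  have := no_Z2 Z2_free (a := e) (b := f) (c := u) (d := d) (e := m0).
  rewrite (D_adj (BD _ fB)) (D_adj (BD _ uB)) (D_adj (AD _ dA)) A0 // nem0 (negPf nf0) Gu0.
  rewrite [G f u]adj_sym Guf [G f d]adj_sym [G u d]adj_sym (no d f) // (no d u) //.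
  by move=> /(_ isT isT isT isT isT).
(* [f] misses [d], [q] and [m0]. All of A sees [m0], which attaches [q]; two more vertices of M
   serve as [g] and as the attachment of [f]. *)
have M3 : 2 < #|M|.
  apply: (@misses_max f [:: d; q; m0]).
    by rewrite /= !inE negb_or dq (neq_DM (AD _ dA) m0M) (neq_DM (AD _ qA) m0M).
  move=> w; rewrite !in_cons in_nil orbF => /or3P[] /eqP ->; rewrite inE.
  - by rewrite neqAB // adj_sym no.
  - by rewrite neqAB // adj_sym no.
  - by rewrite eq_sym (neq_DM (BD _ fB) m0M).
have [n1 [n1M n10 _]] := third_M m0 m0 M3.
have [n2 [n2M n20 n21]] := third_M m0 n1 M3.
have Gf n : n \in M -> n != m0 -> G f n.
  move=> nM n0; have := miss_one (in_D1 (BD _ fB)) m0M nM.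
  by rewrite (negPf nf0) eq_sym; apply.
have fin g m : g \in M -> m \in M -> g != m0 -> m != m0 -> m != g -> G d g ->
    has_spanning_halin_subgraph R G.
  move=> gM mM g0 m_0 mg Gdg.
  apply: (@split_hubs_halin A B d q g m m0) => //.
  - by rewrite in_setD1 mg.
  - by rewrite in_setD1 eq_sym g0.
  - by move=> e1; rewrite e1 eqxx in m_0.
  - exact: A0.
  - by move=> u /B1 ->; exact: Gf.
  - by move=> u /B1 ->; exact: Gf.
have := miss_one (in_D1 (AD _ dA)) n1M n2M; rewrite eq_sym n21 => /(_ isT) /orP[Gd|Gd].
  exact: (fin n1 n2).
by apply: (fin n2 n1); rewrite // eq_sym.
Qed.

End AllReachM.

End TwoMisses.

Lemma max_misses_halin : has_spanning_halin_subgraph R G.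
Proof.
case: (ltngtP #|M| 1) => [|M2|]; last exact: one_miss_halin.
  by rewrite ltnS leqn0 cards_eq0 => /eqP; exact: complete_halin.
have M_n0 : M != set0 by rewrite -card_gt0 ltnW.
case: (boolP (D \subset D1)) => [D_D1|]; last first.
  by case/subsetPn => d0 d0D d0N; exact: (isolated_nbr_halin M2 d0D d0N).
have D3 : 2 < #|D|.
  by apply: leq_trans (D1_ge3 M_n0) _; apply/subset_leq_card/subsetP => d /D1_D.
have [[p [uniq_p mem_p srt]]|[C1 [C2 [CE C12 [C1n C2n] [cl1 cl2] no]]]] :=
  hamilton_path_or_split alpha2 D.
  have size_p : 2 < size p by rewrite (seq_card uniq_p mem_p).
  case: p uniq_p mem_p srt size_p => [//|f [//|p1 r]] uniq_p mem_p srt _.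
  exact: (hamilton_path_halin M2 D_D1 uniq_p mem_p srt).
have cardD : #|C1| + #|C2| = #|D| by rewrite -cardsUI CE C12 cards0 addn0.
case: (leqP #|C1| 1) => C1s; last exact: (split_halin M2 D_D1 CE C12 C1s).
apply: (@split_halin M2 D_D1 C2 C1); rewrite // 1?setUC 1?setIC //.
  by move: cardD D3 C1s; clear; lia.
by move=> u v uC vC; rewrite adj_sym no.
Qed.

End MaxMisses.

Lemma alpha2_halin : has_spanning_halin_subgraph R G.
Proof.
have [n4 _] := G3; have /card_gt0P[x0 _] : 0 < #|V| by exact: leq_trans n4.
have [e _ e_max] := @arg_maxnP V x0 xpredT (fun v => #|misses v|) isT.
by apply: (@max_misses_halin e) => v; exact: e_max.
Qed.

End Alpha2.

(** [y] lies outside the ball of radius 2 around [x], so by connectedness some edge leaves this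
    ball. Its outer end is at distance 3 and need not be [y]. *)
Lemma far_geodesic (V : finType) (G : sgraph V) x y : k_connected 3 G -> x != y ->
  ~~ G x y -> (forall c, ~~ (G c x && G c y)) -> exists d u w, geodesic3 G x d u w.
Proof.
move=> G3 xy nxy far.
pose S := [set v | [|| v == x, G x v | [exists u, G x u && G u v]]].
have SE v : (v \in S) = [|| v == x, G x v | [exists u, G x u && G u v]] by rewrite [LHS]in_set.
have yNS : y \notin S.
  rewrite SE eq_sym (negPf xy) (negPf nxy) /=; apply/existsP => -[u /andP[Gxu Guy]].
  by have := far u; rewrite adj_sym Gxu Guy.
have [[u w] /and3P[uS Guw wNS]|closed] :=
    pickP (fun uw : V * V => [&& uw.1 \in S, G uw.1 uw.2 & uw.2 \notin S]); last first.
  case/negP: yNS; apply: (@adj_closed _ _ G3 S x); last by rewrite SE eqxx.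
  by move=> u w uS Guw; have := closed (u, w); rewrite /= uS Guw /= => /negbFE.
rewrite /= in uS Guw wNS.
have [wx nxw far_w] : [/\ w != x, ~~ G x w & forall v, G x v -> ~~ G v w].
  move: wNS; rewrite SE !negb_or => /and3P[-> -> /existsPn h]; split=> // v Gxv.
  by have := h v; rewrite Gxv.
have nxu : ~~ G x u by apply: contraTN Guw => /far_w.
have ux : u != x by apply: contraTneq Guw => ->.
move: uS; rewrite SE (negPf ux) (negPf nxu) => /existsP[d /andP[Gxd Gdu]].
exists d, u, w; split=> //; split=> //; first exact: far_w.
by move=> v; rewrite adj_sym => /far_w.
Qed.

Theorem theorem1p6 (R : realType) (V : finType) (G : sgraph V) :
  k_connected 3 G ->
  induced_free K13 G ->
  induced_free Z2 G ->
  has_spanning_halin_subgraph R G.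
Proof.
move=> G3 claw_free Z2_free.
have [[[x y] z] /and4P[uniq_xyz nxy nxz nyz]|alpha2] := pickP (fun t : V * V * V =>
    [&& uniq [:: t.1.1; t.1.2; t.2], ~~ G t.1.1 t.1.2, ~~ G t.1.1 t.2 & ~~ G t.1.2 t.2]);
  last first.
  apply: alpha2_halin => // x y z uxyz; have := alpha2 (x, y, z).
  rewrite -[X in X = false]/([&& uniq [:: x; y; z], ~~ G x y, ~~ G x z & ~~ G y z]).
  by rewrite uxyz; case: (G x y); case: (G x z); case: (G y z).
have common u v : u != v -> ~~ G u v ->
    has_spanning_halin_subgraph R G \/ exists c, G c u && G c v.
  move=> uv nuv; have [c Gc|none] := pickP (fun c => G c u && G c v).
    by right; exists c.
  left; have [|d [a [b geo]]] := far_geodesic G3 uv nuv.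
    by move=> c; rewrite none.
  exact: (geodesic_halin R G3 claw_free Z2_free geo).
have [nexy nexz neyz] : [/\ x != y, x != z & y != z].
  by move: uniq_xyz; rewrite /= !inE negb_or andbT => /andP[/andP[-> ->] ->].
have [//|[c /andP[Gcx Gcy]]] := common x y nexy nxy.
have [//|[d /andP[Gdx Gdz]]] := common x z nexz nxz.
have [//|[w /andP[Gwy Gwz]]] := common y z neyz nyz.
exact: (independent_triple_halin R G3 claw_free Z2_free uniq_xyz nxy nxz nyz
  Gcx Gcy Gdx Gdz Gwy Gwz).
Qed.
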